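(* Fix $T>0$, $\Lambda>0$ and $$0<\eta<\tfrac12,\qquad 0<\gamma<\min\{\tfrac12,2\eta\}.$$ For every $A,B\ge1$, the set $\mathcal K_{A,B}$ defined in the context (which depends only on $(\eta,\gamma,\Lambda,T,A,B)$) is compact in $\Omega$ and contained in $\mathcal G_{\mathrm{dyad}}$. The family is increasing in both parameters: $A\le A'$, $B\le B'$ imply $\mathcal K_{A,B}\subseteq\mathcal K_{A',B'}$. There are positive constants $C_\eta,c_\eta$ depending only on $\eta$, $C_\gamma,c_\gamma$ depending only on $\gamma$, and $C_{\eta,\gamma}$ depending only on $(\eta,\gamma)$, such that for all $A,B\ge1$ $$c_\Lambda(\Omega\setminus\mathcal K_{A,B})\le C_\eta e^{-c_\eta A^2}+C_\gamma e^{-c_\gamma B}.$$ The map $Q:\mathcal K_{A,B}\to C([0,T])$ is uniformly continuous, and $$\sup_{x\in\mathcal K_{A,B}}\|Q^n(x)-Q(x)\|_\infty\le C_\gamma B\Lambda T2^{-\gamma n},\qquad n\ge1,$$ and, with $\alpha=\gamma/(1-\eta+\gamma)>0$, $$\|Q(x)-Q(\widetilde x)\|_\infty\le C_{\eta,\gamma}A^\alpha B^{1-\alpha}(\Lambda T)^{1-\alpha/2}\|x-\widetilde x\|_\infty^\alpha,\qquad x,\widetilde x\in\mathcal K_{A,B}.$$ Stopping preserves each $\mathcal K_{A,B}$: if $x\in\mathcal K_{A,B}$ and $s\in[0,T]$ then $x_{\cdot\wedge s}\in\mathcal K_{A,B}$. For deterministic concatenation, there is $\kappa_\eta<\infty$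 such that, for all $A,B\ge 1$ and every $s\in[0,T]$, $$x,\widetilde x\in\mathcal K_{A,B}\quad\Longrightarrow\quad x\otimes_s\widetilde x\in\mathcal K_{2^{1-\eta}A,\,3B+\kappa_\eta A^2},$$ where $(x\otimes_s\widetilde x)_t=x_t\mathbf 1_{\{t\le s\}}+(x_s+\widetilde x_t-\widetilde x_s)\mathbf 1_{\{t>s\}}$.
   Context: $\Omega=C_0([0,T];\mathbb R)$ is the space of continuous paths with $x_0=0$, with the uniform norm $\|\cdot\|_\infty$; $X$ is the coordinate process. For $n\ge1$ let $t_k^n=kT2^{-n}$ and, for $t\in[t_j^n,t_{j+1}^n]$, $$Q^n_t(x)=\sum_{k=0}^{j-1}(x_{t^n_{k+1}}-x_{t^n_k})^2+(x_t-x_{t^n_j})^2 .$$ $\mathcal C_{\mathrm{dyad}}$ is the set of $x\in\Omega$ for which $(Q^n(x))_{n\ge1}$ is Cauchy in the uniform norm, $\widehat Q(x)$ is its uniform limit, $\mathcal G_{\mathrm{dyad}}=\{x\in\mathcal C_{\mathrm{dyad}}:\widehat Q(x)\text{ is increasing (nondecreasing) and }\widehat Q_0(x)=0\}$, and $Q=\widehat Q|_{\mathcal G_{\mathrm{dyad}}}$. $\mathfrak M_\Lambda$ is the family of all Borel probability measures $P$ on $\Omega$ such that, in the usual augmentation of its natural filtration, $X$ is a continuous local martingale with $[X]^P_t=\int_0^ta^P_s\,ds$ for a predictable $a^P$ with $0\le a^P\le\Lambda$, $P\otimes ds$-a.e.; $c_\Lambda(A)=\sup_{P\in\mathfrak M_\Lambda}P(A)$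 for Borel $A\subset\Omega$. Put $\|x\|_\eta=\sup_{0\le s<t\le T}|x_t-x_s|/|t-s|^\eta$ and $Z_\gamma(x)=\sup_{n\ge1}2^{\gamma n}\|Q^{n+1}(x)-Q^n(x)\|_\infty\in[0,\infty]$. Let $\mathcal A_\Lambda$ be the set of increasing $q\in C([0,T])$ with $q_0=0$ and $|q_t-q_s|\le\Lambda|t-s|$ for all $s,t$. Define $$D_{A,B}=\{x\in\Omega:\|x\|_\eta\le A\sqrt\Lambda\,T^{1/2-\eta},\ Z_\gamma(x)\le B\Lambda T\}\subset\mathcal C_{\mathrm{dyad}},\qquad \mathcal K_{A,B}=\{x\in D_{A,B}:\widehat Q(x)\in\mathcal A_\Lambda\}.$$ *)

(* Defs.v *)
From HB Require Import structures.
From mathcomp Require Import all_boot all_order all_algebra.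
From mathcomp Require Import all_classical all_reals all_analysis.

Set Implicit Arguments.
Unset Strict Implicit.
Unset Printing Implicit Defensive.

Import Order.TTheory GRing.Theory Num.Theory.
Import numFieldNormedType.Exports.

Local Open Scope classical_set_scope.
Local Open Scope ring_scope.

(** A continuous function on [0,T] is represented by its unique extension to
    the whole line which is constant on ]-oo, 0] and on [T, +oo[; evaluation at
    real times is then total, and two paths are equal iff they agree on
    [0,T]. *)

Definition clip (R : realType) (T : {posnum R}) (t : R) : R :=
  Num.max 0 (Num.min t T%:num).

Definition cpath_pred (R : realType) (T : {posnum R}) : {pred R -> R} :=
  mem [set f : R -> R | continuous f /\ forall t, f t = f (clip T t)].
Arguments cpath_pred {R} T : simpl never.

Record cpath (R : realType) (T : {posnum R}) := CPath {
  cpath_fun :> R -> R ;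
  cpathP : cpath_fun \in cpath_pred T }.

Section cpath_lmodule.
Context (R : realType) (T : {posnum R}).

Lemma cpath_predP (f : R -> R) :
  (f \in cpath_pred T) <-> continuous f /\ forall t, f t = f (clip T t).
Proof. by split=> [/set_mem|/mem_set]. Qed.

HB.instance Definition _ := [isSub for @cpath_fun R T].
HB.instance Definition _ := [Choice of cpath T by <:].

Lemma cpath_submod_closed : submod_closed (cpath_pred T).
Proof.
split=> [|a f g /cpath_predP[cf Ff] /cpath_predP[cg Fg]]; apply/cpath_predP.
  by split=> // x; exact: cst_continuous.
split=> [x|t]; last by rewrite !fctE /= Ff Fg.
apply: (@continuousD _ _ _ (a *: f) g); last exact: cg.
by apply: (@continuousZl_tmp _ _ _ f a); exact: cf.
Qed.

HB.instance Definition _ :=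
  GRing.isSubmodClosed.Build R (R -> R) (cpath_pred T) cpath_submod_closed.
HB.instance Definition _ := [SubChoice_isSubLmodule of cpath T by <:].

Lemma clip_itv t : clip T t \in `[0, T%:num].
Proof. by rewrite in_itv/= /clip le_max lexx /= ge_max ge0 ge_min lexx orbT. Qed.

Lemma clip_id t : t \in `[0, T%:num] -> clip T t = t.
Proof.
by rewrite in_itv/= => /andP[t0 tT]; rewrite /clip (min_idPl tT) (max_idPr t0).
Qed.

Lemma clip_clip t : clip T (clip T t) = clip T t.
Proof. exact/clip_id/clip_itv. Qed.

Lemma le_clip : {homo clip T : s t / s <= t}.
Proof. by move=> s t st; rewrite /clip ge_max !le_max lexx/= le_min !ge_min st lexx !orbT. Qed.

Lemma clip_min : {morph clip T : s t / Num.min s t}.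
Proof.
move=> s t; case: (leP s t) => st.
  by rewrite (min_idPl (le_clip st)).
by rewrite (min_idPr (le_clip (ltW st))).
Qed.

Lemma clip_max : {morph clip T : s t / Num.max s t}.
Proof.
move=> s t; case: (leP s t) => st.
  by rewrite (max_idPr (le_clip st)).
by rewrite (max_idPl (le_clip (ltW st))).
Qed.

Lemma clip0 : clip T 0 = 0.
Proof. by apply: clip_id; rewrite in_itv/= lexx ge0. Qed.

Lemma continuous_clip : continuous (clip T).
Proof.
move=> t; apply: (@continuous_max _ _ (cst 0) (fun t => Num.min t T%:num)).
  exact: cst_continuous.
apply: (@continuous_min _ _ id (cst T%:num)) => //; exact: cst_continuous.
Qed.

Lemma cpath_clip (x : cpath T) t : x (clip T t) = x t.
Proof. by have /cpath_predP[_ /(_ t)] := cpathP x. Qed.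

Lemma cpath_continuous (x : cpath T) : continuous x.
Proof. by have /cpath_predP[] := cpathP x. Qed.

Definition cpath_norm (x : cpath T) : R :=
  sup [set `|x t| | t in `[0, T%:num]].

Lemma cpath_has_sup (x : cpath T) :
  has_sup [set `|x t| | t in `[0, T%:num]].
Proof.
split; first by exists `|x 0|, 0 => //=; rewrite in_itv/= lexx ge0.
have [|c _ cmax] := @EVT_max R (fun t => `|x t|) 0 T%:num (ge0 _).
  apply: continuous_subspaceT => t.
  by apply: cvg_norm; exact: cpath_continuous.
by exists `|x c| => _ [t tT <-]; exact: cmax.
Qed.

Lemma le_cpath_norm (x : cpath T) t : `|x t| <= cpath_norm x.
Proof.
rewrite -cpath_clip; apply: ub_le_sup; first exact: (cpath_has_sup x).2.
by exists (clip T t) => //; exact: clip_itv.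
Qed.

Lemma cpath_norm_le (x : cpath T) (b : R) :
  (forall t, t \in `[0, T%:num] -> `|x t| <= b) -> cpath_norm x <= b.
Proof.
move=> xb; apply: ge_sup; first exact: (cpath_has_sup x).1.
by move=> _ [t tT <-]; exact: xb.
Qed.

Lemma cpath_normD (x y : cpath T) :
  cpath_norm (x + y) <= cpath_norm x + cpath_norm y.
Proof.
apply: cpath_norm_le => t _.
by apply: le_trans (ler_normD (x t) (y t)) _; apply: lerD; exact: le_cpath_norm.
Qed.

Lemma cpath_normZ (l : R) (x : cpath T) :
  cpath_norm (l *: x) = `|l| * cpath_norm x.
Proof.
have le (k : R) (y : cpath T) : cpath_norm (k *: y) <= `|k| * cpath_norm y.
  apply: cpath_norm_le => t _.
  have -> : (k *: y) t = k * y t by [].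
  by rewrite normrM ler_wpM2l// le_cpath_norm.
have [->|l0] := eqVneq l 0.
  rewrite normr0 mul0r; apply/le_anti/andP; split.
    by rewrite (le_trans (le _ _))// normr0 mul0r.
  by rewrite (le_trans _ (le_cpath_norm _ 0)).
apply/le_anti/andP; split; first exact: le.
rewrite mulrC -ler_pdivlMr ?normr_gt0// mulrC -normfV.
by rewrite -{1}[x](scalerK l0) le.
Qed.

Lemma cpath_norm0_eq0 (x : cpath T) : cpath_norm x = 0 -> x = 0.
Proof.
move=> x0; apply/val_inj/funext => t; apply/eqP.
by rewrite -normr_le0 -x0 le_cpath_norm.
Qed.

HB.instance Definition _ := Lmodule_isNormed.Build R (cpath T)
  cpath_normD cpath_normZ cpath_norm0_eq0.

End cpath_lmodule.

Definition Omega_pred (R : realType) (T : {posnum R}) : {pred cpath T} :=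
  [pred x : cpath T | x 0 == 0].
Arguments Omega_pred {R} T : simpl never.

Record Omega (R : realType) (T : {posnum R}) := MkOmega {
  Omega_path :> cpath T ;
  OmegaP : Omega_path \in Omega_pred T }.

Section Omega_lmodule.
Context (R : realType) (T : {posnum R}).

HB.instance Definition _ := [isSub for @Omega_path R T].
HB.instance Definition _ := [Choice of Omega T by <:].

Lemma Omega_submod_closed : submod_closed (Omega_pred T).
Proof.
split=> [|a x y /eqP x0 /eqP y0]; first by rewrite inE.
apply/eqP; change (a * x 0 + y 0 = 0); by rewrite x0 y0 mulr0 addr0.
Qed.

HB.instance Definition _ :=
  GRing.isSubmodClosed.Build R (cpath T) (Omega_pred T) Omega_submod_closed.
HB.instance Definition _ := [SubChoice_isSubLmodule of Omega T by <:].

Definition Omega_norm (x : Omega T) : R := `|Omega_path x|.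

Lemma Omega_normD (x y : Omega T) :
  Omega_norm (x + y) <= Omega_norm x + Omega_norm y.
Proof. exact: (ler_normD (Omega_path x) (Omega_path y)). Qed.

Lemma Omega_normZ (l : R) (x : Omega T) :
  Omega_norm (l *: x) = `|l| * Omega_norm x.
Proof. exact: (normrZ l (Omega_path x)). Qed.

Lemma Omega_norm0_eq0 (x : Omega T) : Omega_norm x = 0 -> x = 0.
Proof. by move=> /normr0_eq0 x0; exact/val_inj. Qed.

HB.instance Definition _ := Lmodule_isNormed.Build R (Omega T)
  Omega_normD Omega_normZ Omega_norm0_eq0.

End Omega_lmodule.

Definition dyad (R : realType) (T : {posnum R}) (n k : nat) : R :=
  k%:R * T%:num / 2 ^+ n.

(** For [t] in [0,T], [j] below is the integer such that
    [dyad T n j <= t < dyad T n j.+1]. *)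
Definition Qfun (R : realType) (T : {posnum R}) (n : nat) (x : R -> R) (t : R)
    : R :=
  let j := Num.truncn (t * 2 ^+ n / T%:num) in
  \sum_(k < j) (x (dyad T n k.+1) - x (dyad T n k)) ^+ 2
    + (x t - x (dyad T n j)) ^+ 2.

Section path_constructions.
Context (R : realType) (T : {posnum R}).

Lemma le_dyad n : {homo dyad T n : j k / (j <= k)%N >-> j <= k}.
Proof. by move=> j k jk; rewrite /dyad !ler_wpM2r ?ler_nat ?invr_ge0 ?exprn_ge0. Qed.

Lemma truncn_dyad n t : 0 <= t ->
  let j := Num.truncn (t * 2 ^+ n / T%:num) in
  dyad T n j <= t < dyad T n j.+1.
Proof.
move=> t0 /=; set j := Num.truncn _; have h0 : 0 <= t * 2 ^+ n / T%:num.
  by rewrite divr_ge0 ?mulr_ge0 ?exprn_ge0.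
have /andP[h1 h2] := truncn_itv h0.
rewrite /dyad ler_pdivrMr ?exprn_gt0// ltr_pdivlMr ?exprn_gt0//.
by rewrite -ler_pdivlMr// -ltr_pdivrMr// h1 h2.
Qed.

Lemma QfunE n (x : R -> R) t : t \in `[0, T%:num] ->
  Qfun T n x t = \sum_(0 <= k < (2 ^ n).+1)
    (x (Num.min t (dyad T n k.+1)) - x (Num.min t (dyad T n k))) ^+ 2.
Proof.
rewrite in_itv/= => /andP[t0 tT]; rewrite /Qfun.
have /= := truncn_dyad n t0; set j := Num.truncn _ => /andP[jt tj].
have jn : (j <= 2 ^ n)%N.
  rewrite -(ler_nat R) natrX.
  have h0 : 0 <= t * 2 ^+ n / T%:num by rewrite divr_ge0 ?mulr_ge0 ?exprn_ge0.
  have /andP[/le_trans-> //] := truncn_itv h0.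
  by rewrite ler_pdivrMr// mulrC ler_wpM2l ?exprn_ge0.
have tail0 : \sum_(j.+1 <= k < (2 ^ n).+1)
    (x (Num.min t (dyad T n k.+1)) - x (Num.min t (dyad T n k))) ^+ 2 = 0.
  rewrite big_nat; apply: big1 => k /andP[jk _].
  have tk : t <= dyad T n k by apply: le_trans (ltW tj) (le_dyad _ _).
  by rewrite !(min_idPl _) ?subrr ?expr0n// (le_trans tk)// le_dyad.
rewrite (@big_cat_nat _ _ _ j)//= ?(leqW jn)// (@big_ltn _ _ _ j) ?ltnS//=.
rewrite tail0 addr0 (min_idPl (ltW tj)) (min_idPr jt) big_mkord.
congr (_ + _); apply: eq_bigr => k _.
by rewrite !(min_idPr _)// (le_trans _ jt)// le_dyad// ltnW.
Qed.

Lemma Qfun_subproof n (x : cpath T) :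
  (fun t => Qfun T n x (clip T t)) \in cpath_pred T.
Proof.
apply/cpath_predP; split=> [|t]; last by rewrite (clip_id (clip_itv _ _)).
have -> : (fun t => Qfun T n x (clip T t)) =
    \sum_(0 <= k < (2 ^ n).+1) (fun t =>
      (x (Num.min (clip T t) (dyad T n k.+1)) -
       x (Num.min (clip T t) (dyad T n k))) ^+ 2).
  apply/funext => t; rewrite fct_sumE QfunE ?clip_itv//.
have cx d : continuous (fun t => x (Num.min (clip T t) d)).
  move=> t; apply: (@continuous_comp _ _ _ (fun t => Num.min (clip T t) d) x).
    apply: (@continuous_min _ _ (clip T) (cst d)); first exact: continuous_clip.
    exact: cst_continuous.
  exact: cpath_continuous.
apply: (big_ind (fun f : R -> R => continuous f)) => [t|f g cf cg t|k _ t].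
- exact: cst_continuous.
- by apply: continuousD; [exact: cf|exact: cg].
- by rewrite /continuous_at; under eq_fun do rewrite expr2; apply: cvgM; (apply: cvgB; exact: cx).
Qed.

Definition Q (n : nat) (x : cpath T) : cpath T := CPath (Qfun_subproof n x).

Lemma stop_subproof (s : R) (x : Omega T) :
  (fun t => x (Num.min t s)) \in cpath_pred T.
Proof.
apply/cpath_predP; split=> [t|t].
  apply: (@continuous_comp _ _ _ (fun t => Num.min t s) x).
    by apply: (@continuous_min _ _ id (cst s)) => //; exact: cst_continuous.
  exact: cpath_continuous.
rewrite -(cpath_clip x) -[RHS](cpath_clip x); congr (x _).
by rewrite !clip_min clip_clip.
Qed.


Lemma stop_at0 (s : R) (x : Omega T) :
  CPath (stop_subproof s x) \in Omega_pred T.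
Proof.
have /eqP x0 := OmegaP x.
apply/eqP; change (x (Num.min 0 s) = 0); rewrite -(cpath_clip x).
suff -> : clip T (Num.min 0 s) = 0 by [].
by rewrite clip_min clip0 /clip; apply/min_idPl; rewrite le_max lexx.
Qed.

Definition stop (s : R) (x : Omega T) : Omega T := MkOmega (stop_at0 s x).

Lemma concat_subproof (s : R) (x y : Omega T) :
  (fun t => if t <= s then x t else x s + y t - y s) \in cpath_pred T.
Proof.
have /eqP x0 := OmegaP x; have /eqP y0 := OmegaP y.
have E t : (if t <= s then x t else x s + y t - y s) =
    x (Num.min t s) + y (Num.max t s) - y s.
  by case: leP => ts //; rewrite addrK.
apply/cpath_predP; split=> [|t].
  have -> : (fun t => if t <= s then x t else x s + y t - y s) =
      (fun t => x (Num.min t s) + y (Num.max t s) - y s).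
    by apply/funext.
  move=> t; apply: cvgB; last exact: cvg_cst.
  apply: cvgD.
    have /cpath_predP[cx _] := stop_subproof s x; exact: cx.
  apply: (@continuous_comp _ _ _ (fun t => Num.max t s) y).
    by apply: (@continuous_max _ _ id (cst s)) => //; exact: cst_continuous.
  exact: cpath_continuous.
rewrite !E; congr (_ + _ - _).
  have /cpath_predP[_ /(_ t)] := stop_subproof s x; exact.
rewrite -(cpath_clip y) -[RHS](cpath_clip y); congr (y _).
by rewrite clip_max [RHS]clip_max clip_clip.
Qed.

Lemma concat_at0 (s : R) (x y : Omega T) :
  CPath (concat_subproof s x y) \in Omega_pred T.
Proof.
have /eqP x0 := OmegaP x; have /eqP y0 := OmegaP y.
apply/eqP; change ((if 0 <= s then x 0 else x s + y 0 - y s) = 0).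
case: leP => // s0.
have s_0 : clip T s = 0 by rewrite /clip (min_idPl _) ?(max_idPl _)// ?ltW// (lt_trans s0).
by rewrite -(cpath_clip x s) -(cpath_clip y s) s_0 x0 y0 addr0 subr0.
Qed.

Definition concat (s : R) (x y : Omega T) : Omega T :=
  MkOmega (concat_at0 s x y).

End path_constructions.

Definition Cdyad (R : realType) (T : {posnum R}) : set (Omega T) :=
  [set x | cauchy (Q n x @[n --> \oo])].
Arguments Cdyad {R} T.

(** Only meaningful on [Cdyad T], where it is the uniform limit. *)
Definition Qhat (R : realType) (T : {posnum R}) (x : Omega T) : cpath T :=
  lim (Q n x @[n --> \oo]).

Definition Gdyad (R : realType) (T : {posnum R}) : set (Omega T) :=
  [set x | [/\ Cdyad T x,
               {in `[0, T%:num] &, nondecreasing (Qhat x)} &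
               Qhat x 0 = 0]].
Arguments Gdyad {R} T.

Definition holder_norm (R : realType) (T : {posnum R}) (eta : R) (x : Omega T)
    : \bar R :=
  ereal_sup [set (`|x z.2 - x z.1| / `|z.2 - z.1| `^ eta)%:E |
             z in [set z : R * R | 0 <= z.1 < z.2 /\ z.2 <= T%:num]].

Definition Zgamma (R : realType) (T : {posnum R}) (gamma : R) (x : Omega T)
    : \bar R :=
  ereal_sup [set (2 `^ (gamma * n%:R) * `|Q n.+1 x - Q n x|)%:E |
             n in [set n | (1 <= n)%N]].

Definition Alip (R : realType) (T : {posnum R}) (Lambda : R) : set (cpath T) :=
  [set q | [/\ {in `[0, T%:num] &, nondecreasing q},
               q 0 = 0 &
               {in `[0, T%:num] &, forall s t,
                  `|q t - q s| <= Lambda * `|t - s|}]].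
Arguments Alip {R} T Lambda.

Definition Dset (R : realType) (T : {posnum R}) (Lambda eta gamma A B : R)
    : set (Omega T) :=
  [set x | (holder_norm eta x
             <= (A * Num.sqrt Lambda * T%:num `^ (2^-1 - eta))%:E)%E /\
           (Zgamma gamma x <= (B * Lambda * T%:num)%:E)%E].
Arguments Dset {R} T Lambda eta gamma A B.

Definition Kset (R : realType) (T : {posnum R}) (Lambda eta gamma A B : R)
    : set (Omega T) :=
  [set x | Dset T Lambda eta gamma A B x /\ Alip T Lambda (Qhat x)].
Arguments Kset {R} T Lambda eta gamma A B.

(** Filtrations are families of sigma-algebras [F t], used for [t] in [0,T]. *)

Definition adapted (W : Type) (R : realType) (T : R) (F : R -> set (set W))
    (M : R -> W -> R) : Prop :=
  forall t, t \in `[0, T] -> forall B, measurable B -> F t (M t @^-1` B).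

Definition martingale d (W : measurableType d) (R : realType) (T : R)
    (P : set W -> \bar R) (F : R -> set (set W)) (M : R -> W -> R) : Prop :=
  [/\ adapted T F M,
      forall t, t \in `[0, T] -> P.-integrable setT (EFin \o M t) &
      forall s t, s \in `[0, T] -> t \in `[0, T] -> s <= t ->
        forall A, F s A ->
          (\int[P]_(w in A) (M t w)%:E = \int[P]_(w in A) (M s w)%:E)%E].

Definition stopping_time (W : Type) (R : realType) (T : R)
    (F : R -> set (set W)) (tau : W -> R) : Prop :=
  (forall w, 0 <= tau w) /\
  forall t, t \in `[0, T] -> F t [set w | tau w <= t].

(** For processes null at time 0. Since the time interval [0,T] is closed, a
    localizing sequence must eventually reach [T]. *)
Definition cont_local_martingale d (W : measurableType d) (R : realType) (T : R)
    (P : set W -> \bar R) (F : R -> set (set W)) (M : R -> W -> R) : Prop :=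
  [/\ adapted T F M,
      forall w, M 0 w = 0 /\ {within `[0, T], continuous (M ^~ w)} &
      exists tau : nat -> W -> R,
        [/\ forall n, stopping_time T F (tau n),
            {ae P, forall w, nondecreasing_seq (tau ^~ w) /\
                             \forall n \near \oo, T <= tau n w} &
            forall n,
              martingale T P F (fun t w => M (Num.min t (tau n w)) w)]].

(** [V] is the bracket of the continuous local martingale [M]: the nondecreasing
    continuous adapted process null at 0, unique up to indistinguishability,
    such that M^2 - V is a continuous local martingale. *)
Definition quadratic_variation d (W : measurableType d) (R : realType) (T : R)
    (P : set W -> \bar R) (F : R -> set (set W)) (M V : R -> W -> R) : Prop :=
  [/\ adapted T F V,
      forall w, [/\ V 0 w = 0,
                    {within `[0, T], continuous (V ^~ w)} &
                    {in `[0, T] &, nondecreasing (V ^~ w)}] &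
      cont_local_martingale T P F (fun t w => M t w ^+ 2 - V t w)].

Definition predictable_sets (W : Type) (R : realType) (T : R)
    (F : R -> set (set W)) : set (set (W * R)) :=
  <<s [set z | z.2 \in `[0, T]],
      [set A `*` [set 0] | A in F 0] `|`
      [set C | exists s t A, [/\ 0 <= s, s < t, t <= T, F s A &
                                 C = A `*` `]s, t]]] >>.

Definition predictable (W : Type) (R : realType) (T : R)
    (F : R -> set (set W)) (a : W * R -> R) : Prop :=
  forall B, measurable B ->
    predictable_sets T F ([set z | z.2 \in `[0, T]] `&` a @^-1` B).

Definition Borel (R : realType) (T : {posnum R}) :=
  g_sigma_algebraType (@open (Omega T)).

Definition coord (R : realType) (T : {posnum R}) (t : R) (w : Omega T) : R :=
  w t.

(** For [u >= T] this is the sigma-algebra generated by the whole path, since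
    [coord s = coord T] for [s >= T]. *)
Definition natural (R : realType) (T : {posnum R}) (u : R)
    : set (set (Omega T)) :=
  <<s \bigcup_(s in `[0, u])
        preimage_set_system setT (@coord R T s) measurable >>.
Arguments natural {R} T u.

(** The usual augmentation: completion, then right limits. *)
Definition augmented (R : realType) (T : {posnum R})
    (P : probability (Borel T) R) (t : R) : set (set (Omega T)) :=
  \bigcap_(u in `]t, +oo[) <<s natural T u `|` P.-negligible >>.

(** The (local) martingale properties are stated on the completion of [P], for
    which the members of the augmented filtration are measurable. *)
Definition Mclass (R : realType) (T : {posnum R}) (Lambda : R)
    : set (probability (Borel T) R) :=
  [set P | let F := augmented P in
           let Pbar := @completed_measure_extension _ (Borel T) R P in
    cont_local_martingale T%:num Pbar F (@coord R T) /\
    exists (V : R -> Omega T -> R) (a : Omega T * R -> R),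
      [/\ quadratic_variation T%:num Pbar F (@coord R T) V,
          predictable T%:num F a,
          {ae (P \x lebesgue_measure)%E, forall z : Borel T * R,
             z.2 \in `[0, T%:num] -> 0 <= a z <= Lambda} &
          {ae P, forall w, forall t, t \in `[0, T%:num] ->
             (V t w)%:E
               = (\int[lebesgue_measure]_(s in `[0%R, t]) (a (w, s))%:E)%E}]].
Arguments Mclass {R} T Lambda.

Definition capacity (R : realType) (T : {posnum R}) (Lambda : R)
    (A : set (Omega T)) : \bar R :=
  ereal_sup [set P A | P in Mclass T Lambda].

(* Main.v *)
From HB Require Import structures.
Require Import Defs.
From mathcomp Require Import all_boot all_order all_algebra.
From mathcomp Require Import all_classical all_reals all_analysis.
From mathcomp Require Import measurable_realfun ring lra zify.

(** The set [Kset] is cut out by a Hölder bound, by geometric decay of the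
    differences [Q n.+1 x - Q n x], and by a Lipschitz bound on their limit.

    The deterministic claims follow from these three bounds. Hölder balls are
    equicontinuous, so on them an ultrafilter which converges at every time
    converges uniformly; each [Q n] is Lipschitz on a Hölder ball, and the
    distance of [Q n] to [Qhat] is uniformly geometric, so all three bounds
    survive the limit ([Kset_compact]). The same two estimates, a Lipschitz
    constant of order [2^((1 - eta) n)] for [Q n] and an error of order
    [2^(- gamma n)], give the exponent [alpha] when the level [n] is chosen to
    balance them ([two_scale_bound], [Kset_Qhat_dist]). Stopping commutes with
    [Q n]. Concatenation at time [s] alters [Q n] only on the dyadic interval
    which contains [s], hence by at most a squared Hölder increment of order
    [2^(- 2 eta n)], and this is absorbed by [2^(- gamma n)] because
    [gamma < 2 eta] ([Q_concat], [Kset_concat]).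

    The capacity bound uses only two properties of a measure in [Mclass]: for
    [A] in the sigma-algebra at time [s], the integral over [A] of
    [(X t - X s)^2] is at most [L (t - s) P A], and that of
    [exp (l (X t - X s))] is at most [exp (l^2 L (t - s)) P A]. The first comes
    from the bracket by optional stopping; the second is obtained without
    stochastic calculus, by multiplying the first one along a fine partition,
    since [exp x <= 1 + x + x^2] for small [x] ([local_energy_le],
    [local_exp_le]). Three events then have to be controlled.
    - Failure of the Hölder bound: by dyadic chaining some dyadic increment is
      large, and Gaussian tails are summable over the dyadic tree
      ([dyadic_chaining], [holder_tail]).
    - Failure of the decay: along the dyadic points of a finer level,
      [Q n.+1 - Q n] is a martingale transform of the path whose energy is
      bounded by [2 T 2^(- n)] times [Q n.+1]. Up to the first level and the
      first time at which the decay fails, [Q n.+1] is bounded by a multiple of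
      [B L T], and an exponential maximal inequality yields
      [exp (- c B 2^((1 - 2 gamma) n))], which is summable in [n] because
      [gamma < 1/2] ([first_exceedance], [bad_tail], [Zgamma_tail]).
    - Failure of the Lipschitz bound, although the decay holds: this event is
      null, because sums of squared increments over finer and finer grids of
      [s, t] almost surely do not all stay above [L (t - s) + e]
      ([square_variation_negligible], [Qhat_lipschitz_ae]). *)

Set Implicit Arguments.
Unset Strict Implicit.
Unset Printing Implicit Defensive.
Import Order.TTheory GRing.Theory Num.Theory.
Import numFieldNormedType.Exports.

Local Open Scope classical_set_scope.
Local Open Scope ring_scope.

(** * Integration against a sub-sigma-algebra *)

Lemma measurable_funTS_EFin d (W : measurableType d) (R : realType) (A : set W) (f : W -> R) :
  measurable_fun setT f -> measurable_fun A (fun w => (f w)%:E).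
Proof. by move=> mf; apply: measurable_funTS; exact/measurable_EFinP. Qed.

(** Fatou's lemma, in a form that never mentions a limit of [f_]: it is enough
    that [f] is eventually at most [f_ n + e]. The approximants [f_] may then
    be products, frozen or localized processes that do not converge. *)
Lemma integral_fatou_le d (W : measurableType d) (R : realType)
    (mu : {measure set W -> \bar R}) (A : set W) (f : W -> R) (f_ : nat -> W -> R)
    (c : nat -> \bar R) (l : \bar R) :
  measurable A -> measurable_fun setT f -> (forall n, measurable_fun setT (f_ n)) ->
  (forall w, 0 <= f w) -> (forall n w, 0 <= f_ n w) ->
  {ae mu, forall w, A w -> forall e : R, 0 < e -> \forall n \near \oo, f w <= f_ n w + e} ->
  (forall n, (\int[mu]_(w in A) (f_ n w)%:E <= c n)%E) -> c @ \oo --> l ->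
  (\int[mu]_(w in A) (f w)%:E <= l)%E.
Proof.
move=> mA mf mf_ f0 f_0 [N [mN N0 AN]] fc cl.
(* Truncated by [f], the approximants do converge to [f]. *)
pose g : nat -> W -> R := fun n w => Num.min (f_ n w) (f w).
have mg n : measurable_fun setT (EFin \o g n).
  by apply/measurable_EFinP; exact: measurable_minr.
have g0 n w : (0 <= (g n w)%:E)%E by rewrite lee_fin le_min f0 f_0.
have gf w : (A `\` N) w -> (g n w)%:E @[n --> \oo] --> (f w)%:E.
  move=> [Aw Nw]; apply: cvg_EFin; first by near=> n.
  apply/cvgrPdist_le => e e0.
  have /(_ Aw e e0) H : A w -> forall e : R, 0 < e -> \forall n \near \oo, f w <= f_ n w + e.
    by apply: contrapT => h; apply: Nw; exact: AN.
  near=> n; rewrite /g /= ger0_norm ?subr_ge0 ?ge_min ?lexx ?orbT//.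
  rewrite lerBlDr addrC -lerBlDr le_min !lerBlDr [X in _ && X]lerDl (ltW e0) andbT.
  by near: n.
have mAN : measurable (A `\` N) by exact: measurableD.
have -> : (\int[mu]_(w in A) (f w)%:E = \int[mu]_(w in A `\` N) (f w)%:E)%E.
  apply: ge0_negligible_integral => //.
  - exact: measurable_funTS_EFin.
  - by move=> w _; rewrite lee_fin.
apply: (@le_trans _ _ (\int[mu]_(w in A `\` N) limn_einf (fun n => (g n w)%:E)))%E.
  rewrite le_eqVlt; apply/orP; left; apply/eqP.
  apply: eq_integral => w /[!inE] /gf /cvg_limn_einf_sup[+ _]; exact.
apply: le_trans (fatou _ mAN (fun n => measurable_funTS (mg n)) (fun n w _ => g0 n w)) _.
have [<- _] := cvg_limn_einf_sup cl.
rewrite !limn_einf_lim; apply: lee_lim; [exact: is_cvg_einfs|exact: is_cvg_einfs|].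
near=> n; apply: le_ereal_inf_tmp => _ [k /= nk <-].
apply: (@le_trans _ _ (\int[mu]_(w in A `\` N) (g k w)%:E)%E).
  by apply: ereal_inf_lbound; exists k.
apply: le_trans (fc k).
apply: (@le_trans _ _ (\int[mu]_(w in A `\` N) (f_ k w)%:E)%E).
  apply: ge0_le_integral => //.
  - by apply: measurable_funTS_EFin; exact: measurable_minr.
  - exact: measurable_funTS_EFin.
  - by move=> w _; rewrite lee_fin ge_min lexx.
apply: ge0_subset_integral => //.
- exact: measurable_funTS_EFin.
- by move=> w _; rewrite lee_fin.
Unshelve. all: by end_near.
Qed.

(** Cutting along the level sets of [J] lets an inequality with a deterministic
    parameter be used with a random parameter that has countably many values. *)
Lemma integral_countable_le d (W : measurableType d) (R : realType)
    (mu : {measure set W -> \bar R}) (A : set W) (J : W -> nat) (h k : nat -> W -> R) :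
  (forall j, measurable (A `&` J @^-1` [set j])) ->
  (forall j, measurable_fun setT (h j)) -> (forall j, measurable_fun setT (k j)) ->
  (forall j w, 0 <= h j w) -> (forall j w, 0 <= k j w) ->
  (forall j, (\int[mu]_(w in A `&` J @^-1` [set j]) (h j w)%:E
           <= \int[mu]_(w in A `&` J @^-1` [set j]) (k j w)%:E)%E) ->
  (\int[mu]_(w in A) (h (J w) w)%:E <= \int[mu]_(w in A) (k (J w) w)%:E)%E.
Proof.
move=> mJ mh mk h0 k0 hk.
have AE : A = \bigcup_j (A `&` J @^-1` [set j]).
  by apply/seteqP; split => [w Aw|w [j _ []]//]; exists (J w).
have tJ : trivIset setT (fun j => A `&` J @^-1` [set j]).
  by move=> i j _ _ [w [[_ <-] [_ <-]]].
have mfJ (f : nat -> W -> R) : (forall j, measurable_fun setT (f j)) ->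
    measurable_fun (\bigcup_j (A `&` J @^-1` [set j])) (EFin \o (fun w => f (J w) w)).
  move=> mf; apply/measurable_fun_bigcup => // j.
  apply: (eq_measurable_fun (EFin \o f j)) => [w /[!inE] -[_ /= ->]//|].
  exact: measurable_funTS_EFin.
rewrite AE ge0_integral_bigcup//; [|exact: mfJ|by move=> w _; rewrite lee_fin].
rewrite ge0_integral_bigcup//; [|exact: mfJ|by move=> w _; rewrite lee_fin].
apply: lee_nneseries => [j _ _|j _]; first by apply: integral_ge0 => w _; rewrite lee_fin.
rewrite (eq_integral (fun w => (h j w)%:E)); last by move=> w /[!inE] -[_ /= ->].
by rewrite [leRHS](eq_integral (fun w => (k j w)%:E)); last by move=> w /[!inE] -[_ /= ->].
Qed.

(** Measurability with respect to a sub-sigma-algebra is phrased through the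
    measurable type generated by [G], so that the closure properties of
    measurable functions apply to it verbatim. *)
Definition sub_measurable d (W : measurableType d) (R : realType) (G : set (set W)) (g : W -> R) :=
  measurable_fun setT (g : g_sigma_algebraType G -> R).

Section sub_measurable.
Context d (W : measurableType d) (R : realType) (G : set (set W)).
Hypothesis sG : sigma_algebra setT G.

Lemma sub_measurableP (g : W -> R) :
  sub_measurable G g <-> forall B, measurable B -> G (g @^-1` B).
Proof.
split=> [mg B mB|Gg _ B mB].
  have := mg measurableT B mB; rewrite setTI; by rewrite measurable_g_measurableTypeE.
by rewrite setTI measurable_g_measurableTypeE//; exact: Gg.
Qed.

Lemma sub_measurableS (G' : set (set W)) (g : W -> R) :
  sigma_algebra setT G' -> G `<=` G' -> sub_measurable G g -> sub_measurable G' g.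
Proof.
move=> sG' GG' mg _ B mB; rewrite setTI measurable_g_measurableTypeE//.
by apply: GG'; move/sub_measurableP : mg; exact.
Qed.

Lemma sub_measurable_measurable (g : W -> R) :
  G `<=` measurable -> sub_measurable G g -> measurable_fun setT g.
Proof. by move=> Gm /sub_measurableP mg _ B mB; rewrite setTI; exact/Gm/mg. Qed.

Lemma sub_measurable_le (g : W -> R) a : sub_measurable G g -> G [set w | g w <= a].
Proof.
move/sub_measurableP => /(_ [set` `]-oo, a]] (measurable_itv _)).
by congr G; apply/seteqP; split => w /=; rewrite in_itv.
Qed.

Lemma sub_measurable_lt (g : W -> R) a : sub_measurable G g -> G [set w | g w < a].
Proof.
move/sub_measurableP => /(_ [set` `]-oo, a[] (measurable_itv _)).
by congr G; apply/seteqP; split => w /=; rewrite in_itv.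
Qed.

Lemma sub_algebraC A : G A -> G (~` A).
Proof. by case: sG => _ GD _ /GD; rewrite setTD. Qed.

Lemma sub_algebraT : G setT.
Proof. by case: sG => G0 GD _; have := GD _ G0; rewrite setD0. Qed.

Lemma sub_algebraI A B : G A -> G B -> G (A `&` B).
Proof.
rewrite -(measurable_g_measurableTypeE sG) => GA GB.
exact: (@measurableI _ (g_sigma_algebraType G)).
Qed.

Lemma sub_measurable_indic A : G A -> sub_measurable G (\1_A : W -> R).
Proof.
move=> GA; apply: (@measurable_indic _ (g_sigma_algebraType G)).
by rewrite measurable_g_measurableTypeE.
Qed.

End sub_measurable.

Definition grid_floor (R : realType) (e x : R) : R := e * (Num.floor (x / e))%:~R.

Lemma grid_floor_itv (R : realType) (e x : R) : 0 < e -> grid_floor e x <= x < grid_floor e x + e.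
Proof.
move=> e0; have /andP[h1 h2] := floor_itv (x / e).
rewrite /grid_floor mulrC -ler_pdivlMr// h1/=.
by move: h2; rewrite ltr_pdivrMr// intrD mulrDl mul1r.
Qed.

Lemma measurable_grid_floor (R : realType) (n : nat) :
  measurable_fun setT (grid_floor (n.+1%:R^-1 : R)).
Proof.
apply: nondecreasing_measurable => // x y xy.
by rewrite /grid_floor ler_wpM2l// ler_int le_floor// ler_wpM2r.
Qed.

(** This replaces conditioning on [G]: an inequality valid for every constant
    [c] on every set of [G] holds with [c] replaced by the discretization of a
    [G]-measurable [g], as the level sets of that discretization are in [G]. *)
Lemma integral_frozen_le d (W : measurableType d) (R : realType)
    (mu : {measure set W -> \bar R}) (G : set (set W)) (A : set W) (g : W -> R)
    (h k : R -> W -> R) (e : R) :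
  sigma_algebra setT G -> G `<=` measurable -> G A -> sub_measurable G g -> 0 < e ->
  (forall c, measurable_fun setT (h c)) -> (forall c, measurable_fun setT (k c)) ->
  (forall c w, 0 <= h c w) -> (forall c w, 0 <= k c w) ->
  (forall c B, G B -> B `<=` A ->
     (\int[mu]_(w in B) (h c w)%:E <= \int[mu]_(w in B) (k c w)%:E)%E) ->
  (\int[mu]_(w in A) (h (grid_floor e (g w)) w)%:E
     <= \int[mu]_(w in A) (k (grid_floor e (g w)) w)%:E)%E.
Proof.
move=> sG Gm GA mg e0 mh mk h0 k0 hk.
pose J w := pickle (Num.floor (g w / e)).
pose un (f : R -> W -> R) (j : nat) w := if unpickle j is Some z then f (e * z%:~R) w else 0.
have unE f w : f (grid_floor e (g w)) w = un f (J w) w by rewrite /un /J pickleK.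
have GJ j : G (A `&` J @^-1` [set j]).
  apply: sub_algebraI => //.
  case E : (unpickle j : option int) => [z|]; last first.
    have -> : J @^-1` [set j] = set0; last by case: sG.
    by apply/seteqP; split => // w /= Ej; move: E; rewrite -Ej pickleK.
  suff -> : J @^-1` [set j] = (if pickle z == j then g @^-1` `[e * z%:~R, e * (z%:~R + 1)[ else set0).
    case: ifP => _; last by case: sG.
    by move/sub_measurableP: mg; apply=> //; exact: measurable_itv.
  apply/seteqP; split => w /=.
    move=> Jw; move: (E); rewrite -Jw pickleK => -[zE]; rewrite -zE /J eqxx /= in_itv /=.
    have /andP[h1 h2] := grid_floor_itv (g w) e0; move: h1 h2.
    by rewrite /grid_floor mulrDr mulr1 => -> ->.
  case: ifPn => // /eqP zj /=; rewrite in_itv /= => /andP[h1 h2].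
  rewrite -zj /J; congr pickle; apply/floor_def; rewrite intrD.
  by rewrite ler_pdivlMr// ltr_pdivrMr// mulrC h1 mulrC.
rewrite (eq_integral (fun w => (un h (J w) w)%:E)); last by move=> w _; rewrite unE.
rewrite [leRHS](eq_integral (fun w => (un k (J w) w)%:E)); last by move=> w _; rewrite unE.
apply: integral_countable_le.
- by move=> j; exact: Gm.
- by move=> j; rewrite /un; case: unpickle => //; exact: measurable_cst.
- by move=> j; rewrite /un; case: unpickle => //; exact: measurable_cst.
- by move=> j w; rewrite /un; case: unpickle.
- by move=> j w; rewrite /un; case: unpickle.
- move=> j; rewrite /un; case: unpickle => [z|//]; apply: hk => //; exact: subIsetl.
Qed.

Lemma integral_scale d (W : measurableType d) (R : realType)
    (mu : {measure set W -> \bar R}) (A : set W) (c : R) (f : W -> R) :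
  measurable A -> measurable_fun setT f -> (forall w, 0 <= f w) -> 0 <= c ->
  (\int[mu]_(w in A) (c * f w)%:E = c%:E * \int[mu]_(w in A) (f w)%:E)%E.
Proof.
move=> mA mf f0 c0; rewrite -ge0_integralZl//; [exact: measurable_funTS_EFin|].
by move=> w _; rewrite lee_fin.
Qed.

(** Pull-out property: the hypothesis says that the conditional expectation of
    [f] given [G] is at most [c]. *)
Lemma integral_mul_le d (W : measurableType d) (R : realType)
    (mu : {measure set W -> \bar R}) (G : set (set W)) (f g : W -> R) (c : R) :
  sigma_algebra setT G -> G `<=` measurable -> sub_measurable G g -> (forall w, 0 <= g w) ->
  measurable_fun setT f -> (forall w, 0 <= f w) -> 0 <= c ->
  (forall A, G A -> (\int[mu]_(w in A) (f w)%:E <= c%:E * mu A)%E) ->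
  (\int[mu]_w (g w * f w)%:E <= c%:E * \int[mu]_w (g w)%:E)%E.
Proof.
move=> sG Gm mg g0 mf f0 c0 fc.
have mg' := sub_measurable_measurable sG Gm mg.
apply: (@integral_fatou_le _ _ _ mu setT _ (fun n w => `|grid_floor n.+1%:R^-1 (g w)| * f w)
   (fun=> c%:E * \int[mu]_w (g w)%:E)%E) => //; last exact: cvg_cst.
- exact: measurable_funM.
- move=> n; apply: measurable_funM => //; apply: measurableT_comp => //.
  exact: measurableT_comp (measurable_grid_floor _) mg'.
- by move=> w; exact: mulr_ge0.
- by move=> n w; exact: mulr_ge0.
- apply: aeW => w _ e e0; have [fw0|] := eqVneq (f w) 0.
    by near=> n; rewrite fw0 !mulr0 add0r ltW.
  rewrite neq_lt ltNge f0/= => fw0.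
  have : \forall n \near \oo, n.+1%:R^-1 < e / f w by apply: near_infty_natSinv_lt (PosNum (divr_gt0 e0 fw0)).
  apply: filterS => n ne.
  have /andP[_ /ltW h] := @grid_floor_itv _ n.+1%:R^-1 (g w) ltac:(by []).
  rewrite -lerBlDl -mulrBl -ler_pdivlMr//; apply: le_trans (ltW ne).
  rewrite lerBlDl (le_trans h)// lerD2r ler_norm//.
- move=> n; apply: (@le_trans _ _ (\int[mu]_w (c * `|grid_floor n.+1%:R^-1 (g w)|)%:E)%E).
    apply: (@integral_frozen_le _ _ _ mu G setT g (fun a w => `|a| * f w) (fun a w => c * `|a|)) => //.
    + exact: sub_algebraT.
    + by move=> a; apply: measurable_funM.
    + by move=> a w; exact: mulr_ge0.
    + by move=> a w; exact: mulr_ge0.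
    + move=> a B GB _; rewrite integral_cst; last exact: Gm.
      rewrite integral_scale//; last exact: Gm.
      by rewrite mulrC EFinM -muleA lee_wpmul2l ?lee_fin//; exact: fc.
  rewrite -integral_scale//; apply: ge0_le_integral => //.
  + by move=> w _; rewrite lee_fin mulr_ge0.
  + apply: measurable_funTS_EFin; apply: measurable_funM => //; apply: measurableT_comp => //.
    exact: measurableT_comp (measurable_grid_floor _) mg'.
  + by apply: measurable_funTS_EFin; exact: measurable_funM.
  + move=> w _; rewrite lee_fin ler_wpM2l// ger0_norm.
      by have /andP[] := @grid_floor_itv _ n.+1%:R^-1 (g w) ltac:(by []).
    by rewrite /grid_floor mulr_ge0// ler0z floor_ge0 divr_ge0.
Unshelve. all: by end_near.
Qed.

(** * Optional stopping for continuous martingales *)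

Definition grid (R : realType) (s t : R) (N i : nat) : R := s + (t - s) * i%:R / N%:R.

(** Index of the first grid point that is not before [r], or [N] if there is
    none: the upward discretization of a stopping time capped at [t]. *)
Definition grid_hit (R : realType) (s t : R) (N : nat) (r : R) : nat :=
  find (fun i => r <= grid s t N i) (iota 0 N).

Section grid.
Context (R : realType) (s t : R).
Hypothesis st : s <= t.

Lemma grid0 N : grid s t N 0 = s.
Proof. by rewrite /grid mulr0 mul0r addr0. Qed.

Lemma gridN N : (0 < N)%N -> grid s t N N = t.
Proof. by move=> N0; rewrite /grid mulfK ?pnatr_eq0 -?lt0n// addrC subrK. Qed.

Lemma grid_le N i j : (i <= j)%N -> grid s t N i <= grid s t N j.
Proof. by move=> ij; rewrite /grid lerD2l ler_wpM2r// ler_wpM2l ?subr_ge0// ler_nat. Qed.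

Lemma gridS N i : grid s t N i.+1 = grid s t N i + (t - s) / N%:R.
Proof. by rewrite /grid -addrA -mulrDl -{3}[t - s]mulr1 -mulrDr -natr1. Qed.

Lemma grid_itv N i : (i <= N)%N -> s <= grid s t N i <= t.
Proof.
case: N => [|N] iN; first by rewrite /grid invr0 mulr0 addr0 lexx.
by have := grid_le N.+1 (leq0n i); have := grid_le N.+1 iN; rewrite grid0 gridN// => -> ->.
Qed.

Lemma grid_hit_le N r : (grid_hit s t N r <= N)%N.
Proof. by rewrite -{2}(size_iota 0 N) find_size. Qed.

Lemma grid_hit_leP N r j : (j < N)%N -> (grid_hit s t N r <= j)%N = (r <= grid s t N j).
Proof.
move=> jN; apply/idP/idP => [hj|rj].
  have hN := leq_ltn_trans hj jN.
  have := @nth_find _ 0%N (fun i => r <= grid s t N i) (iota 0 N).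
  rewrite has_find size_iota => /(_ hN); rewrite nth_iota// add0n => h.
  exact: le_trans h (grid_le _ hj).
rewrite leqNgt; apply/negP => jh.
have := @before_find _ 0%N (fun i => r <= grid s t N i) (iota 0 N) _ jh.
by rewrite nth_iota// add0n rj.
Qed.

(** The cap at [t] explains the minimum: if [r] exceeds [t] the index is [N]. *)
Lemma grid_hit_dist N r : (0 < N)%N -> s <= r ->
  `|grid s t N (grid_hit s t N r) - Num.min t r| <= (t - s) / N%:R.
Proof.
move=> N0 sr; set h := grid_hit _ _ _ _.
have hN : (h <= N)%N := grid_hit_le N r.
have ts0 : 0 <= (t - s) / N%:R by rewrite divr_ge0// subr_ge0.
have lo : grid s t N h <= Num.min t r + (t - s) / N%:R.
  case E : h => [|j]; first by rewrite grid0 ler_wpDr// le_min st sr.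
  rewrite gridS lerD2r le_min.
  have jN : (j < N)%N by rewrite -E.
  have /andP[_ ->] := grid_itv (ltnW jN).
  by rewrite leNgt; apply/negP => /ltW; rewrite -grid_hit_leP// -/h E ltnn.
rewrite ler_distl lo andbT lerBlDr; apply: ler_wpDr => //.
move: hN; rewrite leq_eqVlt => /predU1P[->|hN]; first by rewrite gridN// ge_min lexx.
by rewrite ge_min; apply/orP; right; rewrite -grid_hit_leP.
Qed.

End grid.

Lemma within_continuous_eps (R : realType) (a b : R) (f : R -> R) :
  {within `[a, b], continuous f} -> forall t, a <= t <= b -> forall e : R, 0 < e ->
  exists2 d : R, 0 < d & forall u, a <= u <= b -> `|t - u| < d -> `|f t - f u| < e.
Proof.
move=> cf t tab e e0; have tI : `[a, b]%classic t by rewrite /= in_itv.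
have /subspace_continuousP/(_ t tI)/cvgrPdist_lt/(_ e e0) := cf.
rewrite near_withinE => -[d /= d0 H]; exists d => // u uab tu.
by apply: H => //; rewrite /= in_itv.
Qed.

Section optional_stopping.
Context d (W : measurableType d) (R : realType) (P : probability W R) (T : R)
  (F : R -> set (set W)).
Hypothesis sF : forall t : R, 0 <= t <= T -> sigma_algebra setT (F t).
Hypothesis Fm : forall t : R, 0 <= t <= T -> F t `<=` measurable.
Hypothesis Fle : forall s t : R, 0 <= s -> s <= t -> t <= T -> F s `<=` F t.

Lemma adapted_sub_measurable (M : R -> W -> R) t :
  adapted T F M -> 0 <= t <= T -> sub_measurable (F t) (M t).
Proof. by move=> aM tT; apply/sub_measurableP; [exact: sF|apply: aM; rewrite in_itv]. Qed.

Lemma adapted_measurable (M : R -> W -> R) t :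
  adapted T F M -> 0 <= t <= T -> measurable_fun setT (M t).
Proof.
by move=> aM tT; apply: (sub_measurable_measurable (sF tT) (Fm tT)); exact: adapted_sub_measurable.
Qed.

Lemma stopping_time_gt (r : W -> R) t : stopping_time T F r -> 0 <= t <= T ->
  F t [set w | t < r w].
Proof.
move=> [_ sr] tT; have -> : [set w | t < r w] = ~` [set w | r w <= t].
  by apply/seteqP; split => w /=; rewrite ltNge => /negP.
by apply: sub_algebraC; [exact: sF|apply: sr; rewrite in_itv].
Qed.

Lemma martingaleN (Y : R -> W -> R) : martingale T P F Y -> martingale T P F (fun t w => - Y t w).
Proof.
move=> [aY iY eY]; split.
- move=> t tT B mB; have mB' : measurable (-%R @^-1` B).
    by rewrite -[X in measurable X]setTI; exact: (@oppr_measurable R setT).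
  exact: aY tT _ mB'.
- by move=> t tT; rewrite (_ : _ \o _ = \- (EFin \o Y t))%E//; exact: integrableN (iY t tT).
- move=> s t sT tT st A FA.
  have mA : measurable A by move: sT; rewrite in_itv => sT; exact: (Fm sT).
  have iA u : u \in `[0, T] -> P.-integrable A (EFin \o Y u).
    by move=> uT; apply: integrableS (iY u uT).
  rewrite (_ : (fun w => (- Y t w)%:E) = fun w => (- (Y t w)%:E)%E)//.
  rewrite (_ : (fun w => (- Y s w)%:E) = fun w => (- (Y s w)%:E)%E)//.
  have iN u : u \in `[0, T] -> (\int[P]_(w in A) - (Y u w)%:E = - \int[P]_(w in A) (Y u w)%:E)%E.
    by move=> uT; have := integralN (integrable_add_def mA (iA u uT)); exact.
  by rewrite (iN _ tT) (iN _ sT) (eY s t).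
Qed.

(** The submartingale property of the positive part: on the set where
    [c < Y u], which is known at time [u], the positive part is [Y u - c]
    itself. Positive parts are nonnegative, which later permits Fatou. *)
Lemma martingale_pos_le (Y : R -> W -> R) (c u t : R) B : martingale T P F Y ->
  0 <= u -> u <= t -> t <= T -> F u B ->
  (\int[P]_(w in B) (Num.max (Y u w - c) 0)%:E <= \int[P]_(w in B) (Num.max (Y t w - c) 0)%:E)%E.
Proof.
move=> [aY iY eY] u0 ut tT FB.
have uT : 0 <= u <= T by rewrite u0 (le_trans ut).
have tT' : 0 <= t <= T by rewrite (le_trans u0 ut).
have mB : measurable B by exact: (Fm uT).
have mYu := adapted_measurable aY uT; have mYt := adapted_measurable aY tT'.
pose B' := B `&` [set w | c < Y u w].
have FB' : F u B'.
  apply: sub_algebraI; [exact: sF|exact: FB|].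
  have -> : [set w | c < Y u w] = ~` [set w | Y u w <= c].
    by apply/seteqP; split => w /=; rewrite ltNge => /negP.
  apply: sub_algebraC; [exact: sF|].
  by apply: sub_measurable_le; [exact: sF|exact: adapted_sub_measurable].
have mB' : measurable B' by exact: (Fm uT).
have mpos v : measurable_fun setT (Y v) -> measurable_fun setT (fun w => Num.max (Y v w - c) 0).
  by move=> mv; apply: measurable_maxr => //; exact: measurable_funB.
have pos0 v w : (0 <= (Num.max (Y v w - c) 0)%:E)%E by rewrite lee_fin le_max lexx orbT.
have iB' v : v \in `[0, T] -> P.-integrable B' (EFin \o Y v).
  by move=> /iY; apply: integrableS.
have ic : P.-integrable B' (EFin \o cst c) by exact: finite_measure_integrable_cst.
have uI : u \in `[0, T] by rewrite in_itv.
have tI : t \in `[0, T] by rewrite in_itv.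
apply: (@le_trans _ _ (\int[P]_(w in B') (Y u w - c)%:E)%E).
  rewrite (_ : \int[P]_(w in B) _ = \int[P]_(w in B') (Num.max (Y u w - c) 0)%:E)%E.
    rewrite le_eqVlt; apply/orP; left; apply/eqP/eq_integral => w /[!inE] -[_ /= cY].
    by rewrite (max_idPl _)// subr_ge0 ltW.
  rewrite /B' integral_mkcondr; apply: eq_integral => w _; rewrite patchE.
  case: ifPn => //; rewrite notin_setE /= => /negP; rewrite -leNgt => h.
  by rewrite (max_idPr _)// subr_le0.
rewrite integralB_EFin ?(iB' _ uI)// -(eY u t uI tI ut B' FB') -integralB_EFin ?(iB' _ tI)//.
apply: (@le_trans _ _ (\int[P]_(w in B') (Num.max (Y t w - c) 0)%:E)%E).
  apply: le_integral => //.
  - by rewrite (_ : (fun w => _) = (EFin \o Y t) \- (EFin \o cst c))%E//; apply: integrableB => //; exact: iB'.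
  - apply: (le_integrable mB' _ _ (integrableD mB' (integrable_abse (iB' _ tI)) (integrable_abse ic))).
      by apply: measurable_funTS_EFin; exact: mpos.
    move=> w _ /=; rewrite lee_fin ger0_norm ?le_max ?lexx ?orbT// ger0_norm ?addr_ge0//.
    by rewrite ge_max addr_ge0// andbT lerD// ?ler_norm// -normrN ler_norm.
  - by move=> w _; rewrite lee_fin le_max lexx.
by apply: ge0_subset_integral => //; [apply: measurable_funTS_EFin; exact: mpos|exact: subIsetl].
Qed.

Section stopped.
Variables (Y : R -> W -> R) (r : W -> R).
Hypothesis mY : martingale T P F Y.
Hypothesis cY : forall w, {within `[0, T], continuous (Y ^~ w)}.
Hypothesis sr : stopping_time T F r.

Lemma grid_hit_sub_algebra (s t : R) N j : 0 <= s -> s <= t -> t <= T -> (j <= N)%N ->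
  F (grid s t N j) [set w | grid_hit s t N (r w) = j].
Proof.
move=> s0 st tT jN.
have gT i : (i <= N)%N -> 0 <= grid s t N i <= T.
  by move=> /(grid_itv st)/andP[h1 h2]; rewrite (le_trans s0)//= (le_trans h2).
have FN i : (i < N)%N -> F (grid s t N i) [set w | (grid_hit s t N (r w) <= i)%N].
  move=> iN; have -> : [set w | (grid_hit s t N (r w) <= i)%N] = [set w | r w <= grid s t N i].
    by apply/seteqP; split => w /=; rewrite grid_hit_leP.
  by apply: sr.2; rewrite in_itv gT// ltnW.
have FjN : F (grid s t N j) [set w | (grid_hit s t N (r w) <= j)%N].
  move: jN; rewrite leq_eqVlt => /predU1P[->|/FN//].
  rewrite (_ : [set w | _] = setT); first by apply: sub_algebraT; exact/sF/gT.
  by apply/seteqP; split => // w _; exact: grid_hit_le.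
case: j jN FjN => [|j] jN FjN.
  by rewrite (_ : [set w | _] = [set w | (grid_hit s t N (r w) <= 0)%N])//; apply/seteqP; split => w /=; [move=> ->|rewrite leqn0 => /eqP].
rewrite (_ : [set w | _] = [set w | (grid_hit s t N (r w) <= j.+1)%N] `&` ~` [set w | (grid_hit s t N (r w) <= j)%N]).
  apply: sub_algebraI => //; first exact/sF/gT.
  apply: sub_algebraC; first exact/sF/gT.
  have /andP[h1 _] := gT _ (ltnW jN); have /andP[_ h2] := gT _ jN.
  by apply: (Fle h1 _ h2); [exact: grid_le|exact: FN].
by apply/seteqP; split => w /=; [move=> ->; split => //; rewrite ltnn|move=> [h1 /negP]; rewrite -ltnNge => h2; apply/eqP; rewrite eqn_leq h1].
Qed.

Lemma cvg_grid_hit (s t : R) w : 0 <= s -> s <= t -> t <= T -> s <= r w ->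
  Y (grid s t n.+1 (grid_hit s t n.+1 (r w))) w @[n --> \oo] --> Y (Num.min t (r w)) w.
Proof.
move=> s0 st tT srw; have m : 0 <= Num.min t (r w) <= T.
  by rewrite le_min (le_trans s0 st) (le_trans s0 srw) ge_min tT.
apply/cvgrPdist_lt => e e0; have [d0 d00 H] := within_continuous_eps (@cY w) m e0.
have : \forall n \near \oo, n.+1%:R^-1 < d0 / (t - s + 1).
  by apply: (near_infty_natSinv_lt (PosNum (divr_gt0 d00 _))); rewrite ltr_wpDl// subr_ge0.
move=> ?; near=> n; apply: H.
  by have /andP[h1 h2] := grid_itv st (grid_hit_le s t n.+1 (r w)); rewrite (le_trans s0)//= (le_trans h2).
rewrite distrC (le_lt_trans (grid_hit_dist st _ srw))//.
apply: (@le_lt_trans _ _ ((t - s + 1) * n.+1%:R^-1)); first by rewrite ler_wpM2r// lerDl.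
by rewrite mulrC -ltr_pdivlMr ?ltr_wpDl ?subr_ge0//; near: n.
Unshelve. all: by end_near.
Qed.

Lemma grid_stopped_sub_measurable (s t : R) N : 0 <= s -> s <= t -> t <= T ->
  sub_measurable (F t) (fun w => Y (grid s t N (grid_hit s t N (r w))) w).
Proof.
move=> s0 st tT; have tT' : 0 <= t <= T by rewrite (le_trans s0).
have gT i : (i <= N)%N -> 0 <= grid s t N i <= T.
  by move=> /(grid_itv st)/andP[h1 h2]; rewrite (le_trans s0)//= (le_trans h2).
apply/(sub_measurableP (sF tT')) => B mB.
have -> : (fun w => Y (grid s t N (grid_hit s t N (r w))) w) @^-1` B =
    \bigcup_(j in [set j | (j <= N)%N]) ([set w | grid_hit s t N (r w) = j] `&` Y (grid s t N j) @^-1` B).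
  apply/seteqP; split => [w /= Bw|w [j /= jN [/= <- //]]].
  by exists (grid_hit s t N (r w)) => //=; exact: grid_hit_le.
rewrite -(measurable_g_measurableTypeE (sF tT')).
apply: bigcup_measurable => j /= jN; rewrite (measurable_g_measurableTypeE (sF tT')).
have /andP[g0 gT'] := gT _ jN; have /andP[_ gt] := grid_itv st jN.
apply: (Fle g0 gt tT); apply: sub_algebraI; [exact/sF/gT|exact: grid_hit_sub_algebra|].
by have [aY _ _] := mY; apply: aY => //; rewrite in_itv/= g0.
Qed.

Lemma stopped_sub_measurable (t : R) : 0 <= t <= T ->
  sub_measurable (F t) (fun w => Y (Num.min t (r w)) w).
Proof.
move=> /andP[t0 tT].
pose f n w := Y (grid 0 t n.+1 (grid_hit 0 t n.+1 (r w))) w.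
apply: (@measurable_fun_cvg _ (g_sigma_algebraType (F t)) R setT f) => [n|w _].
  exact: grid_stopped_sub_measurable.
by apply: cvg_grid_hit => //; exact: sr.1.
Qed.

(** On each event where the discretized stopping time has a given value the
    estimate is [martingale_pos_le]; Fatou's lemma removes the discretization,
    since [Y] is continuous. *)
Lemma stopped_pos_le (c s t : R) A : 0 <= s -> s <= t -> t <= T -> F s A ->
  (forall w, A w -> s <= r w) ->
  (\int[P]_(w in A) (Num.max (Y (Num.min t (r w)) w - c) 0)%:E
    <= \int[P]_(w in A) (Num.max (Y t w - c) 0)%:E)%E.
Proof.
move=> s0 st tT FA Ar; have sT : 0 <= s <= T by rewrite s0 (le_trans st).
have tT' : 0 <= t <= T by rewrite (le_trans s0).
have mpos (f : W -> R) : measurable_fun setT f -> measurable_fun setT (fun w => Num.max (f w - c) 0).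
  by move=> mf; apply: measurable_maxr => //; exact: measurable_funB.
have pos0 (x : R) : 0 <= Num.max (x - c) 0 by rewrite le_max lexx orbT.
have [aY _ _] := mY.
pose f : nat -> W -> R := fun n w => Num.max (Y (grid s t n.+1 (grid_hit s t n.+1 (r w))) w - c) 0.
apply: (@integral_fatou_le _ _ _ P A _ f (fun=> \int[P]_(w in A) (Num.max (Y t w - c) 0)%:E)%E) => //.
- exact: (Fm sT).
- by apply: mpos; apply: (sub_measurable_measurable (sF tT') (Fm tT')); exact: stopped_sub_measurable.
- by move=> n; apply: mpos; apply: (sub_measurable_measurable (sF tT') (Fm tT')); exact: grid_stopped_sub_measurable.
- by move=> n w; exact: pos0.
- apply: aeW => w Aw e e0.
  have /cvgrPdist_lt/(_ e e0) := cvg_grid_hit s0 st tT (Ar w Aw).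
  apply: filterS => n h; have := le_lt_trans (ler_norm _) h.
  have f0 : 0 <= f n w + e by rewrite addr_ge0 ?pos0 ?ltW.
  by rewrite ge_max f0 andbT -lerBlDr /f le_max => ?; apply/orP; left; lra.
- move=> n; pose J w := grid_hit s t n.+1 (r w).
  have gT i : (i <= n.+1)%N -> 0 <= grid s t n.+1 i <= T.
    by move=> /(grid_itv st)/andP[h1 h2]; rewrite (le_trans s0)//= (le_trans h2).
  have FJ j : (j <= n.+1)%N -> F (grid s t n.+1 j) (A `&` J @^-1` [set j]).
    move=> jn; apply: sub_algebraI; [exact/sF/gT| |exact: grid_hit_sub_algebra].
    by have /andP[h1 h2] := grid_itv st jn; apply: (Fle s0 h1 (le_trans h2 tT)).
  have J0 j : (n.+1 < j)%N -> A `&` J @^-1` [set j] = set0.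
    by move=> nj; apply/seteqP; split => // w [_ /= Jj]; move: nj; rewrite -Jj ltnNge grid_hit_le.
  rewrite (eq_integral (fun w => (Num.max (Y (grid s t n.+1 (minn (J w) n.+1)) w - c) 0)%:E)); last first.
    by move=> w _; rewrite /f -/(J w) (minn_idPl (grid_hit_le _ _ _ _)).
  have mmin j : (minn j n.+1 <= n.+1)%N by rewrite geq_minr.
  apply: (@integral_countable_le _ _ _ P A J
    (fun j w => Num.max (Y (grid s t n.+1 (minn j n.+1)) w - c) 0)
    (fun _ w => Num.max (Y t w - c) 0)) => //.
  + move=> j; have [jn|nj] := leqP j n.+1; last by rewrite J0.
    exact: (Fm (gT _ jn) (FJ _ jn)).
  + by move=> j; apply: mpos; apply: adapted_measurable => //; exact: gT.
  + by move=> j; apply: mpos; exact: adapted_measurable.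
  + move=> j; have [jn|nj] := leqP j n.+1; last by rewrite J0// !integral_set0.
    apply: martingale_pos_le => //; [| |exact: FJ].
      by have /andP[] := gT _ jn.
    by have /andP[] := grid_itv st jn.
- exact: cvg_cst.
Qed.

End stopped.

Section optional_stopping_theorem.
Variables (Y : R -> W -> R) (r : W -> R).
Hypothesis mY : martingale T P F Y.
Hypothesis cY : forall w, {within `[0, T], continuous (Y ^~ w)}.
Hypothesis sr : stopping_time T F r.

Lemma stopped_integrable (t : R) : 0 <= t <= T ->
  P.-integrable setT (EFin \o (fun w => Y (Num.min t (r w)) w)).
Proof.
move=> tT'; have /andP[t0 tT] := tT'.
have [aY iY _] := mY.
have mr := sub_measurable_measurable (sF tT') (Fm tT') (stopped_sub_measurable mY cY sr tT').
have mt := adapted_measurable aY tT'.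
have mpos (f : W -> R) : measurable_fun setT f ->
    measurable_fun setT (fun w => (Num.max (f w - 0) 0)%:E).
  by move=> mf; apply: measurable_funTS_EFin; apply: measurable_maxr => //; exact: measurable_funB.
have pos0 (x : R) : (0 <= (Num.max (x - 0) 0)%:E)%E by rewrite lee_fin le_max lexx orbT.
have fin (Z : R -> W -> R) : martingale T P F Z -> (\int[P]_w (Num.max (Z t w - 0) 0)%:E < +oo)%E.
  move=> [aZ /(_ t)]; rewrite in_itv/= => /(_ tT') /integrableP[mZ iZ] _.
  apply: le_lt_trans iZ; apply: ge0_le_integral => //.
  - by apply: mpos; exact: adapted_measurable.
  - exact: measurableT_comp.
  - by move=> w _ /=; rewrite subr0 lee_fin ge_max normr_ge0 ler_norm.
apply/integrableP; split; first exact/measurable_EFinP.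
apply: (@le_lt_trans _ _ (\int[P]_w ((Num.max (Y (Num.min t (r w)) w - 0) 0)%:E
    + (Num.max (- Y (Num.min t (r w)) w - 0) 0)%:E))%E).
  apply: ge0_le_integral => //.
  - by apply: measurableT_comp => //; exact/measurable_EFinP.
  - by apply: emeasurable_funD; apply: mpos => //; exact: measurableT_comp.
  - move=> w _ /=; rewrite -EFinD lee_fin !subr0 ler_norml.
    by case: (leP (Y (Num.min t (r w)) w) 0); case: (leP (- Y (Num.min t (r w)) w) 0) => *; apply/andP; split; lra.
rewrite ge0_integralD//; [|exact: mpos|by apply: mpos; exact: measurableT_comp].
have F0 : F 0 setT by apply: sub_algebraT; apply: sF; rewrite lexx (le_trans t0).
apply: lte_add_pinfty.
  apply: le_lt_trans (fin _ mY); apply: (stopped_pos_le mY cY sr 0 (lexx 0)) => // w _; exact: sr.1.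
have cN w : {within `[0, T], continuous (fun t => - Y t w)} by move=> x; apply: cvgN; exact: cY.
apply: le_lt_trans (fin _ (martingaleN mY)).
by apply: (stopped_pos_le (martingaleN mY) cN sr 0 (lexx 0)) => // w _; exact: sr.1.
Qed.

(** The positive parts above the level [c] are compared with [c] going to minus
    infinity, where truncation costs nothing in the limit. Uniform
    integrability of the stopped values is thereby avoided. *)
Lemma stopped_le (s t : R) A : 0 <= s -> s <= t -> t <= T -> F s A ->
  (forall w, A w -> s <= r w) ->
  (\int[P]_(w in A) Y (Num.min t (r w)) w <= \int[P]_(w in A) Y t w).
Proof.
move=> s0 st tT FA Ar.
have tT' : 0 <= t <= T by rewrite (le_trans s0).
have sT : 0 <= s <= T by rewrite s0 (le_trans st).
have mA : measurable A by exact: (Fm sT).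
have [aY iY _] := mY.
have mt := adapted_measurable aY tT'.
have ir : P.-integrable A (EFin \o (fun w => Y (Num.min t (r w)) w)).
  by apply: integrableS (stopped_integrable tT').
have it : P.-integrable A (EFin \o Y t).
  by apply: integrableS (iY t _) => //; rewrite in_itv.
have ic (c : R) : P.-integrable A (EFin \o cst c) by exact: finite_measure_integrable_cst.
have iB (f g : W -> R) : P.-integrable A (EFin \o f) -> P.-integrable A (EFin \o g) ->
   P.-integrable A (EFin \o (fun w => f w - g w)).
  by move=> fi gi; rewrite (_ : _ \o _ = (EFin \o f) \- (EFin \o g))%E//; exact: integrableB.
have ipos (f : W -> R) : P.-integrable A (EFin \o f) -> P.-integrable A (EFin \o (fun w => Num.max (f w) 0)).
  move=> fi; have mf : measurable_fun A f by apply/measurable_EFinP; exact: measurable_int fi.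
  apply: le_integrable fi => //.
    by apply/measurable_EFinP; exact: measurable_maxr.
  move=> w _ /=; rewrite lee_fin ger0_norm ?le_max ?lexx ?orbT//.
  by rewrite ge_max normr_ge0 ler_norm.
(* The second term is the error made by truncating [Y t] at [c]. *)
have key (c : R) : \int[P]_(w in A) Y (Num.min t (r w)) w <=
    \int[P]_(w in A) Y t w + \int[P]_(w in A) Num.max (c - Y t w) 0.
  have i1 := ipos _ (iB _ _ ir (ic c)); have i2 := ipos _ (iB _ _ it (ic c)).
  have i3 := ipos _ (iB _ _ (ic c) it).
  have : \int[P]_(w in A) Num.max (Y (Num.min t (r w)) w - c) 0 <= \int[P]_(w in A) Num.max (Y t w - c) 0.
    apply: fine_le; [exact: integrable_fin_num i1|exact: integrable_fin_num i2|].
    exact: (stopped_pos_le mY cY sr c s0).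
  have -> : \int[P]_(w in A) Num.max (Y t w - c) 0 =
      \int[P]_(w in A) Y t w - \int[P]_(w in A) c + \int[P]_(w in A) Num.max (c - Y t w) 0.
    rewrite -(RintegralB mA it (ic c)) -(RintegralD mA (iB _ _ it (ic c)) i3).
    by apply: eq_Rintegral => w _ /=; case: (leP (Y t w - c) 0) => h; case: (leP (c - Y t w) 0) => h'; lra.
  have : \int[P]_(w in A) (Y (Num.min t (r w)) w - c) <= \int[P]_(w in A) Num.max (Y (Num.min t (r w)) w - c) 0.
    by apply: le_Rintegral => //; [exact: (iB _ _ ir (ic c))|move=> w _; rewrite le_max lexx].
  by rewrite (RintegralB mA ir (ic c)); lra.
have lim0 : \int[P]_(w in A) Num.max (- n%:R - Y t w) 0 @[n --> \oo] --> (0 : R).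
  have := @dominated_cvg _ _ _ P A mA (fun n w => (Num.max (- n%:R - Y t w) 0)%:E)
    (cst 0%E) (fun w => `|Y t w|%:E).
  rewrite integral0 => H; have <- : fine 0%E = 0 :> R by []. apply: fine_cvg; apply: H => //.
  - move=> n; apply: measurable_funTS_EFin; apply: measurable_maxr => //; exact: measurable_funB.
  - move=> w Aw; apply: cvg_near_cst; near=> n; congr EFin; apply/max_idPr.
    by rewrite lerBlDr add0r lerNl; near: n; exact: nbhs_infty_ger.
  - exact: (integrable_norm it).
  - move=> n w Aw; rewrite lee_fin ger0_norm ?le_max ?lexx ?orbT// ge_max normr_ge0 andbT.
    by rewrite (@le_trans _ _ (- Y t w))// ?gerDr ?oppr_le0// -normrN ler_norm.
apply/ler_addgt0Pr => e e0.
have /cvgrPdist_lt/(_ e e0) [n _ /(_ n (leqnn n)) /=] := lim0.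
rewrite sub0r normrN => /(le_lt_trans (ler_norm _))/ltW ne.
by apply: le_trans (key (- n%:R)) _; rewrite lerD2l.
Unshelve. all: by end_near.
Qed.

End optional_stopping_theorem.

Section stopped_martingale.
Variables (Y : R -> W -> R) (r : W -> R).
Hypothesis mY : martingale T P F Y.
Hypothesis cY : forall w, {within `[0, T], continuous (Y ^~ w)}.
Hypothesis sr : stopping_time T F r.

(** The reverse inequality is [stopped_le] for [- Y]. *)
Lemma stopped_eq (s t : R) A : 0 <= s -> s <= t -> t <= T -> F s A ->
  (forall w, A w -> s <= r w) ->
  (\int[P]_(w in A) (Y (Num.min t (r w)) w)%:E = \int[P]_(w in A) (Y t w)%:E)%E.
Proof.
move=> s0 st tT FA Ar.
have tT' : 0 <= t <= T by rewrite (le_trans s0).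
have sT : 0 <= s <= T by rewrite s0 (le_trans st).
have mA : measurable A by exact: (Fm sT).
have [aY iY _] := mY.
have ir : P.-integrable A (EFin \o (fun w => Y (Num.min t (r w)) w)).
  by apply: integrableS (stopped_integrable mY cY sr tT').
have it : P.-integrable A (EFin \o Y t).
  by apply: integrableS (iY t _) => //; rewrite in_itv.
have cN w : {within `[0, T], continuous (fun t => - Y t w)} by move=> x; apply: cvgN; exact: cY.
have h1 := stopped_le mY cY sr s0 st tT FA Ar.
have := stopped_le (martingaleN mY) cN sr s0 st tT FA Ar.
have RN (f : W -> R) : P.-integrable A (EFin \o f) -> \int[P]_(w in A) (- f w) = - \int[P]_(w in A) f w.
  by move=> fi; rewrite /Rintegral -fineN -(integralN (integrable_add_def mA fi)).
rewrite (RN _ ir) (RN _ it) lerN2 => h2.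
have : (\int[P]_(w in A) Y (Num.min t (r w)) w) = \int[P]_(w in A) Y t w.
  by apply/le_anti; rewrite h1 h2.
rewrite /Rintegral => h; rewrite -(fineK (integrable_fin_num mA ir)) h fineK//.
exact: integrable_fin_num it.
Qed.

(** On the part of [A] where [r <= s] the stopped process no longer moves; the
    rest of [A] is known at time [s] and falls under [stopped_eq]. *)
Lemma stopped_martingale : martingale T P F (fun t w => Y (Num.min t (r w)) w).
Proof.
have [aY iY eY] := mY; split.
- move=> t; rewrite in_itv => tT B mB.
  by have /(sub_measurableP (sF tT)) := stopped_sub_measurable mY cY sr tT; exact.
- by move=> t; rewrite in_itv => tT; exact: stopped_integrable.
move=> s t sI tI st A FA.
have sT : 0 <= s <= T by move: sI; rewrite in_itv.
have tT : 0 <= t <= T by move: tI; rewrite in_itv.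
have /andP[s0 sT'] := sT; have /andP[t0 tT'] := tT.
pose A1 := A `&` [set w | r w <= s]; pose A2 := A `&` [set w | s < r w].
have FA1 : F s A1 by apply: sub_algebraI => //; [exact: sF|apply: sr.2].
have FA2 : F s A2 by apply: sub_algebraI => //; [exact: sF|exact: stopping_time_gt].
have AE : A = A1 `|` A2.
  rewrite -setIUr; apply/seteqP; split => [w Aw|w []//]; split => //=.
  by case: (leP (r w) s); [left|right].
have disj : [disjoint A1 & A2].
  by apply/disj_setPS => w [[_ /= h1] [_ /= h2]]; move: h2; rewrite ltNge h1.
have mA1 : measurable A1 by exact: (Fm sT). have mA2 : measurable A2 by exact: (Fm sT).
have spl u : 0 <= u <= T -> (\int[P]_(w in A) (Y (Num.min u (r w)) w)%:E =
    \int[P]_(w in A1) (Y (Num.min u (r w)) w)%:E + \int[P]_(w in A2) (Y (Num.min u (r w)) w)%:E)%E.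
  move=> uT; rewrite {1}AE integral_setU//.
  by apply: measurable_funTS; exact: measurable_int (stopped_integrable mY cY sr uT).
rewrite (spl _ sT) (spl _ tT); congr (_ + _)%E.
  apply: eq_integral => w /[!inE] -[_ /= rs].
  by rewrite (min_idPr (le_trans rs st)) (min_idPr rs).
rewrite (stopped_eq s0 st tT' FA2); last by move=> w [_ /= /ltW].
rewrite (stopped_eq s0 (lexx s) sT' FA2); last by move=> w [_ /= /ltW].
exact: eY.
Qed.

End stopped_martingale.

End optional_stopping.

(** * Second moments of increments *)

Section real_integrable.
Context d (W : measurableType d) (R : realType) (mu : {measure set W -> \bar R}) (A : set W).
Hypothesis mA : measurable A.

Lemma real_integrableD (f g : W -> R) : mu.-integrable A (EFin \o f) ->
  mu.-integrable A (EFin \o g) -> mu.-integrable A (EFin \o (fun w => f w + g w)).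
Proof. by move=> fi gi; rewrite (_ : _ \o _ = (EFin \o f) \+ (EFin \o g))%E//; exact: integrableD. Qed.

Lemma real_integrableB (f g : W -> R) : mu.-integrable A (EFin \o f) ->
  mu.-integrable A (EFin \o g) -> mu.-integrable A (EFin \o (fun w => f w - g w)).
Proof. by move=> fi gi; rewrite (_ : _ \o _ = (EFin \o f) \- (EFin \o g))%E//; exact: integrableB. Qed.

Lemma real_integrableZ (c : R) (f : W -> R) : mu.-integrable A (EFin \o f) ->
  mu.-integrable A (EFin \o (fun w => c * f w)).
Proof. by move=> fi; exact: (integrableZl mA c fi). Qed.

Lemma ae_le_Rintegral (f g : W -> R) : mu.-integrable A (EFin \o f) ->
  mu.-integrable A (EFin \o g) -> {ae mu, forall w, A w -> f w <= g w} ->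
  \int[mu]_(w in A) f w <= \int[mu]_(w in A) g w.
Proof.
move=> fi gi fg; rewrite -subr_ge0 -RintegralB//.
rewrite (_ : \int[mu]_(w in A) _ = \int[mu]_(w in A) Num.max (g w - f w) 0).
  by apply: Rintegral_ge0 => w _; rewrite le_max lexx orbT.
have /measurable_EFinP mf := measurable_int _ fi.
have /measurable_EFinP mg := measurable_int _ gi.
congr fine; apply: ae_eq_integral => //.
- by apply/measurable_EFinP; exact: measurable_funB.
- by apply/measurable_EFinP; apply: measurable_maxr => //; exact: measurable_funB.
- by apply: filterS fg => w /[apply] h; rewrite (max_idPl _)// subr_ge0.
Qed.

End real_integrable.

(** [U] is a stopped local martingale and [V] stands for its square minus its
    bracket, so [UV] bounds the growth of the bracket by [L (t - s)]. *)
Section energy.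
Context d (W : measurableType d) (R : realType) (P : probability W R) (T : R)
  (F : R -> set (set W)).
Hypothesis sF : forall t : R, 0 <= t <= T -> sigma_algebra setT (F t).
Hypothesis Fm : forall t : R, 0 <= t <= T -> F t `<=` measurable.
Variables (L : R) (U V : R -> W -> R).
Hypothesis L0 : 0 <= L.
Hypothesis mU : martingale T P F U.
Hypothesis mV : martingale T P F V.
Hypothesis U0 : forall w, U 0 w = 0.
Hypothesis V0 : forall w, V 0 w = 0.
Hypothesis UV : forall s t : R, 0 <= s -> s <= t -> t <= T ->
  {ae P, forall w, U t w ^+ 2 - U s w ^+ 2 <= V t w - V s w + L * (t - s)}.

Lemma integrable_energy (t : R) : 0 <= t <= T ->
  P.-integrable setT (EFin \o (fun w => U t w ^+ 2)).
Proof.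
move=> tT; have /andP[t0 tT'] := tT; have [aU _ _] := mU; have [_ iV _] := mV.
have mUt := adapted_measurable sF Fm aU tT.
have mU2 : measurable_fun setT (fun w => U t w ^+ 2) by exact: measurable_funX.
have ig : P.-integrable setT (EFin \o (fun w => V t w + L * t)).
  apply: real_integrableD => //; first by apply: iV; rewrite in_itv.
  exact: finite_measure_integrable_cst.
apply/integrableP; split; first exact/measurable_EFinP.
have /integrableP[mg] := ig; apply: le_lt_trans.
apply: ae_ge0_le_integral => //.
- by apply: measurableT_comp => //; exact/measurable_EFinP.
- exact: measurableT_comp.
- apply: filterS (UV (lexx 0) t0 tT') => w; rewrite U0 V0 expr0n /= !subr0 => h _.
  by rewrite lee_fin ger0_norm ?sqr_ge0// (le_trans h)// ler_norm.
Qed.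

(** For a constant [c] the difference of the two integrands is controlled by
    [UV] up to increments of the martingales [U] and [V], which integrate to 0. *)
Lemma energy_center_le (c s t : R) A : 0 <= s -> s <= t -> t <= T -> F s A ->
  (\int[P]_(w in A) ((U t w - c) ^+ 2)%:E
    <= \int[P]_(w in A) ((U s w - c) ^+ 2 + L * (t - s))%:E)%E.
Proof.
move=> s0 st tT FA; have tT' : 0 <= t <= T by rewrite (le_trans s0).
have sT : 0 <= s <= T by rewrite s0 (le_trans st).
have sI : s \in `[0, T] by rewrite in_itv.
have tI : t \in `[0, T] by rewrite in_itv.
have mA : measurable A by exact: (Fm sT).
have [aU iU eU] := mU; have [_ iV eV] := mV.
have ic (k : R) : P.-integrable A (EFin \o fun=> k) by exact: finite_measure_integrable_cst.
have iA (f : W -> R) : P.-integrable setT (EFin \o f) -> P.-integrable A (EFin \o f).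
  exact: integrableS.
have iUA u (uI : u \in `[0, T]) := iA _ (iU u uI).
have iVA u (uI : u \in `[0, T]) := iA _ (iV u uI).
have iU2 u (uT : 0 <= u <= T) := iA _ (integrable_energy uT).
have iq u : 0 <= u <= T -> P.-integrable A (EFin \o (fun w => (U u w - c) ^+ 2)).
  move=> uT; have uI : u \in `[0, T] by rewrite in_itv.
  rewrite (_ : (fun w => _) = fun w => U u w ^+ 2 - (2 * c) * U u w + c ^+ 2); last first.
    by apply/funext => w; ring.
  apply: real_integrableD => //; apply: real_integrableB => //; first exact: iU2.
  by apply: real_integrableZ => //; exact: iUA.
have iqs : P.-integrable A (EFin \o (fun w => (U s w - c) ^+ 2 + L * (t - s))).
  by apply: real_integrableD => //; exact: iq.
rewrite -(fineK (integrable_fin_num mA (iq _ tT'))) -(fineK (integrable_fin_num mA iqs)) lee_fin.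
change (\int[P]_(w in A) (U t w - c) ^+ 2 <= \int[P]_(w in A) ((U s w - c) ^+ 2 + L * (t - s))).
have RM (X : R -> W -> R) : martingale T P F X -> \int[P]_(w in A) X t w = \int[P]_(w in A) X s w.
  by move=> [_ _ eX]; congr fine; exact: eX.
have -> : \int[P]_(w in A) ((U s w - c) ^+ 2 + L * (t - s)) =
   \int[P]_(w in A) (((U s w - c) ^+ 2 + L * (t - s)) + ((V t w - V s w) - 2 * c * (U t w - U s w))).
  have iVV := real_integrableB mA (iVA t tI) (iVA s sI).
  have iUU := real_integrableB mA (iUA t tI) (iUA s sI).
  have iUc := real_integrableZ mA (2 * c) iUU.
  rewrite [RHS](RintegralD mA iqs (real_integrableB mA iVV iUc)).
  rewrite (RintegralB mA iVV iUc) (RintegralZl _ mA iUU).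
  rewrite (RintegralB mA (iVA t tI) (iVA s sI)) (RintegralB mA (iUA t tI) (iUA s sI)).
  by rewrite (RM U)// (RM V)// !subrr mulr0 subr0 addr0.
apply: ae_le_Rintegral => //; first exact: iq.
  apply: real_integrableD => //; apply: real_integrableB => //.
    by apply: real_integrableB => //; exact: iVA.
  by apply: real_integrableZ => //; apply: real_integrableB => //; exact: iUA.
apply: filterS (UV s0 st tT) => w h _; rewrite -subr_ge0.
have -> : (U s w - c) ^+ 2 + L * (t - s) + (V t w - V s w - 2 * c * (U t w - U s w)) - (U t w - c) ^+ 2
  = (V t w - V s w + L * (t - s)) - (U t w ^+ 2 - U s w ^+ 2) by ring.
by rewrite subr_ge0.
Qed.

(** [energy_center_le] with the constant [c] frozen at the discretized value of
    [U s]. Freezing takes the place of expanding the square and of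
    conditioning the product [U t * U s]. *)
Lemma energy_increment_le (s t : R) A : 0 <= s -> s <= t -> t <= T -> F s A ->
  (\int[P]_(w in A) ((U t w - U s w) ^+ 2)%:E <= (L * (t - s))%:E * P A)%E.
Proof.
move=> s0 st tT FA; have tT' : 0 <= t <= T by rewrite (le_trans s0).
have sT : 0 <= s <= T by rewrite s0 (le_trans st).
have mA : measurable A by exact: (Fm sT).
have [aU _ _] := mU.
have mUt := adapted_measurable sF Fm aU tT'; have mUs := adapted_measurable sF Fm aU sT.
have K0 : 0 <= L * (t - s) by rewrite mulr_ge0// subr_ge0.
have e0 n : 0 < n.+1%:R^-1 :> R by [].
have mG n : measurable_fun setT (fun w => grid_floor n.+1%:R^-1 (U s w)).
  exact: measurableT_comp (measurable_grid_floor _) mUs.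
apply: (@integral_fatou_le _ _ _ P A _
  (fun n w => (U t w - grid_floor n.+1%:R^-1 (U s w)) ^+ 2)
  (fun n => (n.+1%:R^-1 ^+ 2 + L * (t - s))%:E * P A)%E) => //.
- by apply: measurable_funX; exact: measurable_funB.
- by move=> n; apply: measurable_funX; exact: measurable_funB.
- by move=> w; exact: sqr_ge0.
- by move=> n w; exact: sqr_ge0.
- apply: aeW => w _ e epos.
  have : (fun n => (U t w - grid_floor n.+1%:R^-1 (U s w)) ^+ 2) @ \oo --> (U t w - U s w) ^+ 2.
    have cf : (fun n => grid_floor n.+1%:R^-1 (U s w)) @ \oo --> U s w.
      apply/cvgrPdist_lt => a a0.
      have := near_infty_natSinv_lt (PosNum a0); apply: filterS => n /= na.
      have /andP[h1 h2] := grid_floor_itv (U s w) (e0 n).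
      by rewrite ger0_norm ?subr_ge0// (lt_trans _ na)// ltrBlDl.
    rewrite expr2; under eq_fun do rewrite expr2.
    by apply: cvgM; apply: cvgB => //; exact: cvg_cst.
  move/cvgrPdist_lt => /(_ e epos); apply: filterS => n /ltW/(le_trans (ler_norm _)).
  by rewrite lerBlDl.
- move=> n; apply: (@le_trans _ _ (\int[P]_(w in A)
     ((U s w - grid_floor n.+1%:R^-1 (U s w)) ^+ 2 + L * (t - s))%:E)%E).
    apply: (@integral_frozen_le _ _ _ P (F s) A (U s) (fun c w => (U t w - c) ^+ 2)
      (fun c w => (U s w - c) ^+ 2 + L * (t - s))) => //.
    + exact: sF.
    + exact: Fm.
    + exact: (adapted_sub_measurable sF aU sT).
    + by move=> c; apply: measurable_funX; exact: measurable_funB.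
    + by move=> c; apply: measurable_funD => //; apply: measurable_funX; exact: measurable_funB.
    + by move=> c w; exact: sqr_ge0.
    + by move=> c w; rewrite addr_ge0// sqr_ge0.
    + by move=> c B FB _; exact: energy_center_le.
  rewrite -integral_cst//; apply: ge0_le_integral => //.
  + by move=> w _; rewrite lee_fin addr_ge0// sqr_ge0.
  + apply: measurable_funTS_EFin; apply: measurable_funD => //; apply: measurable_funX.
    exact: measurable_funB.
  + move=> w _; rewrite lee_fin lerD2r.
    have /andP[h1 h2] := grid_floor_itv (U s w) (e0 n).
    by rewrite lerXn2r ?nnegrE ?subr_ge0// lerBlDl ltW.
- have PA : P A \is a fin_num by exact: fin_num_measure.
  rewrite -(fineK PA) -EFinM; under eq_fun do rewrite -EFinM.
  apply: cvg_EFin; first by near=> n.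
  rewrite /=; apply: cvgM; last exact: cvg_cst.
  rewrite -[X in _ --> X]add0r; apply: cvgD; last exact: cvg_cst.
  rewrite -[X in _ --> X](mulr0 0); under eq_fun do rewrite expr2.
  by apply: cvgM; exact: cvg_harmonic.
Unshelve. all: by end_near.
Qed.

End energy.

(** * Exponential moments of increments *)

Lemma uniform_continuity (R : realType) (a b : R) (f : R -> R) :
  {within `[a, b], continuous f} -> forall e : R, 0 < e ->
  exists2 d : R, 0 < d & forall x y, a <= x <= b -> a <= y <= b -> `|x - y| < d -> `|f x - f y| < e.
Proof.
move=> cf e e0; have e20 : 0 < e / 2 by rewrite divr_gt0.
have := @segment_compact R a b => /compact_near_coveringP.
move=> /(_ nat \oo (fun n x => a <= x <= b -> forall y, a <= y <= b -> `|x - y| < n.+1%:R^-1 -> `|f x - f y| < e)).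
case=> [x|n _ /(_ n (leqnn n)) H]; last first.
  by exists n.+1%:R^-1 => // x y xab yab xy; apply: H => //=; rewrite in_itv.
rewrite /= in_itv /= => xab; have [d d0 H] := within_continuous_eps cf xab e20.
have d20 : 0 < d / 2 by rewrite divr_gt0.
near=> x' n => /= x'ab y yab x'y.
have nd : n.+1%:R^-1 < d / 2 by near: n; exact: (near_infty_natSinv_lt (PosNum d20)).
have xx' : `|x - x'| < d / 2 by near: x'; exact: nbhsx_ballx.
have xy : `|x - y| < d.
  by rewrite (le_lt_trans (ler_distD x' _ _))// [ltRHS](splitr d) ltrD// (lt_trans x'y).
rewrite (le_lt_trans (ler_distD (f x) _ _))// [ltRHS](splitr e) ltrD//; last exact: H.
by rewrite distrC; apply: H => //; rewrite (lt_le_trans xx')//.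
Unshelve. all: by end_near.
Qed.

Lemma quad_gt0 (R : realType) (x : R) : 0 < 1 + x + x ^+ 2.
Proof. by have := sqr_ge0 (x + 2^-1); rewrite sqrrD; lra. Qed.

Lemma expR_le_quad (R : realType) (x : R) : `|x| <= 4^-1 -> expR x <= 1 + x + x ^+ 2.
Proof.
rewrite ler_norml => /andP[x1 x2].
have h : expR (x / 2) <= (1 - x / 2)^-1.
  rewrite -[leLHS]invrK -expRN lef_pV2 ?posrE ?expR_gt0//; last lra.
  by have := expR_ge1Dx (- (x / 2)).
rewrite [x in expR x](splitr x) expRD.
have p0 : 0 < 1 - x / 2 by lra.
apply: (@le_trans _ _ ((1 - x / 2)^-1 * (1 - x / 2)^-1)); first by rewrite ler_pM ?expR_ge0.
rewrite -invfM -[leLHS]mul1r ler_pdivrMr ?mulr_gt0//.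
nra.
Qed.

Section sub_measurable_ops.
Context d (W : measurableType d) (R : realType) (G : set (set W)).
Implicit Types f g : W -> R.

Lemma sub_measurable_cst (c : R) : sub_measurable G (fun=> c : R).
Proof. exact: measurable_cst. Qed.

Lemma sub_measurableD f g : sub_measurable G f -> sub_measurable G g ->
  sub_measurable G (fun w => f w + g w).
Proof. exact: (@measurable_funD _ (g_sigma_algebraType G)). Qed.

Lemma sub_measurableB f g : sub_measurable G f -> sub_measurable G g ->
  sub_measurable G (fun w => f w - g w).
Proof. exact: (@measurable_funB _ (g_sigma_algebraType G)). Qed.

Lemma sub_measurableM f g : sub_measurable G f -> sub_measurable G g ->
  sub_measurable G (fun w => f w * g w).
Proof. exact: (@measurable_funM _ (g_sigma_algebraType G)). Qed.

Lemma sub_measurableX f n : sub_measurable G f -> sub_measurable G (fun w => f w ^+ n).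
Proof. by move=> mf; exact: (@measurable_funX _ (g_sigma_algebraType G) R setT f n mf). Qed.

Lemma sub_measurable_comp (h : R -> R) f : measurable_fun setT h ->
  sub_measurable G f -> sub_measurable G (fun w => h (f w)).
Proof. by move=> mh mf; rewrite /sub_measurable; exact: (measurableT_comp mh mf). Qed.

End sub_measurable_ops.

Section discrete_product.
Context d (W : measurableType d) (R : realType) (P : probability W R) (G : nat -> set (set W)).
Hypothesis sG : forall i, sigma_algebra setT (G i).
Hypothesis Gm : forall i, G i `<=` measurable.
Hypothesis GS : forall i, G i `<=` G i.+1.

Lemma filtration_le i j : (i <= j)%N -> G i `<=` G j.
Proof.
move=> /subnK <-; elim: (j - i)%N => [|k IH]; first by rewrite add0n.
by apply: subset_trans IH _; rewrite addSn; exact: GS.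
Qed.

Lemma sub_measurable_prod (f : nat -> W -> R) : (forall i, sub_measurable (G i.+1) (f i)) ->
  forall n, sub_measurable (G n) (fun w => \prod_(i < n) f i w).
Proof.
move=> mf; elim=> [|n IH].
  by under eq_fun do rewrite big_ord0; exact: sub_measurable_cst.
under eq_fun do rewrite big_ord_recr /=.
apply: sub_measurableM; last exact: mf.
exact: (sub_measurableS (sG n) (sG n.+1) (@GS n) IH).
Qed.

Lemma sub_measurable_sum (f : nat -> W -> R) : (forall i, sub_measurable (G i.+1) (f i)) ->
  forall n, sub_measurable (G n) (fun w => \sum_(i < n) f i w).
Proof.
move=> mf; elim=> [|n IH].
  by under eq_fun do rewrite big_ord0; exact: sub_measurable_cst.
under eq_fun do rewrite big_ord_recr /=.
apply: sub_measurableD; last exact: mf.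
exact: (sub_measurableS (sG n) (sG n.+1) (@GS n) IH).
Qed.

Lemma integral_indic_mul (A : set W) (f : W -> R) :
  (\int[P]_w (\1_A w * f w)%:E = \int[P]_(w in A) (f w)%:E)%E.
Proof.
rewrite [RHS]integral_mkcond; apply: eq_integral => w _.
by rewrite patchE indicE; case: ifPn => _; rewrite ?mul1r ?mul0r.
Qed.

(** Iterated conditioning: each factor is at most [K i] on average given the
    past, and the earlier factors belong to that past. *)
Lemma integral_prod_le (f : nat -> W -> R) (K : nat -> R) :
  (forall i, sub_measurable (G i.+1) (f i)) -> (forall i w, 0 <= f i w) ->
  (forall i, 0 <= K i) ->
  (forall i A, G i A -> (\int[P]_(w in A) (f i w)%:E <= (K i)%:E * P A)%E) ->
  forall n A, G 0 A ->
  (\int[P]_(w in A) (\prod_(i < n) f i w)%:E <= (\prod_(i < n) K i)%:E * P A)%E.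
Proof.
move=> mf f0 K0 fK n A GA; elim: n => [|n IH].
  under eq_integral do rewrite big_ord0; rewrite big_ord0 integral_cst//.
  exact: (Gm GA).
rewrite -integral_indic_mul.
under eq_integral do rewrite big_ord_recr/= mulrA.
apply: (@le_trans _ _ ((K n)%:E * \int[P]_w (\1_A w * \prod_(i < n) f i w)%:E)%E).
  apply: (integral_mul_le (sG n) (@Gm n)) => //.
  - apply: sub_measurableM; last exact: sub_measurable_prod.
    exact: (sub_measurable_indic (sG n) (filtration_le (leq0n n) GA)).
  - by move=> w; rewrite mulr_ge0 ?prodr_ge0// indicE.
  - exact: (sub_measurable_measurable (sG n.+1) (@Gm n.+1)).
  - exact: fK.
rewrite integral_indic_mul big_ord_recr/= mulrC EFinM -muleA lee_wpmul2l//.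
by rewrite lee_fin.
Qed.

End discrete_product.

Section exponential_moment.
Context d (W : measurableType d) (R : realType) (P : probability W R) (T : R)
  (F : R -> set (set W)).
Hypothesis sF : forall t : R, 0 <= t <= T -> sigma_algebra setT (F t).
Hypothesis Fm : forall t : R, 0 <= t <= T -> F t `<=` measurable.
Hypothesis Fle : forall s t : R, 0 <= s -> s <= t -> t <= T -> F s `<=` F t.
Variables (L : R) (U : R -> W -> R).
Hypothesis L0 : 0 <= L.
Hypothesis mU : martingale T P F U.
Hypothesis cU : forall w, {within `[0, T], continuous (U ^~ w)}.
Hypothesis energyU : forall (s t : R) A, 0 <= s -> s <= t -> t <= T -> F s A ->
  (\int[P]_(w in A) ((U t w - U s w) ^+ 2)%:E <= (L * (t - s))%:E * P A)%E.

(** The linear term integrates to 0 and the square is bounded by [energyU]. *)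
Lemma integral_quad_le (l s t : R) A : 0 <= s -> s <= t -> t <= T -> F s A ->
  (\int[P]_(w in A) (1 + l * (U t w - U s w) + (l * (U t w - U s w)) ^+ 2)%:E
    <= (expR (l ^+ 2 * L * (t - s)))%:E * P A)%E.
Proof.
move=> s0 st tT FA; have tT' : 0 <= t <= T by rewrite (le_trans s0).
have sT : 0 <= s <= T by rewrite s0 (le_trans st).
have mA : measurable A by exact: (Fm sT).
have [aU iU eU] := mU.
have mUt := adapted_measurable sF Fm aU tT'; have mUs := adapted_measurable sF Fm aU sT.
have iUA (u : R) : 0 <= u <= T -> P.-integrable A (EFin \o U u).
  by move=> uT; apply: integrableS (iU u _) => //; rewrite in_itv.
have iD := real_integrableB mA (iUA _ tT') (iUA _ sT).
have PA : P A \is a fin_num by exact: fin_num_measure.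
have iD2 : P.-integrable A (EFin \o (fun w => (U t w - U s w) ^+ 2)).
  apply/integrableP; split.
    by apply: measurable_funTS_EFin; apply: measurable_funX; exact: measurable_funB.
  rewrite (eq_integral (fun w => ((U t w - U s w) ^+ 2)%:E)); last first.
    by move=> w _ /=; rewrite ger0_norm ?sqr_ge0.
  apply: le_lt_trans (energyU s0 st tT FA) _.
  by rewrite -(fineK PA) -EFinM ltry.
have i1 : P.-integrable A (EFin \o fun=> 1) by exact: finite_measure_integrable_cst.
have il := real_integrableZ mA l iD; have il2 := real_integrableZ mA (l ^+ 2) iD2.
rewrite (eq_integral (fun w => (1 + l * (U t w - U s w) + l ^+ 2 * (U t w - U s w) ^+ 2)%:E)); last first.
  by move=> w _; rewrite exprMn.
have iq := real_integrableD mA (real_integrableD mA i1 il) il2.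
rewrite -(fineK (integrable_fin_num mA iq)).
change ((\int[P]_(w in A) (1 + l * (U t w - U s w) + l ^+ 2 * (U t w - U s w) ^+ 2))%:E <=
  (expR (l ^+ 2 * L * (t - s)))%:E * P A)%E.
rewrite (RintegralD mA (real_integrableD mA i1 il) il2) (RintegralD mA i1 il).
rewrite !(RintegralZl _ mA)// (RintegralB mA (iUA _ tT') (iUA _ sT)).
have -> : \int[P]_(w in A) U t w = \int[P]_(w in A) U s w.
  by congr fine; apply: eU => //; rewrite in_itv.
rewrite subrr mulr0 addr0 Rintegral_cst// mul1r -(fineK PA) -EFinM lee_fin.
have h : \int[P]_(w in A) (U t w - U s w) ^+ 2 <= L * (t - s) * fine (P A).
  rewrite -lee_fin EFinM (fineK PA) /Rintegral fineK; first exact: energyU.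
  exact: integrable_fin_num iD2.
apply: (@le_trans _ _ ((1 + l ^+ 2 * L * (t - s)) * fine (P A))).
  rewrite mulrDl mul1r lerD2l -[l ^+ 2 * L * _]mulrA -[l ^+ 2 * _ * _]mulrA.
  by rewrite ler_wpM2l ?sqr_ge0.
by rewrite ler_wpM2r ?fine_ge0// expR_ge1Dx.
Qed.

(** For a fine grid the exponential of the increment is at most the product of
    the quadratic factors [1 + x + x^2], because a continuous path has small
    increments; each factor is controlled by [integral_quad_le]. Fatou's lemma
    replaces the integrability that is still unknown. *)
Lemma integral_exp_increment_le (l s t : R) A : 0 <= s -> s <= t -> t <= T -> F s A ->
  (\int[P]_(w in A) (expR (l * (U t w - U s w)))%:E
    <= (expR (l ^+ 2 * L * (t - s)))%:E * P A)%E.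
Proof.
move=> s0 st tT FA; have tT' : 0 <= t <= T by rewrite (le_trans s0).
have sT : 0 <= s <= T by rewrite s0 (le_trans st).
have [aU iU eU] := mU.
have mA : measurable A by exact: (Fm sT).
have mUt := adapted_measurable sF Fm aU tT'; have mUs := adapted_measurable sF Fm aU sT.
pose u n i := grid s t n.+1 (minn i n.+1).
have mn i n : (minn i n.+1 <= n.+1)%N by rewrite geq_minr.
have uT n i : 0 <= u n i <= T.
  by have /andP[h1 h2] := grid_itv st (mn i n); rewrite (le_trans s0)//= (le_trans h2).
have uS n i : u n i <= u n i.+1 by apply: grid_le => //; rewrite leq_min geq_minr andbT; lia.
have u0 n : u n 0%N = s by rewrite /u min0n grid0.
have un n : u n n.+1 = t by rewrite /u minnn gridN.
pose q (x : R) := 1 + x + x ^+ 2.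
pose f n i w := q (l * (U (u n i.+1) w - U (u n i) w)).
have f0 n i w : 0 <= f n i w by exact/ltW/quad_gt0.
have sUu n i : sub_measurable (F (u n i)) (U (u n i)) by exact: (adapted_sub_measurable sF aU (uT n i)).
have sUu' n i : sub_measurable (F (u n i.+1)) (U (u n i)).
  apply: (sub_measurableS (sF (uT n i)) (sF (uT n i.+1))) => //.
  by apply: Fle => //; [have /andP[] := uT n i|have /andP[] := uT n i.+1].
have sf n i : sub_measurable (F (u n i.+1)) (f n i).
  apply: (@sub_measurable_comp _ _ _ _ (fun x => q (l * x))); last exact: sub_measurableB.
  by apply: measurable_funD; [apply: measurable_funD => //; exact: measurable_funM|
     apply: measurable_funX; exact: measurable_funM].
have FS n i : F (u n i) `<=` F (u n i.+1).
  by apply: Fle => //; [have /andP[] := uT n i|have /andP[] := uT n i.+1].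
have mexp (g : W -> R) : measurable_fun setT g -> measurable_fun setT (fun w => expR (g w)).
  by move=> mg; exact: measurableT_comp.
apply: (@integral_fatou_le _ _ _ P A _ (fun n w => \prod_(i < n.+1) f n i w)
  (fun=> (expR (l ^+ 2 * L * (t - s)))%:E * P A)%E) => //.
- by apply: mexp; apply: measurable_funM => //; exact: measurable_funB.
- move=> n; apply: (sub_measurable_measurable (sF (uT n n.+1)) (Fm (uT n n.+1))).
  exact: (sub_measurable_prod (fun i => sF (uT n i)) (@FS n)).
- by move=> n w; exact: prodr_ge0.
- apply: aeW => w _ e e0.
  have c0 : 0 < (4 * (`|l| + 1))^-1 by rewrite invr_gt0 mulr_gt0// ltr_wpDl.
  have [del del0 H] := uniform_continuity (@cU w) c0.
  have ts1 : 0 < t - s + 1 by rewrite ltr_wpDl// subr_ge0.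
  have := near_infty_natSinv_lt (PosNum (divr_gt0 del0 ts1)); apply: filterS => n /= nd.
  apply: (@le_trans _ _ (\prod_(i < n.+1) f n i w)); last by rewrite lerDl ltW.
  have -> : expR (l * (U t w - U s w)) = \prod_(i < n.+1) expR (l * (U (u n i.+1) w - U (u n i) w)).
    rewrite -expR_sum; congr expR; rewrite -mulr_sumr; congr (_ * _).
    rewrite -(big_mkord xpredT (fun i => U (u n i.+1) w - U (u n i) w)).
    by rewrite (telescope_sumr (fun i => U (u n i) w))// u0 un.
  apply: ler_prod => i _; rewrite expR_ge0/=; apply: expR_le_quad.
  have step : `|u n i.+1 - u n i| < del.
    have iN := ltn_ord i; rewrite /u (minn_idPl iN) (minn_idPl (ltnW iN)) gridS addrC addKr.
    rewrite ger0_norm ?divr_ge0 ?subr_ge0//.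
    apply: (@le_lt_trans _ _ ((t - s + 1) * n.+1%:R^-1)); first by rewrite ler_wpM2r// lerDl.
    by rewrite mulrC -ltr_pdivlMr.
  have := H _ _ (uT n i.+1) (uT n i) step.
  rewrite -[(4 * _)^-1]mul1r ltr_pdivlMr ?mulr_gt0 ?ltr_wpDl// normrM => /ltW h.
  rewrite -[4^-1]mul1r ler_pdivlMr//; apply: le_trans h.
  rewrite [leRHS]mulrCA [leLHS]mulrC ler_wpM2l// mulrC ler_wpM2l//.
  by rewrite lerDl.
- move=> n; have := @integral_prod_le _ _ _ P (fun i => F (u n i)) (fun i => sF (uT n i))
    (fun i => @Fm _ (uT n i)) (@FS n) (f n) (fun i => expR (l ^+ 2 * L * (u n i.+1 - u n i)))
    (sf n) (f0 n).
  move=> /(_ (fun i => expR_ge0 _)) H.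
  apply: le_trans (H _ n.+1 A _) _.
  + by move=> i B FB; apply: integral_quad_le => //; [have /andP[] := uT n i|have /andP[] := uT n i.+1].
  + by rewrite /= u0.
  rewrite -expR_sum -mulr_sumr.
  rewrite -(big_mkord xpredT (fun i => u n i.+1 - u n i)).
  by rewrite (telescope_sumr (fun i => u n i))// u0 un.
- exact: cvg_cst.
Qed.

End exponential_moment.

(** * Continuous local martingales with Lipschitz bracket *)

Lemma within_continuousP (R : realType) (a b : R) (f : R -> R) :
  (forall t, a <= t <= b -> forall e : R, 0 < e ->
    exists2 d : R, 0 < d & forall u, a <= u <= b -> `|t - u| < d -> `|f t - f u| < e) ->
  {within `[a, b], continuous f}.
Proof.
move=> H; apply/subspace_continuousP => t; rewrite /= in_itv /= => tab.
apply/cvgrPdist_lt => e e0; have [d d0 Hd] := H t tab e e0.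
rewrite near_withinE; exists d => // u /= tu; rewrite in_itv/= => uab; exact: Hd.
Qed.

Lemma within_continuous_stop (R : realType) (T r : R) (f : R -> R) : 0 <= r ->
  {within `[0, T], continuous f} -> {within `[0, T], continuous (fun t => f (Num.min t r))}.
Proof.
move=> r0 cf; have mT t : 0 <= t <= T -> 0 <= Num.min t r <= T.
  by move=> /andP[t0 tT]; rewrite le_min t0 r0 ge_min tT.
apply: within_continuousP => t tT e e0.
have [d d0 H] := within_continuous_eps cf (mT t tT) e0.
exists d => // u uT tu; apply: H; first exact: mT.
apply: le_lt_trans tu; rewrite ler_norml.
have := ler_norm (t - u); have := ler_norm (u - t); rewrite (distrC u) => h1 h2.
by case: (leP t r) => tr; case: (leP u r) => ur; apply/andP; split; lra.
Qed.

Section local_martingale.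
Context d (W : measurableType d) (R : realType) (P : probability W R) (T : R)
  (F : R -> set (set W)).
Hypothesis sF : forall t : R, 0 <= t <= T -> sigma_algebra setT (F t).
Hypothesis Fm : forall t : R, 0 <= t <= T -> F t `<=` measurable.
Hypothesis Fle : forall s t : R, 0 <= s -> s <= t -> t <= T -> F s `<=` F t.
Variables (L : R) (M V : R -> W -> R).
Hypothesis L0 : 0 <= L.
Hypothesis lM : cont_local_martingale T P F M.
Hypothesis lN : cont_local_martingale T P F (fun t w => M t w ^+ 2 - V t w).
Hypothesis V0 : forall w, V 0 w = 0.
Hypothesis VL : {ae P, forall w, forall s t : R, 0 <= s -> s <= t -> t <= T ->
  V t w - V s w <= L * (t - s)}.

(** Stopping at the minimum of the localizing sequences of [M] and of
    [M^2 - V] produces true martingales that eventually agree with [M], with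
    moment bounds that do not depend on the localization. *)
Lemma localized_moments : exists U : nat -> R -> W -> R,
  [/\ forall n, adapted T F (U n),
      {ae P, forall w, \forall n \near \oo, forall t, 0 <= t <= T -> U n t w = M t w},
      forall n (s t : R) A, 0 <= s -> s <= t -> t <= T -> F s A ->
        (\int[P]_(w in A) ((U n t w - U n s w) ^+ 2)%:E <= (L * (t - s))%:E * P A)%E &
      forall n (l s t : R) A, 0 <= s -> s <= t -> t <= T -> F s A ->
        (\int[P]_(w in A) (expR (l * (U n t w - U n s w)))%:E
          <= (expR (l ^+ 2 * L * (t - s)))%:E * P A)%E].
Proof.
have [aM M0 [tau [st tauT mtau]]] := lM.
have [aN N0 [sig [ss sigT msig]]] := lN.
pose r n w := Num.min (tau n w) (sig n w).
have r0 n w : 0 <= r n w by rewrite le_min (st n).1 (ss n).1.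
pose U n t w := M (Num.min t (r n w)) w.
pose Z n t w := M (Num.min t (r n w)) w ^+ 2 - V (Num.min t (r n w)) w.
have mU n : martingale T P F (U n).
  have := stopped_martingale sF Fm Fle (mtau n) _ (ss n).
  rewrite (_ : (fun t w => _) = U n); last first.
    by apply/funext => t; apply/funext => w; rewrite /U /r minAC minA.
  by apply => w; apply: (within_continuous_stop ((st n).1 w) (M0 w).2).
have mZ n : martingale T P F (Z n).
  have := stopped_martingale sF Fm Fle (msig n) _ (st n).
  rewrite (_ : (fun t w => _) = Z n); last first.
    by apply/funext => t; apply/funext => w; rewrite /Z /r -minA.
  apply => w.
  by apply: (within_continuous_stop ((ss n).1 w) (N0 w).2).
have cU n w : {within `[0, T], continuous (U n ^~ w)}.
  by apply: (within_continuous_stop (r0 n w) (M0 w).2).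
have UZ n (s t : R) : 0 <= s -> s <= t -> t <= T ->
    {ae P, forall w, U n t w ^+ 2 - U n s w ^+ 2 <= Z n t w - Z n s w + L * (t - s)}.
  move=> s0 sle tT; apply: filterS VL => w /(_ (Num.min s (r n w)) (Num.min t (r n w))).
  have h1 : 0 <= Num.min s (r n w) by rewrite le_min s0 r0.
  have h2 : Num.min s (r n w) <= Num.min t (r n w).
    by case: (leP s (r n w)) => ?; case: (leP t (r n w)) => ?; lra.
  have h3 : Num.min t (r n w) <= T by rewrite ge_min tT.
  move=> /(_ h1 h2 h3) h; rewrite /U /Z.
  suff h4 : L * (Num.min t (r n w) - Num.min s (r n w)) <= L * (t - s) by lra.
  rewrite ler_wpM2l//; case: (leP t (r n w)) => ?; case: (leP s (r n w)) => ?; lra.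
have U0 n w : U n 0 w = 0 by rewrite /U (min_idPl (r0 n w)) (M0 w).1.
have Z0 n w : Z n 0 w = 0 by rewrite /Z (min_idPl (r0 n w)) (M0 w).1 V0 expr0n/= subr0.
have en n := energy_increment_le sF Fm L0 (mU n) (mZ n) (U0 n) (Z0 n) (UZ n).
exists U; split => //.
- by move=> n; have [] := mU n.
- apply: filterS2 tauT sigT => w [_ tT] [_ sT]; near=> n => t /andP[t0 tT'].
  rewrite /U (min_idPl _)// le_min !(le_trans tT')//; [near: n; exact: sT|near: n; exact: tT].
- by move=> n l s t A; exact: (integral_exp_increment_le sF Fm Fle L0 (mU n) (cU n) (en n)).
Unshelve. all: by end_near.
Qed.

Lemma local_energy_le (s t : R) A : 0 <= s -> s <= t -> t <= T -> F s A ->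
  (\int[P]_(w in A) ((M t w - M s w) ^+ 2)%:E <= (L * (t - s))%:E * P A)%E.
Proof.
move=> s0 st tT FA; have tT' : 0 <= t <= T by rewrite (le_trans s0).
have sT : 0 <= s <= T by rewrite s0 (le_trans st).
have [U [aU UM en _]] := localized_moments; have [aM _ _] := lM.
apply: (@integral_fatou_le _ _ _ P A _ (fun n w => (U n t w - U n s w) ^+ 2)
  (fun=> (L * (t - s))%:E * P A)%E) => //.
- exact: (Fm sT).
- by apply: measurable_funX; apply: measurable_funB; exact: (adapted_measurable sF Fm aM).
- by move=> n; apply: measurable_funX; apply: measurable_funB; exact: (adapted_measurable sF Fm (aU n)).
- by move=> w; exact: sqr_ge0.
- by move=> n w; exact: sqr_ge0.
- apply: filterS UM => w h _ e e0; apply: filterS h => n h.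
  by rewrite !h// lerDl ltW.
- by move=> n; exact: en.
- exact: cvg_cst.
Qed.

Lemma local_exp_le (l s t : R) A : 0 <= s -> s <= t -> t <= T -> F s A ->
  (\int[P]_(w in A) (expR (l * (M t w - M s w)))%:E
    <= (expR (l ^+ 2 * L * (t - s)))%:E * P A)%E.
Proof.
move=> s0 st tT FA; have tT' : 0 <= t <= T by rewrite (le_trans s0).
have sT : 0 <= s <= T by rewrite s0 (le_trans st).
have [U [aU UM _ ex]] := localized_moments; have [aM _ _] := lM.
have mexp (g : W -> R) : measurable_fun setT g -> measurable_fun setT (fun w => expR (g w)).
  by move=> mg; exact: measurableT_comp.
apply: (@integral_fatou_le _ _ _ P A _ (fun n w => expR (l * (U n t w - U n s w)))
  (fun=> (expR (l ^+ 2 * L * (t - s)))%:E * P A)%E) => //.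
- exact: (Fm sT).
- apply: mexp; apply: measurable_funM => //; apply: measurable_funB; exact: (adapted_measurable sF Fm aM).
- move=> n; apply: mexp; apply: measurable_funM => //; apply: measurable_funB; exact: (adapted_measurable sF Fm (aU n)).
- apply: filterS UM => w h _ e e0; apply: filterS h => n h.
  by rewrite !h// lerDl ltW.
- by move=> n; exact: ex.
- exact: cvg_cst.
Qed.

End local_martingale.

(** * The exponential maximal inequality *)

Section exponential_maximal_inequality.
Context d (W : measurableType d) (R : realType) (P : probability W R) (G : nat -> set (set W)).
Hypothesis sG : forall i, sigma_algebra setT (G i).
Hypothesis Gm : forall i, G i `<=` measurable.
Hypothesis GS : forall i, G i `<=` G i.+1.

(** Induction on the number of steps: the mass that has already crossed the
    level [k] contributes at least [k] times its probability. *)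
Lemma supermartingale_maximal_le (e : nat -> W -> R) (k : R) N : 0 < k ->
  (forall n w, 0 <= e n w) -> (forall n, sub_measurable (G n) (e n)) ->
  (forall n A, G n A -> (\int[P]_(w in A) (e n.+1 w)%:E <= \int[P]_(w in A) (e n w)%:E)%E) ->
  (k%:E * P [set w | exists2 n, (n < N)%N & (k <= e n w)%R] <= \int[P]_w (e 0%N w)%:E)%E.
Proof.
move=> k0 e0 me se.
pose B n := [set w | forall j, (j < n)%N -> e j w < k].
have BS n : B n.+1 = B n `&` [set w | e n w < k].
  apply/seteqP; split => w /= => [Bw|[Bw en] j].
    by split; [move=> j jn; apply: Bw; exact: ltnW|exact: Bw].
  by rewrite ltnS leq_eqVlt => /predU1P[->//|]; exact: Bw.
have me' n : measurable_fun setT (e n) := sub_measurable_measurable (sG n) (@Gm n) (me n).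
have Gk n : G n [set w | e n w < k] by exact: sub_measurable_lt.
have GB n : G n (B n).
  elim: n => [|n IH].
    rewrite (_ : B 0%N = setT); first exact: (sub_algebraT (sG 0)).
    by apply/seteqP; split.
  by rewrite BS; apply: GS; apply: (sub_algebraI (sG n)).
have mB n : measurable (B n) by exact: (Gm (GB n)).
have CB n : [set w | exists2 j, (j < n)%N & (k <= e j w)%R] = ~` B n.
  apply/seteqP; split => w /=.
    by move=> [j jn kj] Bw; have := Bw j jn; rewrite ltNge kj.
  by rewrite /B /= => /existsNP [j /not_implyP[jn /negP]]; rewrite -leNgt => kj; exists j.
suff : (k%:E * P (~` B N) + \int[P]_(w in B N) (e N w)%:E <= \int[P]_w (e 0%N w)%:E)%E.
  rewrite CB; apply: le_trans; rewrite leeDl//; apply: integral_ge0 => w _; by rewrite lee_fin.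
elim: N => [|n IH].
  have -> : B 0%N = setT by apply/seteqP; split.
  by rewrite setCT measure0 mule0 add0e.
apply: le_trans IH.
pose A := B n `&` [set w | k <= e n w].
have AE : A = B n `&` ~` [set w | e n w < k].
  by congr (_ `&` _); apply/seteqP; split => w /=; rewrite leNgt => /negP.
have GA : G n A by rewrite AE; apply: (sub_algebraI (sG n)) => //; exact: (sub_algebraC (sG n)).
have mA : measurable A := Gm GA.
have BU : B n = A `|` B n.+1.
  by rewrite AE BS -setIUr setvU setIT.
have dAB : [disjoint A & B n.+1].
  by rewrite AE BS; apply/disj_setPS => w [[_ /= h] [_]].
have CU : ~` B n.+1 = ~` B n `|` A.
  rewrite BU setCU; apply/seteqP; split => w /=.
    by move=> h; have [Aw|Aw] := pselect (A w); [right|left].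
  case=> [[_]//|Aw]; have := dAB => /disj_setPS/(_ w) h; by move=> Bw; apply: h.
have dCA : [disjoint ~` B n & A].
  by apply/disj_setPS => w [/= h []].
rewrite CU measureU//; last exact/disj_set2P.
2: exact: measurableC.
have -> : (k%:E * (P (~` B n) + P A)%R = k%:E * P (~` B n) + k%:E * P A)%E by rewrite -ge0_muleDr.
rewrite -addeA leeD2l// [in leRHS]BU ge0_integral_setU//.
- apply: leeD.
    rewrite -integral_cst//; apply: ge0_le_integral => //.
    + by move=> w _; rewrite lee_fin ltW.
    + exact: measurable_funTS_EFin.
    + by move=> w [_ /=]; rewrite lee_fin.
  apply: le_trans (se n _ _) _ => //.
  by rewrite BS; apply: (sub_algebraI (sG n)).
- exact: measurable_funTS_EFin.
- by move=> w _; rewrite lee_fin.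
Qed.

Variables (L : R) (D : nat -> W -> R) (dt : nat -> R) (H : nat -> W -> R).
Hypothesis L0 : 0 < L.
Hypothesis mD : forall i, sub_measurable (G i.+1) (D i).
Hypothesis expD : forall i l A, G i A ->
  (\int[P]_(w in A) (expR (l * D i w))%:E <= (expR (l ^+ 2 * L * dt i))%:E * P A)%E.
Hypothesis mH : forall i, sub_measurable (G i) (H i).

Let S n w := \sum_(i < n) H i w * D i w.
Let q n w := \sum_(i < n) H i w ^+ 2 * dt i.

(** The factor [H i] belongs to the past, so it may be frozen at a constant,
    for which the estimate is [expD] with [l] multiplied by that constant. *)
Lemma integral_exp_frozen_le i l A : G i A ->
  (\int[P]_(w in A) (expR (l * (H i w * D i w) - l ^+ 2 * L * (H i w ^+ 2 * dt i)))%:E <= P A)%E.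
Proof.
move=> GA; have mA := Gm GA.
have mD' := sub_measurable_measurable (sG i.+1) (@Gm i.+1) (@mD i).
have mH' := sub_measurable_measurable (sG i) (@Gm i) (@mH i).
have mexp (g : W -> R) : measurable_fun setT g -> measurable_fun setT (fun w => expR (g w)).
  by move=> mg; exact: measurableT_comp.
pose g n w := grid_floor n.+1%:R^-1 (H i w).
have mg n : measurable_fun setT (g n).
  exact: measurableT_comp (measurable_grid_floor _) mH'.
pose h c w := expR (l * (c * D i w) - l ^+ 2 * L * (c ^+ 2 * dt i)).
have mh (c : W -> R) : measurable_fun setT c -> measurable_fun setT (fun w => h (c w) w).
  move=> mc; apply: mexp; apply: measurable_funB; apply: measurable_funM => //.
    exact: measurable_funM.
  by apply: measurable_funM => //; exact: measurable_funX.
apply: (@integral_fatou_le _ _ _ P A _ (fun n w => h (g n w) w) (fun=> P A)) => //.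
- exact: (mh (H i)).
- by move=> n; exact: mh.
- by move=> n w; exact: expR_ge0.
- apply: aeW => w _ e e0.
  have cg : (fun n => g n w) @ \oo --> H i w.
    apply/cvgrPdist_lt => a a0.
    have := near_infty_natSinv_lt (PosNum a0); apply: filterS => n /= na.
    have /andP[h1 h2] := @grid_floor_itv _ n.+1%:R^-1 (H i w) ltac:(by []).
    by rewrite ger0_norm ?subr_ge0// (lt_trans _ na)// ltrBlDl.
  have : (fun n => h (g n w) w) @ \oo --> h (H i w) w.
    apply: continuous_cvg; first exact: continuous_expR.
    apply: cvgB; (apply: cvgM; first exact: cvg_cst); (apply: cvgM; last exact: cvg_cst) => //.
    by rewrite expr2; under eq_fun do rewrite expr2; exact: cvgM.
  move/cvgrPdist_lt => /(_ e e0); apply: filterS => n /ltW/(le_trans (ler_norm _)).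
  by rewrite lerBlDl.
- move=> n; rewrite -[leRHS]mul1e -integral_cst//.
  apply: (@integral_frozen_le _ _ _ P (G i) A (H i) h (fun _ _ => 1)) => //.
  + by move=> c; exact: (mh (fun=> c)).
  + by move=> c w; exact: expR_ge0.
  + move=> c B GB _; have mB := Gm GB.
    rewrite integral_cst// mul1e.
    have hE w : h c w = expR (- (l ^+ 2 * L * (c ^+ 2 * dt i))) * expR (l * c * D i w).
      by rewrite -expRD /h; congr expR; ring.
    under eq_integral do rewrite hE.
    have mlD : measurable_fun setT (fun w => expR (l * c * D i w)).
      by apply: mexp; exact: measurable_funM.
    rewrite (integral_scale P mB mlD (fun w => expR_ge0 _) (expR_ge0 _)).
    apply: le_trans (lee_wpmul2l _ (@expD i (l * c) B GB)) _; first by rewrite lee_fin expR_ge0.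
    rewrite muleA -EFinM -expRD exprMn.
    by rewrite (_ : _ + _ = 0) ?expR0 ?mul1e//; ring.
- exact: cvg_cst.
Qed.

(** [exp (l S n - l^2 L q n)] is a nonnegative supermartingale, and on the event
    in question it reaches the level [exp (l a - l^2 L v)]. *)
Lemma maximal_le (l a v : R) N : 0 <= l ->
  (P [set w | exists2 n, (n < N)%N & (a <= S n w /\ q n w <= v)%R]
    <= (expR (- (l * a) + l ^+ 2 * L * v))%:E)%E.
Proof.
move=> l0.
pose e n w := expR (l * S n w - l ^+ 2 * L * q n w).
have mHS n : sub_measurable (G n.+1) (H n) := sub_measurableS (sG n) (sG n.+1) (@GS n) (@mH n).
have mS n : sub_measurable (G n) (S n).
  refine (@sub_measurable_sum _ _ _ _ sG GS (fun i w => H i w * D i w) _ n) => i.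
  by apply: sub_measurableM; [exact: mHS|exact: mD].
have mq n : sub_measurable (G n) (q n).
  refine (@sub_measurable_sum _ _ _ _ sG GS (fun i w => H i w ^+ 2 * dt i) _ n) => i.
  by apply: sub_measurableM; [apply: sub_measurableX; exact: mHS|exact: sub_measurable_cst].
have me n : sub_measurable (G n) (e n).
  apply: (@sub_measurable_comp _ _ _ _ expR) => //.
  by apply: sub_measurableB; apply: sub_measurableM => //; exact: sub_measurable_cst.
have k0 : 0 < expR (l * a - l ^+ 2 * L * v) by exact: expR_gt0.
have := @supermartingale_maximal_le e _ N k0 (fun n w => expR_ge0 _) me.
have -> : (\int[P]_w (e 0%N w)%:E = 1)%E.
  under eq_integral do rewrite /e /S /q !big_ord0 !mulr0 subr0 expR0.
  by rewrite integral_cst// mul1e; exact: probability_setT.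
move=> h.
have step n A : G n A -> (\int[P]_(w in A) (e n.+1 w)%:E <= \int[P]_(w in A) (e n w)%:E)%E.
  move=> GA; rewrite -[leRHS]integral_indic_mul -[leLHS]integral_indic_mul.
  pose f w := expR (l * (H n w * D n w) - l ^+ 2 * L * (H n w ^+ 2 * dt n)).
  rewrite (eq_integral (fun w => ((\1_A w * e n w) * f w)%:E)); last first.
    move=> w _; rewrite -mulrA /e /f -expRD /S /q !big_ord_recr/=; congr (_ * expR _)%:E; ring.
  rewrite -[leRHS]mul1e; apply: (integral_mul_le (sG n) (@Gm n)) => //.
  - apply: sub_measurableM => //; exact: (sub_measurable_indic (sG n)).
  - by move=> w; rewrite mulr_ge0 ?expR_ge0// indicE.
  - apply: (sub_measurable_measurable (sG n.+1) (@Gm n.+1)).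
    apply: (@sub_measurable_comp _ _ _ _ expR) => //.
    apply: sub_measurableB; apply: sub_measurableM; try exact: sub_measurable_cst.
      exact: sub_measurableM.
    by apply: sub_measurableM; [exact: sub_measurableX|exact: sub_measurable_cst].
  - by move=> w; exact: expR_ge0.
  - by move=> B GB; rewrite mul1e; exact: integral_exp_frozen_le.
have {}h := h step.
rewrite (_ : - (l * a) + _ = - (l * a - l ^+ 2 * L * v)); last by ring.
have mE : measurable [set w | exists2 n, (n < N)%N & expR (l * a - l ^+ 2 * L * v) <= e n w].
  rewrite (_ : mkset _ = \bigcup_(n in [set n | (n < N)%N]) [set w | expR (l * a - l ^+ 2 * L * v) <= e n w]).
    apply: bigcup_measurable => n _; apply: (@Gm n).
    rewrite (_ : mkset _ = ~` [set w | e n w < expR (l * a - l ^+ 2 * L * v)]).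
      by apply: (sub_algebraC (sG n)); exact: sub_measurable_lt.
    by apply/seteqP; split => w /=; rewrite leNgt => /negP.
  by apply/seteqP; split => w [n nN en]; exists n.
apply: (@le_trans _ _ (P [set w | exists2 n, (n < N)%N & expR (l * a - l ^+ 2 * L * v) <= e n w])).
  apply: le_measure; rewrite ?inE//.
    rewrite (_ : mkset _ = \bigcup_(n in [set n | (n < N)%N]) ((~` [set w | S n w < a]) `&` [set w | q n w <= v])).
      apply: bigcup_measurable => n _; apply: (@Gm n); apply: (sub_algebraI (sG n)).
        by apply: (sub_algebraC (sG n)); exact: sub_measurable_lt.
      exact: sub_measurable_le.
    apply/seteqP; split => w [n nN]; first by move=> [h1 h2]; exists n => //; split => //=; apply/negP; rewrite -leNgt.
    by move=> [/= /negP]; rewrite -leNgt => h1 h2; exists n.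
  move=> w [n nN [h1 h2]]; exists n => //; rewrite ler_expR lerB// ler_wpM2l//.
  by rewrite mulr_ge0 ?sqr_ge0// ltW.
have fp := fin_num_measure P _ mE.
rewrite -(fineK fp) lee_fin expRN -[_^-1]mul1r ler_pdivlMr// mulrC -lee_fin EFinM fineK//.
Qed.

End exponential_maximal_inequality.

(** * An upper bound for sums of squared increments *)

(** [x^4] is at most [24 (exp x + exp (- x))]; the choice [l = v^(-1/2)] makes
    the exponential moment equal to the constant [exp 1]. *)
Lemma integral_fourth_le d (W : measurableType d) (R : realType) (P : probability W R)
    (A : set W) (D : W -> R) (v : R) : measurable A -> measurable_fun setT D -> 0 < v ->
  (forall l, (\int[P]_(w in A) (expR (l * D w))%:E <= (expR (l ^+ 2 * v))%:E * P A)%E) ->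
  (\int[P]_(w in A) (D w ^+ 4)%:E <= (48 * expR 1 * v ^+ 2)%:E * P A)%E.
Proof.
move=> mA mD v0 H; pose l := (Num.sqrt v)^-1.
have sv0 : 0 < Num.sqrt v by rewrite sqrtr_gt0.
have l2 : l ^+ 2 * v = 1 by rewrite exprVn sqr_sqrtr ?ltW// mulVf ?gt_eqF.
have mexp c : measurable_fun setT (fun w => expR (c * D w)).
  by apply: measurableT_comp => //; exact: measurable_funM.
have pw w : D w ^+ 4 <= 24 * v ^+ 2 * (expR (l * D w) + expR (- l * D w)).
  have : `|l * D w| ^+ 4 / 24 <= expR (l * D w) + expR (- l * D w).
    apply: (@le_trans _ _ (expR `|l * D w|)).
      have := expR_ge1Dxn 3 (normr_ge0 (l * D w)).
      by rewrite (_ : 4`!%:R = 24)//; apply: le_trans; rewrite lerDr.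
    have := ger0P (l * D w); case: (leP 0 (l * D w)) => h.
      by rewrite (ger0_norm h) lerDl expR_ge0.
    by rewrite (ltr0_norm h) mulNr lerDr expR_ge0.
  rewrite ler_pdivrMr//; move=> h.
  have -> : D w ^+ 4 = v ^+ 2 * `|l * D w| ^+ 4.
    rewrite (_ : `|l * D w| ^+ 4 = (l * D w) ^+ 4); last first.
      by rewrite -[4%N]/(2 * 2)%N !exprM real_normK// num_real.
    have -> : v ^+ 2 * (l * D w) ^+ 4 = (l ^+ 2 * v) ^+ 2 * D w ^+ 4 by ring.
    by rewrite l2 expr1n mul1r.
  apply: le_trans (ler_wpM2l (sqr_ge0 v) h) _.
  by rewrite le_eqVlt; apply/orP; left; apply/eqP; ring.
apply: (@le_trans _ _ (\int[P]_(w in A) (24 * v ^+ 2 * (expR (l * D w) + expR (- l * D w)))%:E)%E).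
  apply: ge0_le_integral => //.
  - by move=> w _; rewrite lee_fin -[4%N]/(2 * 2)%N exprM sqr_ge0.
  - by apply: measurable_funTS_EFin; exact: measurable_funX.
  - apply: measurable_funTS_EFin; apply: measurable_funM => //; exact: measurable_funD.
  - by move=> w _; rewrite lee_fin.
have c0 : 0 <= 24 * v ^+ 2 by rewrite mulr_ge0// sqr_ge0.
have mS : measurable_fun setT (fun w => expR (l * D w) + expR (- l * D w)) by exact: measurable_funD.
have S0 w : 0 <= expR (l * D w) + expR (- l * D w) by rewrite addr_ge0// expR_ge0.
rewrite (integral_scale P mA mS S0 c0).
under eq_integral do rewrite EFinD.
rewrite ge0_integralD//; try (by move=> w _; rewrite lee_fin expR_ge0); try exact: measurable_funTS_EFin.
apply: le_trans (lee_wpmul2l _ (leeD (H l) (H (- l)))) _; first by rewrite lee_fin.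
rewrite sqrrN l2 -ge0_muleDl ?lee_fin ?expR_ge0// muleA -EFinD -EFinM.
by rewrite (_ : 24 * v ^+ 2 * _ = 48 * expR 1 * v ^+ 2)//; ring.
Qed.

(** The linear term has nonpositive mean by the second moment bound, so only the
    quadratic term, of order [th^2 v^2], remains. *)
Lemma integral_quad_centered_le d (W : measurableType d) (R : realType) (P : probability W R)
    (A : set W) (D : W -> R) (v th : R) : measurable A -> measurable_fun setT D -> 0 < v -> 0 <= th ->
  (\int[P]_(w in A) (D w ^+ 2)%:E <= v%:E * P A)%E ->
  (forall l, (\int[P]_(w in A) (expR (l * D w))%:E <= (expR (l ^+ 2 * v))%:E * P A)%E) ->
  (\int[P]_(w in A) (1 + th * (D w ^+ 2 - v) + (th * (D w ^+ 2 - v)) ^+ 2)%:E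
    <= (expR ((1 + 48 * expR 1) * th ^+ 2 * v ^+ 2))%:E * P A)%E.
Proof.
move=> mA mD v0 th0 H2 HE; have H4 := integral_fourth_le mA mD v0 HE.
have mD2 : measurable_fun setT (fun w => D w ^+ 2) by exact: measurable_funX.
have mD4 : measurable_fun setT (fun w => D w ^+ 4) by exact: measurable_funX.
have PA : P A \is a fin_num by exact: fin_num_measure.
have fine_le (f : W -> R) c : measurable_fun setT f -> (forall w, 0 <= f w) ->
  (\int[P]_(w in A) (f w)%:E <= c%:E * P A)%E ->
  P.-integrable A (EFin \o f) /\ \int[P]_(w in A) f w <= c * fine (P A).
  move=> mf f0 fc; have fi : P.-integrable A (EFin \o f).
    apply/integrableP; split; first exact: measurable_funTS_EFin.
    rewrite (eq_integral (fun w => (f w)%:E)); last by move=> w _ /=; rewrite ger0_norm.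
    by apply: le_lt_trans fc _; rewrite -(fineK PA) -EFinM ltry.
  split => //; rewrite -lee_fin EFinM (fineK PA) /Rintegral fineK//.
  exact: integrable_fin_num fi.
have [i2 h2] := fine_le _ _ mD2 (fun w => sqr_ge0 _) H2.
have D40 w : 0 <= D w ^+ 4 by rewrite -[4%N]/(2 * 2)%N exprM sqr_ge0.
have [i4 h4] := fine_le _ _ mD4 D40 H4.
have ic (c : R) : P.-integrable A (EFin \o fun=> c) by exact: finite_measure_integrable_cst.
pose c0 := 1 - th * v + th ^+ 2 * v ^+ 2.
pose g w := c0 + th * D w ^+ 2 + th ^+ 2 * D w ^+ 4.
have ig1 := real_integrableD mA (ic c0) (real_integrableZ mA th i2).
have ig : P.-integrable A (EFin \o g) by exact: (real_integrableD mA ig1 (real_integrableZ mA _ i4)).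
have qg w : 1 + th * (D w ^+ 2 - v) + (th * (D w ^+ 2 - v)) ^+ 2 <= g w.
  rewrite /g /c0 -subr_ge0.
  have -> : 1 - th * v + th ^+ 2 * v ^+ 2 + th * D w ^+ 2 + th ^+ 2 * D w ^+ 4 -
    (1 + th * (D w ^+ 2 - v) + (th * (D w ^+ 2 - v)) ^+ 2) = 2 * th ^+ 2 * (D w ^+ 2 * v) by ring.
  by apply: mulr_ge0; apply: mulr_ge0 => //; rewrite ?sqr_ge0 ?(ltW v0).
have mq : measurable_fun setT (fun w => 1 + th * (D w ^+ 2 - v) + (th * (D w ^+ 2 - v)) ^+ 2).
  apply: measurable_funD; first by apply: measurable_funD => //; apply: measurable_funM => //; exact: measurable_funB.
  by apply: measurable_funX; apply: measurable_funM => //; exact: measurable_funB.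
apply: (@le_trans _ _ (\int[P]_(w in A) (g w)%:E)%E).
  apply: ge0_le_integral => //.
  - by move=> w _; rewrite lee_fin ltW// quad_gt0.
  - exact: measurable_funTS_EFin.
  - exact: measurable_int ig.
  - by move=> w _; rewrite lee_fin.
rewrite -(fineK (integrable_fin_num mA ig)) -(fineK PA) -EFinM lee_fin.
change (\int[P]_(w in A) g w <= expR ((1 + 48 * expR 1) * th ^+ 2 * v ^+ 2) * fine (P A)).
rewrite (RintegralD mA ig1 (real_integrableZ mA _ i4)).
rewrite (RintegralD mA (ic c0) (real_integrableZ mA th i2)) !(RintegralZl _ mA)// Rintegral_cst//.
apply: (@le_trans _ _ ((1 + (1 + 48 * expR 1) * th ^+ 2 * v ^+ 2) * fine (P A))).
  have h2' := ler_wpM2l th0 h2; have h4' := ler_wpM2l (sqr_ge0 th) h4.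
  apply: le_trans (lerD (lerD (lexx _) h2') h4') _.
  by rewrite /c0 le_eqVlt; apply/orP; left; apply/eqP; ring.
by rewrite ler_wpM2r ?fine_ge0// expR_ge1Dx.
Qed.

Section law_of_large_numbers.
Context d (W : measurableType d) (R : realType) (P : probability W R) (T : R)
  (F : R -> set (set W)).
Hypothesis sF : forall t : R, 0 <= t <= T -> sigma_algebra setT (F t).
Hypothesis Fm : forall t : R, 0 <= t <= T -> F t `<=` measurable.
Hypothesis Fle : forall s t : R, 0 <= s -> s <= t -> t <= T -> F s `<=` F t.
Variables (L : R) (M : R -> W -> R).
Hypothesis L0 : 0 < L.
Hypothesis aM : forall t, 0 <= t <= T -> sub_measurable (F t) (M t).
Hypothesis cM : forall w, {within `[0, T], continuous (M ^~ w)}.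
Hypothesis energyM : forall (s t : R) A, 0 <= s -> s <= t -> t <= T -> F s A ->
  (\int[P]_(w in A) ((M t w - M s w) ^+ 2)%:E <= (L * (t - s))%:E * P A)%E.
Hypothesis expM : forall (l s t : R) A, 0 <= s -> s <= t -> t <= T -> F s A ->
  (\int[P]_(w in A) (expR (l * (M t w - M s w)))%:E
    <= (expR (l ^+ 2 * L * (t - s)))%:E * P A)%E.

(** Along a fine grid, [exp (th (V - L (t - s)))] is at most a product of
    quadratic factors in the centered squared increments. The logarithm of its
    mean is of order [th^2 / N n], whereas the exponential is at least
    [exp (th e)] on the event. Letting first [n] and then [th] go to infinity
    shows that the event is null. *)
Lemma square_variation_negligible (s t e : R) (N : nat -> nat) :
  0 <= s -> s < t -> t <= T -> 0 < e -> (forall n, (n < N n)%N) ->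
  P.-negligible [set w | \forall n \near \oo,
    L * (t - s) + e <= \sum_(i < N n) (M (grid s t (N n) i.+1) w - M (grid s t (N n) i) w) ^+ 2].
Proof.
move=> s0 st tT e0 nN; have stl := ltW st.
have N0 n : (0 < N n)%N by exact: leq_ltn_trans (nN n).
have mM u : 0 <= u <= T -> measurable_fun setT (M u).
  by move=> uT; apply: (sub_measurable_measurable (sF uT) (Fm uT)); exact: aM.
pose u n i := grid s t (N n) (minn i (N n)).
have mn i n : (minn i (N n) <= N n)%N by rewrite geq_minr.
have uT n i : 0 <= u n i <= T.
  by have /andP[h1 h2] := grid_itv stl (mn i n); rewrite (le_trans s0)//= (le_trans h2).
have uS n i : u n i <= u n i.+1 by apply: grid_le => //; rewrite leq_min geq_minr andbT; lia.
have ui n i : (i < N n)%N -> u n i.+1 - u n i = (t - s) / (N n)%:R.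
  by move=> iN; rewrite /u (minn_idPl iN) (minn_idPl (ltnW iN)) gridS addrC addKr.
have uE n i : (N n <= i)%N -> u n i.+1 = u n i.
  by move=> Ni; rewrite /u (minn_idPr Ni) (minn_idPr (leqW Ni)).
pose q (x : R) := 1 + x + x ^+ 2.
pose V n w := \sum_(i < N n) (M (u n i.+1) w - M (u n i) w) ^+ 2.
have VE n w : V n w = \sum_(i < N n) (M (grid s t (N n) i.+1) w - M (grid s t (N n) i) w) ^+ 2.
  by apply: eq_bigr => i _; rewrite /u (minn_idPl (ltn_ord i)) (minn_idPl (ltnW (ltn_ord i))).
have FS n i : F (u n i) `<=` F (u n i.+1).
  by apply: Fle => //; [have /andP[] := uT n i|have /andP[] := uT n i.+1].
pose E m := \bigcap_(n in [set n | (m <= n)%N]) [set w | L * (t - s) + e <= V n w].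
have mV n : measurable_fun setT (V n).
  by apply: measurable_sum => i; apply: measurable_funX; apply: measurable_funB; exact: mM.
have mE m : measurable (E m).
  apply: bigcap_measurable; first by exists m => /=.
  move=> n _; rewrite (_ : mkset _ = V n @^-1` `[L * (t - s) + e, +oo[).
    by rewrite -[X in measurable X]setTI; exact: mV.
  by apply/seteqP; split => w /=; rewrite in_itv /= andbT.
have key m th : 0 < th -> ((expR (th * e))%:E * P (E m) <= 1)%E.
  move=> th0; pose f n i w := q (th * ((M (u n i.+1) w - M (u n i) w) ^+ 2 - L * (u n i.+1 - u n i))).
  have sf n i : sub_measurable (F (u n i.+1)) (f n i).
    have su : sub_measurable (F (u n i.+1)) (M (u n i)).
      exact: (sub_measurableS (sF (uT n i)) (sF (uT n i.+1)) (@FS n i) (aM (uT n i))).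
    apply: (@sub_measurable_comp _ _ _ _ (fun x => q (th * (x ^+ 2 - L * (u n i.+1 - u n i))))).
      have mx : measurable_fun setT (fun x : R => th * (x ^+ 2 - L * (u n i.+1 - u n i))).
        by apply: measurable_funM => //; apply: measurable_funB => //; exact: measurable_funX.
      by apply: measurable_funD; [exact: measurable_funD|exact: measurable_funX].
    by apply: sub_measurableB => //; exact: aM.
  pose C : R := 1 + 48 * expR 1.
  pose K n i := expR (C * th ^+ 2 * (L * (u n i.+1 - u n i)) ^+ 2).
  have fK n i A : F (u n i) A -> (\int[P]_(w in A) (f n i w)%:E <= (K n i)%:E * P A)%E.
    move=> FA; have mA : measurable A := Fm (uT n i) FA.
    have [iN|Ni] := ltnP i (N n); last first.
      rewrite /f /K (uE _ _ Ni) !subrr !mulr0 expr0n/= !mulr0 expR0 mul1e.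
      under eq_integral do rewrite !subrr expr0n/= subrr /q mulr0 expr0n/= !addr0.
      by rewrite integral_cst// mul1e.
    have d0 : 0 < L * (u n i.+1 - u n i).
      by rewrite mulr_gt0// ui// divr_gt0 ?subr_gt0// ltr0n.
    have [/andP[u0 _] /andP[_ u1]] := (uT n i, uT n i.+1).
    apply: integral_quad_centered_le => //; [|exact: ltW| |].
    - by apply: measurable_funB; exact: mM.
    - exact: energyM.
    - by move=> l; rewrite mulrA; exact: expM.
  apply: le_trans (_ : \int[P]_w (expR (th * e) * \1_(E m) w)%:E <= 1)%E.
    have mi : measurable_fun setT (\1_(E m) : W -> R) by exact: measurable_indic.
    have i0 w : 0 <= (\1_(E m) w : R) by rewrite indicE.
    by rewrite (integral_scale P measurableT mi i0 (expR_ge0 _)) integral_indic// setIT.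
  apply: (@integral_fatou_le _ _ _ P setT _ (fun n w => \prod_(i < N n) f n i w)
    (fun n => (expR (C * th ^+ 2 * L ^+ 2 * (t - s) ^+ 2 / (N n)%:R))%:E)) => //.
  - by apply: measurable_funM => //; exact: measurable_indic.
  - move=> n; apply: (sub_measurable_measurable (sF (uT n (N n))) (Fm (uT n (N n)))).
    exact: (sub_measurable_prod (fun i => sF (uT n i)) (@FS n)).
  - by move=> n w; apply: prodr_ge0 => i _; exact/ltW/quad_gt0.
  - apply: aeW => w _ a a0; rewrite indicE.
    case: (boolP (w \in E m)) => [/set_mem wE|_]; last first.
      by near=> n; rewrite mulr0 addr_ge0 ?ltW//; apply: prodr_gt0 => i _; exact/quad_gt0.
    rewrite mulr1.
    have b0 : 0 < (8 * th)^-1 by rewrite invr_gt0 mulr_gt0.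
    have c0 : 0 < Num.sqrt (8 * th)^-1 by rewrite sqrtr_gt0.
    have [del del0 H] := uniform_continuity (@cM w) c0.
    pose del' := Num.min del ((8 * th)^-1 / L).
    have del'0 : 0 < del' by rewrite lt_min del0 divr_gt0.
    have ts1 : 0 < t - s + 1 by rewrite ltr_wpDl// subr_ge0.
    near=> n.
    have mn' : (m <= n)%N by near: n; exact: nbhs_infty_ge.
    have nd : n.+1%:R^-1 < del' / (t - s + 1).
      by near: n; exact: (near_infty_natSinv_lt (PosNum (divr_gt0 del'0 ts1))).
    apply: (@le_trans _ _ (\prod_(i < N n) f n i w)); last by rewrite lerDl ltW.
    have step i : (i < N n)%N -> 0 <= u n i.+1 - u n i < del'.
      move=> iN; rewrite ui// divr_ge0 ?subr_ge0//=.
      apply: (@le_lt_trans _ _ ((t - s + 1) * n.+1%:R^-1)); last by rewrite mulrC -ltr_pdivlMr.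
      by rewrite ler_pM ?subr_ge0 ?invr_ge0// ?lerDl// lef_pV2 ?posrE ?ltr0n// ler_nat.
    apply: (@le_trans _ _ (\prod_(i < N n) expR (th * ((M (u n i.+1) w - M (u n i) w) ^+ 2 - L * (u n i.+1 - u n i))))).
      rewrite -expR_sum ler_expR -mulr_sumr ler_wpM2l ?(ltW th0)// sumrB -mulr_sumr.
      rewrite -(big_mkord xpredT (fun i => u n i.+1 - u n i)) (telescope_sumr (fun i => u n i))//.
      have -> : u n (N n) - u n 0%N = t - s by rewrite /u min0n minnn grid0 gridN.
      by have := wE n mn'; rewrite /= /V; lra.
    apply: ler_prod => i _; rewrite expR_ge0/=; apply: expR_le_quad.
    have /andP[st0 st1] := step i (ltn_ord i).
    have : `|M (u n i.+1) w - M (u n i) w| < Num.sqrt (8 * th)^-1.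
      by apply: H => //; rewrite ger0_norm// (lt_le_trans st1)// ge_min lexx.
    move=> h0; have h1 : (M (u n i.+1) w - M (u n i) w) ^+ 2 < (8 * th)^-1.
      rewrite -real_normK ?num_real// -[ltRHS]sqr_sqrtr ?(ltW b0)//.
      by rewrite ltr_pXn2r ?nnegrE ?sqrtr_ge0.
    have h2 : L * (u n i.+1 - u n i) < (8 * th)^-1.
      by rewrite mulrC -ltr_pdivlMr// (lt_le_trans st1)// ge_min lexx orbT.
    have h3 : 0 <= L * (u n i.+1 - u n i) by rewrite mulr_ge0// ltW.
    have h4 := sqr_ge0 (M (u n i.+1) w - M (u n i) w).
    have h5 : `|(M (u n i.+1) w - M (u n i) w) ^+ 2 - L * (u n i.+1 - u n i)| <= (8 * th)^-1.
      by rewrite ler_norml; apply/andP; split; lra.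
    rewrite normrM (gtr0_norm th0); apply: le_trans (ler_wpM2l (ltW th0) h5) _.
    by rewrite invfM mulrCA mulfV ?gt_eqF// mulr1 lef_pV2 ?posrE// ler_nat.
  - move=> n; have := @integral_prod_le _ _ _ P (fun i => F (u n i)) (fun i => sF (uT n i))
      (fun i => @Fm _ (uT n i)) (@FS n) (f n) (K n) (sf n) (fun i w => ltW (quad_gt0 _)).
    move=> /(_ (fun i => expR_ge0 _) (fK n) (N n) setT).
    move=> /(_ (sub_algebraT (sF (uT n 0%N))))/le_trans; apply.
    rewrite [P setT]probability_setT mule1 lee_fin -expR_sum ler_expR -mulr_sumr.
    rewrite (eq_bigr (fun=> L ^+ 2 * ((t - s) / (N n)%:R) ^+ 2)); last first.
      by move=> i _; rewrite ui// exprMn.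
    rewrite sumr_const card_ord -mulr_natr le_eqVlt; apply/orP; left; apply/eqP.
    by field; rewrite pnatr_eq0 -lt0n.
  - apply: cvg_EFin; first by near=> n.
    rewrite -[X in _ --> X](@expR0 R); apply: continuous_cvg; first exact: continuous_expR.
    rewrite -[X in _ --> X](mulr0 (C * th ^+ 2 * L ^+ 2 * (t - s) ^+ 2)).
    apply: cvgM; first exact: cvg_cst.
    apply/cvgrPdist_lt => a a0; have := near_infty_natSinv_lt (PosNum a0); apply: filterS => n /=.
    rewrite sub0r normrN ger0_norm ?invr_ge0//; apply: le_lt_trans.
    by rewrite lef_pV2 ?posrE ?ltr0n// ler_nat.
exists (\bigcup_m E m); split; first exact: bigcup_measurable.
  apply/eqP; rewrite -measure_le0; apply: le_trans (measure_sigma_subadditive _ mE _ (@subset_refl _ _)) _ => //.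
    exact: bigcup_measurable.
  rewrite eseries0// => m _ _.
  have [p pE] : exists p : R, P (E m) = p%:E by exists (fine (P (E m))); rewrite fineK// fin_num_measure.
  have p0 : 0 <= p by rewrite -lee_fin -pE measure_ge0.
  change (P (E m) = 0%E); rewrite pE; congr EFin; apply/eqP; rewrite eq_le p0 andbT leNgt; apply/negP => p1.
  have := key m (p * e)^-1; rewrite invr_gt0 mulr_gt0// => /(_ isT).
  rewrite pE -EFinM lee_fin invfM -mulrA mulVf ?gt_eqF// mulr1.
  apply/negP; rewrite -ltNge -ltr_pdivrMr// div1r.
  by apply: lt_le_trans (expR_ge1Dx _); rewrite ltrDr.
by move=> w [m _ h]; exists m => // n /= mn'; rewrite /= VE; exact: h.
Unshelve. all: by end_near.
Qed.

End law_of_large_numbers.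

(** * Paths and the uniform limit of the quadratic sums *)

Lemma cvg_dist_le (R : realType) (I : Type) (F : set_system I) (f : I -> R) (a l b : R) :
  ProperFilter F -> f @ F --> l -> (\forall i \near F, `|a - f i| <= b) -> `|a - l| <= b.
Proof.
move=> PF fl fb; apply/ler_addgt0Pr => e e0.
have /cvgrPdist_le/(_ e e0) fe := fl.
have [i [h1 h2]] := filter_ex (filterI fb fe).
by apply: le_trans (ler_distD (f i) _ _) _; rewrite lerD// distrC.
Qed.

Section paths.
Context (R : realType) (T : {posnum R}).
Implicit Types (x y : cpath T) (w : Omega T).

Lemma cpath_subE x y t : (x - y) t = x t - y t.
Proof. by []. Qed.

Lemma cpath_le_norm x t : `|x t| <= `|x|.
Proof. exact: le_cpath_norm. Qed.

Lemma cpath_le_dist x y t : `|x t - y t| <= `|x - y|.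
Proof. exact: (cpath_le_norm (x - y)). Qed.

Lemma cpath_norm_leP x (b : R) : (forall t, 0 <= t <= T%:num -> `|x t| <= b) -> `|x| <= b.
Proof. by move=> H; apply: cpath_norm_le => t; rewrite in_itv; exact: H. Qed.

Lemma Omega0 w : w 0 = 0.
Proof. exact/eqP/(OmegaP w). Qed.

Lemma geometric_limit (u : nat -> cpath T) (c r : R) : 0 < r < 1 ->
  (forall n, (1 <= n)%N -> `|u n.+1 - u n| <= c * r ^+ n) ->
  exists q : cpath T, forall n, (1 <= n)%N -> `|u n - q| <= c * r ^+ n / (1 - r).
Proof.
move=> /andP[r0 r1] H; have r10 : 0 < 1 - r by rewrite subr_gt0.
have c0 : 0 <= c.
  by have := le_trans (normr_ge0 _) (H 1%N isT); rewrite expr1 pmulr_lge0.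
have step t n m : (1 <= n)%N -> (n <= m)%N -> `|u m t - u n t| <= c * r ^+ n / (1 - r).
  move=> n1 nm; suff : `|u m t - u n t| <= c * (r ^+ n - r ^+ m) / (1 - r).
    move/le_trans; apply; rewrite ler_wpM2r ?invr_ge0 ?(ltW r10)// ler_wpM2l//.
    by rewrite gerBl exprn_ge0// ltW.
  rewrite -(subnKC nm); elim: (m - n)%N => [|k IH].
    by rewrite addn0 !subrr normr0 mulr0 mul0r.
  rewrite addnS; apply: le_trans (ler_distD (u (n + k)%N t) _ _) _.
  apply: le_trans (lerD (le_trans (cpath_le_dist _ _ t) (H _ _)) IH) _; first by rewrite (leq_trans n1)// leq_addr.
  rewrite le_eqVlt; apply/orP; left; apply/eqP; rewrite exprS; field.
  by rewrite gt_eqF.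
have rn0 (e : R) : 0 < e -> \forall n \near \oo, c * r ^+ n / (1 - r) < e.
  move=> e0; have : (fun n => c * r ^+ n / (1 - r)) @ \oo --> c * 0 / (1 - r).
    apply: cvgM; last exact: cvg_cst.
    apply: cvgM; first exact: cvg_cst.
    by apply: cvg_expr; rewrite ger0_norm// ltW.
  rewrite mulr0 mul0r => /cvgrPdist_lt/(_ e e0); apply: filterS => n.
  by rewrite sub0r normrN; apply: le_lt_trans; exact: ler_norm.
have cv t : cvgn (fun n => u n t).
  apply: cauchy_cvg; apply: cauchy_exP => e e0.
  have [N _ HN] := rn0 e e0; exists (u N.+1 t); exists N.+1 => // m /= Nm.
  rewrite -ball_normE /= distrC; apply: le_lt_trans (step t N.+1 m isT Nm) _.
  by apply: HN => /=.
pose q : R -> R := fun t => limn (fun n => u n t).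
have uq n t : (1 <= n)%N -> `|u n t - q t| <= c * r ^+ n / (1 - r).
  move=> n1; apply: (@cvg_dist_le R nat \oo (fun m => u m t) (u n t) (q t) _ _ (cv t)).
  by exists n => // m /= nm; rewrite distrC; exact: step.
have cq : continuous q.
  move=> t; apply/cvgrPdist_lt => e e0; have e30 : 0 < e / 3 by rewrite divr_gt0.
  have [N _ HN] := rn0 _ e30.
  have /cvgrPdist_lt/(_ _ e30) := @cpath_continuous _ _ (u N.+1) t.
  apply: filterS => s us; have := HN N.+1 (leqnSn N) => qN.
  apply: le_lt_trans (ler_distD (u N.+1 t) _ _) _.
  have h1 : `|q t - u N.+1 t| < e / 3 by rewrite distrC; exact: le_lt_trans (uq _ _ _) qN.
  have h2 : `|u N.+1 t - q s| < 2 * (e / 3).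
    apply: le_lt_trans (ler_distD (u N.+1 s) _ _) _.
    have h3 : `|u N.+1 s - q s| < e / 3 by exact: le_lt_trans (uq _ _ _) qN.
    by apply: lt_le_trans (ltrD us h3) _; lra.
  by apply: lt_le_trans (ltrD h1 h2) _; lra.
have qp : q \in cpath_pred T.
  apply/cpath_predP; split => // t; rewrite /q; congr (lim (_ @ \oo)).
  by apply/funext => n; rewrite cpath_clip.
exists (CPath qp) => n n1; apply: cpath_norm_leP => t _; exact: uq.
Qed.

End paths.

Section path_sets.
Context (R : realType) (T : {posnum R}).
Implicit Types (x y : Omega T).

(** The supremum in [holder_norm] is extended-real valued; all later uses go
    through the pointwise increment bound. *)
Lemma holder_normP (eta H : R) x : (holder_norm eta x <= H%:E)%E <->
  forall s t, 0 <= s -> s < t -> t <= T%:num -> `|x t - x s| <= H * (t - s) `^ eta.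
Proof.
split=> [xH s t s0 st tT|xH].
  have ts0 : 0 < t - s by rewrite subr_gt0.
  have : ((`|x t - x s| / `|t - s| `^ eta)%:E <= H%:E)%E.
    by apply: le_trans xH; apply: ereal_sup_ubound; exists (s, t) => //=; rewrite s0 st.
  by rewrite lee_fin (gtr0_norm ts0) ler_pdivrMr// powR_gt0.
apply: ge_ereal_sup => _ [[s t] /= [/andP[s0 st] tT] <-].
have ts0 : 0 < t - s by rewrite subr_gt0.
by rewrite lee_fin (gtr0_norm ts0) ler_pdivrMr ?powR_gt0//; exact: xH.
Qed.

Lemma powR2_opp_expr (g : R) n : 2 `^ (- (g * n%:R)) = (2 `^ (- g)) ^+ n.
Proof. by rewrite -powR_mulrn ?powR_ge0// -powRrM mulNr. Qed.

Lemma powR2_opp_itv (g : R) : 0 < g -> 0 < 2 `^ (- g) < 1.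
Proof.
move=> g0; rewrite powR_gt0//= powRN invf_lt1 ?powR_gt0//.
have := gt0_ltr_powR g0 (_ : 1 \in Num.nneg) (_ : 2 \in Num.nneg); rewrite powR1; apply; by rewrite ?nnegrE ?ltr1n.
Qed.

Lemma ZgammaP (g c : R) x : (Zgamma g x <= c%:E)%E <->
  forall n, (1 <= n)%N -> `|Q n.+1 x - Q n x| <= c * (2 `^ (- g)) ^+ n.
Proof.
have p0 n : 0 < 2 `^ (g * n%:R) by rewrite powR_gt0.
have E n : (2 `^ (g * n%:R) * `|Q n.+1 x - Q n x| <= c) =
           (`|Q n.+1 x - Q n x| <= c * (2 `^ (- g)) ^+ n).
  by rewrite -powR2_opp_expr powRN ler_pdivlMr// mulrC.
split=> [xc n n1|xc].
  rewrite -E -lee_fin; apply: le_trans xc; apply: ereal_sup_ubound; by exists n.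
by apply: ge_ereal_sup => _ [n /= n1 <-]; rewrite lee_fin E; exact: xc.
Qed.

Lemma Q0 n x : Q n x 0 = 0.
Proof.
rewrite /= /Qfun clip0 mul0r mul0r truncn0 big_ord0 add0r /dyad !mul0r.
by rewrite subrr expr0n.
Qed.

Section quadratic_limit.
Variables (g c : R) (x : Omega T).
Hypotheses (g0 : 0 < g) (xc : (Zgamma g x <= c%:E)%E).
Let r := 2 `^ (- g).

(** The differences are geometrically small, so the limit exists and its
    distance to [Q n] is the tail of a geometric series. *)
Lemma Qhat_limit : Q n x @[n --> \oo] --> Qhat x /\
  forall n, (1 <= n)%N -> `|Q n x - Qhat x| <= c * r ^+ n / (1 - r).
Proof.
have /andP[r0 r1] := powR2_opp_itv g0.
have [q qn] := geometric_limit (powR2_opp_itv g0) ((ZgammaP _ _ _).1 xc).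
suff Qq : Q n x @[n --> \oo] --> q.
  by rewrite (_ : Qhat x = q)//; apply: cvg_lim => //; exact: norm_hausdorff.
apply/cvgrPdist_lt => e e0.
have : (fun n => c * r ^+ n / (1 - r)) @ \oo --> c * 0 / (1 - r).
  apply: cvgM; last exact: cvg_cst.
  apply: cvgM; first exact: cvg_cst.
  by apply: cvg_expr; rewrite ger0_norm// ltW.
rewrite mulr0 mul0r => /cvgrPdist_lt/(_ e e0) H; near=> n.
rewrite distrC; apply: le_lt_trans (qn n _) _; first by near: n; exact: nbhs_infty_ge.
have : `|0 - c * r ^+ n / (1 - r)| < e by near: n; exact: H.
by rewrite sub0r normrN; apply: le_lt_trans; exact: ler_norm.
Unshelve. all: by end_near.
Qed.

Lemma Cdyad_of_Zgamma : Cdyad T x.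
Proof. by apply: cvg_cauchy; apply/cvg_ex; exists (Qhat x); exact: Qhat_limit.1. Qed.

Lemma cvg_Q t : Q n x t @[n --> \oo] --> Qhat x t.
Proof.
apply/cvgrPdist_lt => e e0; have /cvgrPdist_lt/(_ e e0) := Qhat_limit.1.
by apply: filterS => n; apply: le_lt_trans; exact: cpath_le_dist.
Qed.

Lemma Qhat0 : Qhat x 0 = 0.
Proof.
have := @cvg_Q 0; under eq_fun do rewrite Q0.
by move/(cvg_lim (@norm_hausdorff _ _)) => <-; exact: (cvg_lim (@norm_hausdorff _ _) (cvg_cst _)).
Qed.

End quadratic_limit.

Lemma Kset_Gdyad (L eta g A B : R) : 0 < g -> Kset T L eta g A B `<=` Gdyad T.
Proof.
move=> g0 x [[_ xZ] [nd _ _]]; split => //; [exact: Cdyad_of_Zgamma g0 xZ|exact: Qhat0 g0 xZ].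
Qed.

Lemma KsetS (L eta g A B A' B' : R) : 0 <= L -> A <= A' -> B <= B' ->
  Kset T L eta g A B `<=` Kset T L eta g A' B'.
Proof.
move=> L0 AA BB x [[h z] l]; split => //; split.
  apply: le_trans h _; rewrite lee_fin ler_wpM2r ?powR_ge0// ler_wpM2r// sqrtr_ge0//.
by apply: le_trans z _; rewrite lee_fin ler_wpM2r// ler_wpM2r.
Qed.

End path_sets.

(** * Hölder continuity of the limit *)

(** The first term of the bound decreases in [n] and the second one increases;
    the first level at which [b ^+ n.+1] exceeds [K1 / K2] balances them. When
    [K1 / K2 <= b] no level [n >= 1] does better than the trivial bound [K1]. *)
Lemma two_scale_bound (R : realType) (g p U K1 K2 : R) :
  0 < g -> 0 < p -> 0 < K1 -> 0 < K2 -> U <= K1 ->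
  (forall n, (1 <= n)%N -> U <= K1 * (2 `^ (- g)) ^+ n + K2 * (2 `^ p) ^+ n) ->
  U <= (2 `^ g + 1) * (K1 `^ (1 - g / (p + g)) * K2 `^ (g / (p + g))).
Proof.
move=> g0 p0 K10 K20 UK1 UK.
have b0 : 0 < p + g by rewrite addr_gt0.
set al := g / (p + g); pose b := 2 `^ (p + g).
have al0 : 0 < al by rewrite divr_gt0.
have al1 : 1 - al = p / (p + g) by rewrite /al; field; rewrite gt_eqF.
have al10 : 0 < 1 - al by rewrite al1 divr_gt0.
have q0 : 0 < K1 / K2 by rewrite divr_gt0.
have KE : K1 `^ (1 - al) * K2 `^ al = K1 * (K1 / K2) `^ (- al).
  rewrite powRM ?invr_ge0 ?(ltW K10) ?(ltW K20)//.
  rewrite -(powR_inv1 (ltW K20)) -powRrM mulrNN mul1r.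
  by rewrite (@powRD _ K1 1 (- al)) ?gt_eqF ?implybT// powRr1 ?(ltW K10)// mulrA.
rewrite KE.
have ba : b `^ al = 2 `^ g by rewrite /b -powRrM /al mulrCA divff ?mulr1 ?gt_eqF.
have b1 : 1 < b.
  have := gt0_ltr_powR b0 (_ : 1 \in Num.nneg) (_ : 2 \in Num.nneg); rewrite powR1.
  by apply; rewrite ?nnegrE ?ltr1n.
have pos : 0 < (K1 / K2) `^ (- al) by rewrite powR_gt0.
have [small|large] := leP (K1 / K2) b.
  apply: (le_trans UK1); rewrite mulrCA -[leLHS]mulr1 ler_wpM2l ?(ltW K10)//.
  rewrite powRN ler_pdivlMr ?powR_gt0// mul1r.
  apply: (@le_trans _ _ (2 `^ g)); last by rewrite lerDl.
  by rewrite -ba ge0_ler_powR ?nnegrE ?(ltW al0) ?(ltW q0) ?(ltW (lt_trans ltr01 b1)).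
have ex : exists m, K1 / K2 < b ^+ m.+1.
  have cb : (fun n => b^-1 ^+ n) @ \oo --> (0 : R).
    by apply: cvg_expr; rewrite ger0_norm ?invr_ge0 ?(ltW (lt_trans ltr01 b1))// invf_lt1// (lt_trans _ b1).
  have iq0 : 0 < (K1 / K2)^-1 by rewrite invr_gt0.
  have /cvgrPdist_lt/(_ _ iq0) [m _ /(_ m.+1 (leqnSn m))] := cb.
  rewrite /= sub0r normrN ger0_norm ?exprn_ge0 ?invr_ge0 ?(ltW (lt_trans ltr01 b1))//.
  by rewrite exprVn ltf_pV2 ?posrE ?exprn_gt0 ?(lt_trans _ b1)// => h; exists m.
case: (ex_minnP ex) => n hn mn.
have n1 : (1 <= n)%N.
  by case: n hn {mn} => // h; move: (lt_trans large h); rewrite expr1 ltxx.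
have ln : b ^+ n <= K1 / K2.
  rewrite leNgt; apply/negP; case: n n1 hn mn => // n _ _ mn h.
  by have := mn n h; rewrite ltnn.
apply: (le_trans (UK n n1)); rewrite mulrDl mul1r lerD//.
  rewrite mulrCA ler_wpM2l ?(ltW K10)//.
  have -> : (2 `^ (- g)) ^+ n = (b ^+ n) `^ (- al).
    by rewrite -[b ^+ n]powR_mulrn ?powR_ge0// powRAC [b `^ _]powRN ba -powRN powR_mulrn ?powR_ge0.
  rewrite -ba !powRN ler_pdivlMr ?powR_gt0// mulrC ler_pdivrMr ?powR_gt0 ?exprn_gt0 ?(lt_trans _ b1)//.
  rewrite -powRM ?exprn_ge0 ?(ltW (lt_trans ltr01 b1))// -exprS.
  by rewrite ge0_ler_powR ?nnegrE ?(ltW al0) ?(ltW q0) ?exprn_ge0 ?(ltW (lt_trans ltr01 b1)) ?(ltW hn).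
have -> : (2 `^ p) ^+ n = (b ^+ n) `^ (1 - al).
  rewrite -[b ^+ n]powR_mulrn ?powR_ge0// powRAC /b -(powRrM 2) al1 mulrCA divff ?gt_eqF// mulr1.
  by rewrite powR_mulrn ?powR_ge0.
have -> : K1 * (K1 / K2) `^ (- al) = K2 * (K1 / K2) `^ (1 - al).
  rewrite (@powRD _ (K1 / K2) 1 (- al)) ?gt_eqF ?implybT// powRr1 ?(ltW q0)//.
  by rewrite mulrA mulrCA divff ?gt_eqF// mulr1.
rewrite ler_wpM2l ?(ltW K20)// ge0_ler_powR ?nnegrE ?(ltW al10) ?(ltW q0) ?exprn_ge0 ?(ltW (lt_trans ltr01 b1))//.
Qed.

Section quadratic_holder.
Context (R : realType) (T : {posnum R}).
Implicit Types (x y : Omega T).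

Lemma holder_dist (eta H : R) x : 0 <= H -> (holder_norm eta x <= H%:E)%E ->
  forall s t d, 0 < d -> 0 <= eta -> 0 <= s <= T%:num -> 0 <= t <= T%:num -> `|t - s| <= d ->
  `|x t - x s| <= H * d `^ eta.
Proof.
move=> H0 /holder_normP xH.
have key s t d : 0 < d -> 0 <= eta -> 0 <= s -> s < t -> t <= T%:num -> `|t - s| <= d ->
    `|x t - x s| <= H * d `^ eta.
  move=> d0 e0 s0 st tT td; apply: le_trans (xH s t s0 st tT) _.
  rewrite ler_wpM2l// ge0_ler_powR ?nnegrE ?subr_ge0 ?(ltW st) ?(ltW d0)//.
  by rewrite (le_trans (ler_norm _)).
move=> s t d d0 e0 /andP[s0 sT] /andP[t0 tT] td.
case: (ltgtP s t) => st; first exact: key.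
  by rewrite distrC; apply: key => //; rewrite distrC.
by rewrite st subrr normr0 mulr_ge0// powR_ge0.
Qed.

Lemma dyad_min_itv n k (t : R) : 0 <= t <= T%:num -> 0 <= Num.min t (dyad T n k) <= T%:num.
Proof.
move=> /andP[t0 tT]; rewrite le_min t0 ge_min tT/=.
by rewrite andbT /dyad divr_ge0 ?exprn_ge0// mulr_ge0.
Qed.

Lemma dyadS n k : dyad T n k.+1 = dyad T n k + T%:num / 2 ^+ n.
Proof. by rewrite /dyad -natr1 mulrDl mul1r mulrDl. Qed.

Lemma dyad_min_step n k (t : R) :
  0 <= Num.min t (dyad T n k.+1) - Num.min t (dyad T n k) <= T%:num / 2 ^+ n.
Proof.
have d0 : 0 <= T%:num / 2 ^+ n :> R by rewrite divr_ge0 ?exprn_ge0.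
rewrite dyadS; case: (leP t (dyad T n k)) => h1; case: (leP t (dyad T n k + T%:num / 2 ^+ n)) => h2;
  apply/andP; split; lra.
Qed.

(** Stopping every dyadic time at [t] makes the sum run over all dyadic
    intervals, independently of [t]. *)
Lemma QE n x t : 0 <= t <= T%:num -> Q n x t = \sum_(0 <= k < (2 ^ n).+1)
    (x (Num.min t (dyad T n k.+1)) - x (Num.min t (dyad T n k))) ^+ 2.
Proof. by move=> tT; rewrite /= clip_id ?in_itv// QfunE ?in_itv. Qed.

Lemma Omega_dist_le x y t : `|x t - y t| <= `|x - y|.
Proof. exact: (cpath_le_dist (Omega_path x) (Omega_path y)). Qed.

(** A difference of squares is the product of the difference, at most
    [2 |x - y|], and of the sum, at most twice a Hölder increment. *)
Lemma Q_dist_le (eta H : R) n x y : 0 <= eta -> 0 <= H ->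
  (holder_norm eta x <= H%:E)%E -> (holder_norm eta y <= H%:E)%E ->
  `|Q n x - Q n y| <= 8 * `|x - y| * (H * (T%:num / 2 ^+ n) `^ eta) * 2 ^+ n.
Proof.
move=> e0 H0 xH yH; apply: cpath_norm_leP => t tT.
have d0 : 0 < T%:num / 2 ^+ n :> R by rewrite divr_gt0 ?exprn_gt0.
set h := H * _.
have h0 : 0 <= h by rewrite mulr_ge0// powR_ge0.
rewrite cpath_subE !QE// -sumrB; apply: (le_trans (ler_norm_sum _ _ _)).
apply: (@le_trans _ _ (\sum_(0 <= k < (2 ^ n).+1) 4 * `|x - y| * h)).
  apply: ler_sum => k _; rewrite subr_sqr normrM.
  have st (z : Omega T) : (holder_norm eta z <= H%:E)%E ->
      `|z (Num.min t (dyad T n k.+1)) - z (Num.min t (dyad T n k))| <= h.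
    move=> zH; apply: (holder_dist H0 zH) => //; try exact: dyad_min_itv.
    by have /andP[h1 h2] := dyad_min_step n k t; rewrite ger0_norm.
  have -> : 4 * `|x - y| * h = (2 * `|x - y|) * (2 * h) by ring.
  apply: ler_pM => //.
    set t1 := Num.min t (dyad T n k.+1); set t2 := Num.min t (dyad T n k).
    have -> : x t1 - x t2 - (y t1 - y t2) = (x t1 - y t1) - (x t2 - y t2) by ring.
    apply: le_trans (ler_normB _ _) _.
    have -> : 2 * `|x - y| = `|x - y| + `|x - y| by ring.
    by rewrite lerD ?Omega_dist_le.
  apply: le_trans (ler_normD _ _) _.
  by have -> : 2 * h = h + h by [ring]; rewrite lerD ?st.
rewrite sumr_const_nat subn0 -[leLHS]mulr_natr.
have -> : 8 * `|x - y| * h * 2 ^+ n = 4 * `|x - y| * h * (2 * 2 ^+ n) by ring.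
rewrite ler_wpM2l ?mulr_ge0// -natr1 natrX.
have : 1 <= 2 ^+ n :> R by rewrite exprn_ege1// ler1n.
lra.
Qed.

Lemma holder_scale (A L eta : R) n : 0 <= L ->
  A * Num.sqrt L * T%:num `^ (2^-1 - eta) * (T%:num / 2 ^+ n) `^ eta
   = A * Num.sqrt (L * T%:num) * (2 `^ (- eta)) ^+ n.
Proof.
move=> L0; rewrite powRM ?invr_ge0 ?exprn_ge0//.
rewrite -!mulrA; congr (_ * _); rewrite sqrtrM// -!mulrA; congr (_ * _).
rewrite mulrA -powRD ?subrK ?powR12_sqrt//; last by rewrite gt_eqF ?implybT.
congr (_ * _); rewrite -powR2_opp_expr -powR_inv1 ?exprn_ge0// -powRrM -powR_mulrn// -powRrM.
by congr (_ `^ _); ring.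
Qed.

(** [K1] collects the two tails [Q n - Qhat], and [K2] the Lipschitz constant of
    [Q n] on the Hölder ball; the level is optimized by [two_scale_bound]. *)
Lemma Kset_Qhat_dist (L eta g A B : R) x y : 0 < L -> 0 < eta < 2^-1 -> 0 < g -> 1 <= A -> 1 <= B ->
  Kset T L eta g A B x -> Kset T L eta g A B y ->
  `|Qhat x - Qhat y| <= (2 `^ g + 1) * ((2 / (1 - 2 `^ (- g))) `^ (1 - g / (1 - eta + g))
        * 8 `^ (g / (1 - eta + g)))
     * A `^ (g / (1 - eta + g)) * B `^ (1 - g / (1 - eta + g))
     * (L * T%:num) `^ (1 - g / (1 - eta + g) / 2) * `|x - y| `^ (g / (1 - eta + g)).
Proof.
move=> L0 /andP[e0 e1] g0 A1 B1 [[xH xZ] [xnd x0 xL]] [[yH yZ] [ynd y0 yL]].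
set al := g / (1 - eta + g).
have p0 : 0 < 1 - eta by lra.
have al0 : 0 < al by rewrite divr_gt0// addr_gt0.
have al1 : 0 < 1 - al.
  have pg : 0 < 1 - eta + g by lra. by rewrite subr_gt0 /al ltr_pdivrMr; lra.
have [d0|dn0] := eqVneq `|x - y| 0.
  have /eqP := d0; rewrite normr_eq0 subr_eq0 => /eqP ->; rewrite !subrr !normr0.
  by rewrite powR0 ?mulr0// gt_eqF.
have d0 : 0 < `|x - y| by rewrite lt_neqAle eq_sym dn0/=.
set d := `|x - y| in d0 *.
have LT0 : 0 < L * T%:num by rewrite mulr_gt0.
set S := Num.sqrt (L * T%:num); have S0 : 0 < S by rewrite sqrtr_gt0.
have S2 : S ^+ 2 = L * T%:num by rewrite sqr_sqrtr// ltW.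
have /andP[r0 r1] := powR2_opp_itv g0; set r := 2 `^ (- g) in r0 r1 *.
have r10 : 0 < 1 - r by rewrite subr_gt0.
pose K1 := 2 / (1 - r) * (B * S ^+ 2); pose K2 := 8 * (A * d * S).
have A0 : 0 < A by lra. have B0 : 0 < B by lra.
have K10 : 0 < K1 by rewrite !mulr_gt0 ?invr_gt0 ?exprn_gt0.
have K20 : 0 < K2 by rewrite !mulr_gt0.
have r2 : 1 <= 2 / (1 - r) by rewrite ler_pdivlMr//; lra.
have UK1 : `|Qhat x - Qhat y| <= K1.
  apply: (@le_trans _ _ (L * T%:num)); last first.
    rewrite /K1 S2 -[leLHS]mul1r; apply: ler_pM => //; first exact: ltW.
    by rewrite ler_peMl// ltW.
  apply: cpath_norm_leP => t tT.
  have tI : t \in `[0, T%:num] by rewrite in_itv.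
  have oI : 0 \in `[0, T%:num] by rewrite in_itv/= lexx ge0.
  have /andP[t0 tT'] := tT.
  have bnd (z : Omega T) : Qhat z 0 = 0 -> {in `[0, T%:num] &, nondecreasing (Qhat z)} ->
    {in `[0, T%:num] &, forall s t, `|Qhat z t - Qhat z s| <= L * `|t - s|} -> 0 <= Qhat z t <= L * T%:num.
    move=> z0 znd zL; rewrite -{1}z0 znd//=.
    have := zL 0 t oI tI; rewrite z0 !subr0 (ger0_norm t0) => h.
    by apply: le_trans (ler_norm _) (le_trans h _); rewrite ler_wpM2l// ltW.
  have /andP[h1 h2] := bnd x x0 xnd xL; have /andP[h3 h4] := bnd y y0 ynd yL.
  by rewrite cpath_subE ler_norml; have := lerB h1 h4; have := lerB h2 h3; rewrite sub0r subr0 => -> ->.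
have UK n : (1 <= n)%N -> `|Qhat x - Qhat y| <= K1 * r ^+ n + K2 * (2 `^ (1 - eta)) ^+ n.
  move=> n1; have hx := (Qhat_limit g0 xZ).2 n n1; have hy := (Qhat_limit g0 yZ).2 n n1.
  have H0 : 0 <= A * Num.sqrt L * T%:num `^ (2^-1 - eta).
    by rewrite !mulr_ge0 ?powR_ge0 ?sqrtr_ge0// ltW.
  have := Q_dist_le n (ltW e0) H0 xH yH; rewrite holder_scale ?(ltW L0)// -/S -/d => hxy.
  apply: le_trans (ler_distD (Q n x) _ _) _.
  apply: le_trans (lerD _ (ler_distD (Q n y) _ _)) _; first by rewrite distrC; exact: hx.
  apply: le_trans (lerD (lexx _) (lerD hxy hy)) _.
  have -> : (2 `^ (1 - eta)) ^+ n = (2 `^ (- eta)) ^+ n * 2 ^+ n.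
    by rewrite (@powRD _ 2 1 (- eta)) ?gt_eqF ?implybT// powRr1// exprMn mulrC.
  rewrite le_eqVlt /K1 /K2 S2; apply/orP; left; apply/eqP; rewrite -/r; field.
  by rewrite gt_eqF.
apply: (le_trans (two_scale_bound g0 p0 K10 K20 UK1 UK)); rewrite -/al.
have -> : K1 `^ (1 - al) = (2 / (1 - r)) `^ (1 - al) * (B `^ (1 - al) * (S ^+ 2) `^ (1 - al)).
  have BS0 : 0 <= B * S ^+ 2 by rewrite mulr_ge0 ?sqr_ge0 ?(ltW B0).
  by rewrite /K1 (@powRM _ (2 / (1 - r)) (B * S ^+ 2)) ?(le_trans ler01 r2)// (@powRM _ B) ?sqr_ge0 ?(ltW B0).
have -> : K2 `^ al = 8 `^ al * (A `^ al * d `^ al * S `^ al).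
  have Ad0 : 0 <= A * d by rewrite mulr_ge0 ?(ltW A0) ?(ltW d0).
  have AdS0 : 0 <= A * d * S by rewrite mulr_ge0 ?(ltW S0).
  by rewrite /K2 (@powRM _ 8 (A * d * S))// (@powRM _ (A * d) S) ?(ltW S0)// (@powRM _ A d) ?(ltW A0) ?(ltW d0).
have -> : (L * T%:num) `^ (1 - al / 2) = (S ^+ 2) `^ (1 - al) * S `^ al.
  rewrite -powR_mulrn ?(ltW S0)// -powRrM -powRD; last by rewrite (gt_eqF S0) implybT.
  rewrite /S -powR12_sqrt ?(ltW LT0)// -powRrM.
  by congr (_ `^ _); field.
by rewrite le_eqVlt; apply/orP; left; apply/eqP; ring.
Qed.

End quadratic_holder.

(** * Stopping and concatenation *)

Section min_max.
Context (R : realType).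
Implicit Types s t d u : R.

Lemma min_step_itv s t u : u <= t -> 0 <= Num.min t s - Num.min u s <= t - u.
Proof.
by move=> ut; case: (leP t s) => ?; case: (leP u s) => ?; apply/andP; split; lra.
Qed.

Lemma min_max_below s t d : d <= s ->
  [/\ Num.min (Num.min t d) s = Num.min t d, Num.max (Num.min t d) s = s,
      Num.min (Num.min t s) d = Num.min t d, Num.min (Num.max t s) d = d & Num.min s d = d].
Proof.
by move=> ds; case: (leP t d) => h1; case: (leP t s) => h2; case: (leP d s) => h3;
  case: (leP t d) => h4; case: (leP t s) => h5; split => //; lra.
Qed.

Lemma min_max_above s t d : s <= d ->
  [/\ Num.min (Num.min t d) s = Num.min t s,
      Num.max (Num.min t d) s = Num.min (Num.max t s) d,
      Num.min (Num.min t s) d = Num.min t s & Num.min s d = s].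
Proof.
by move=> ds; case: (leP t d) => h1; case: (leP t s) => h2; case: (leP d s) => h3;
  case: (leP t d) => h4; case: (leP t s) => h5; split => //; lra.
Qed.

Lemma min_max_early s t d : t <= s ->
  Num.min (Num.min t d) s = Num.min t d /\ Num.max (Num.min t d) s = s.
Proof.
by move=> ds; case: (leP t d) => h1; case: (leP t s) => h2; case: (leP d s) => h3;
  case: (leP t d) => h4; case: (leP t s) => h5; split => //; lra.
Qed.

End min_max.

Section stop_concat.
Context (R : realType) (T : {posnum R}).
Implicit Types (x y : Omega T) (s : R).

Lemma AlipP (L : R) (q : cpath T) : q 0 = 0 ->
  (forall s t, 0 <= s -> s <= t -> t <= T%:num -> 0 <= q t - q s <= L * (t - s)) -> Alip T L q.
Proof.
move=> q0 H; split => // s t; rewrite !in_itv/= => /andP[s0 sT] /andP[t0 tT].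
  by move=> st; have /andP[+ _] := H s t s0 st tT; rewrite subr_ge0.
case: (leP s t) => st.
  by have /andP[h1 h2] := H s t s0 st tT; rewrite (ger0_norm h1) ger0_norm ?subr_ge0.
have /andP[h1 h2] := H t s t0 (ltW st) sT.
by rewrite distrC (ger0_norm h1) distrC ger0_norm ?subr_ge0 ?(ltW st).
Qed.

Lemma Alip_increment (L : R) (q : cpath T) : Alip T L q ->
  forall s t, 0 <= s -> s <= t -> t <= T%:num -> 0 <= q t - q s <= L * (t - s).
Proof.
move=> [qnd _ qL] s t s0 st tT.
have sI : s \in `[0, T%:num] by rewrite in_itv/= s0 (le_trans st).
have tI : t \in `[0, T%:num] by rewrite in_itv/= (le_trans s0).
rewrite subr_ge0 qnd//=; apply: le_trans (ler_norm _) _.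
by rewrite -[t - s]ger0_norm ?subr_ge0// qL.
Qed.

Lemma Q_stop n x s t : 0 <= s <= T%:num -> 0 <= t <= T%:num ->
  Q n (stop s x) t = Q n x (Num.min t s).
Proof.
move=> /andP[s0 sT] /andP[t0 tT].
rewrite !QE ?t0// ?le_min ?t0 ?s0 ?ge_min ?tT//.
apply: eq_bigr => k _.
by rewrite /stop /= (minAC t s (dyad T n k.+1)) (minAC t s (dyad T n k)).
Qed.

Lemma Kset_stop (L eta g A B : R) x s : 0 < L -> 0 < eta -> 0 < g -> 1 <= A ->
  0 <= s <= T%:num -> Kset T L eta g A B x -> Kset T L eta g A B (stop s x).
Proof.
move=> L0 eta0 g0 A1 sT [[xH xZ] xL]; have /andP[s0 sT'] := sT.
have mT t : 0 <= t <= T%:num -> 0 <= Num.min t s <= T%:num.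
  by move=> /andP[t0 tT]; rewrite le_min t0 s0 ge_min tT.
have zZ : (Zgamma g (stop s x) <= (B * L * T%:num)%:E)%E.
  apply/ZgammaP => n n1; apply: le_trans ((ZgammaP _ _ _).1 xZ n n1).
  apply: cpath_norm_leP => t tT; rewrite cpath_subE !Q_stop//; exact: cpath_le_dist.
split; first split => //.
  have H0 : 0 <= A * Num.sqrt L * T%:num `^ (2^-1 - eta).
    by rewrite !mulr_ge0 ?powR_ge0 ?sqrtr_ge0// (le_trans ler01).
  apply/holder_normP => u t u0 ut tT.
  apply: (holder_dist H0 xH); rewrite ?subr_gt0 ?(ltW eta0) ?mT ?u0 ?tT ?(le_trans (ltW ut)) ?(le_trans u0 (ltW ut))//.
  by have /andP[h1 h2] := min_step_itv s (ltW ut); rewrite ger0_norm.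
have QE t : 0 <= t <= T%:num -> Qhat (stop s x) t = Qhat x (Num.min t s).
  move=> tT; have := @cvg_Q _ _ _ _ _ g0 zZ t; under eq_fun do rewrite Q_stop//.
  move/(cvg_lim (@norm_hausdorff _ _)) => <-.
  exact: (cvg_lim (@norm_hausdorff _ _) (@cvg_Q _ _ _ _ _ g0 xZ _)).
apply: AlipP; first exact: Qhat0 g0 zZ.
move=> u t u0 ut tT; rewrite !QE ?u0 ?tT ?(le_trans u0 ut) ?(le_trans ut tT)//.
have h1 : 0 <= Num.min u s by rewrite le_min u0.
have /andP[h2 h4] := min_step_itv s ut; rewrite subr_ge0 in h2.
have h3 : Num.min t s <= T%:num by rewrite ge_min tT.
have /andP[-> /le_trans->//] := Alip_increment xL h1 h2 h3.
by rewrite ler_wpM2l ?(ltW L0).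
Qed.

Lemma concatE x y s t : concat s x y t = x (Num.min t s) + y (Num.max t s) - y s.
Proof. by rewrite /concat /=; case: leP => ts //; rewrite addrK. Qed.

(** An interval of level [n] that lies on one side of [s] contributes the same
    amount to both sides, so one term is left, the one of the interval around
    [s]; there the difference is twice a Hölder increment of [y] times the
    difference of two such increments. *)
Lemma Q_concat (eta H : R) n x y s t : 0 <= H -> 0 <= eta ->
  (holder_norm eta x <= H%:E)%E -> (holder_norm eta y <= H%:E)%E ->
  0 <= s <= T%:num -> 0 <= t <= T%:num ->
  `|Q n (concat s x y) t - (Q n x (Num.min t s) + Q n y (Num.max t s) - Q n y s)|
    <= 4 * (H * (T%:num / 2 ^+ n) `^ eta) ^+ 2.
Proof.
move=> H0 e0 xH yH sT tT; have /andP[s0 sT'] := sT; have /andP[t0 tT'] := tT.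
set h := H * _; have h0 : 0 <= h by rewrite mulr_ge0// powR_ge0.
have d0 : 0 < T%:num / 2 ^+ n :> R by rewrite divr_gt0 ?exprn_gt0.
have C0 : 0 <= 4 * h ^+ 2 by rewrite mulr_ge0// sqr_ge0.
have mT : 0 <= Num.min t s <= T%:num by rewrite le_min t0 s0 ge_min tT'.
have MT : 0 <= Num.max t s <= T%:num by rewrite le_max t0 ge_max tT' sT'.
rewrite !QE// -big_split/= -sumrB -sumrB.
pose D k := (concat s x y (Num.min t (dyad T n k.+1)) - concat s x y (Num.min t (dyad T n k))) ^+ 2 -
  ((x (Num.min (Num.min t s) (dyad T n k.+1)) - x (Num.min (Num.min t s) (dyad T n k))) ^+ 2 +
   (y (Num.min (Num.max t s) (dyad T n k.+1)) - y (Num.min (Num.max t s) (dyad T n k))) ^+ 2 -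
   (y (Num.min s (dyad T n k.+1)) - y (Num.min s (dyad T n k))) ^+ 2).
have dd k : dyad T n k <= dyad T n k.+1 by apply: le_dyad.
have Dlo k : dyad T n k.+1 <= s -> D k = 0.
  move=> ds; have ds' := le_trans (dd k) ds; rewrite /D !concatE.
  have [-> -> -> -> ->] := min_max_below t ds; have [-> -> -> -> ->] := min_max_below t ds'.
  ring.
have Dhi k : s <= dyad T n k -> D k = 0.
  move=> ds'; have ds := le_trans ds' (dd k); rewrite /D !concatE.
  have [-> -> -> ->] := min_max_above t ds; have [-> -> -> ->] := min_max_above t ds'.
  ring.
have Dmid k : dyad T n k <= s -> s <= dyad T n k.+1 -> `|D k| <= 4 * h ^+ 2.
  move=> dlo dhi; have [ts|st] := leP t s.
    suff -> : D k = 0 by rewrite normr0.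
    rewrite /D !concatE (min_idPl ts) (max_idPr ts).
    have [-> ->] := min_max_early (dyad T n k.+1) ts.
    have [-> ->] := min_max_early (dyad T n k) ts; ring.
  rewrite /D !concatE (min_idPr (ltW st)) (max_idPl (ltW st)).
  have td : dyad T n k <= t by apply: le_trans (ltW st).
  rewrite (min_idPr td) (min_idPr dlo) (min_idPl dlo) (max_idPr dlo) (min_idPl dhi).
  set u := Num.min t (dyad T n k.+1).
  have su : s <= u by rewrite le_min (ltW st).
  rewrite (min_idPr su) (max_idPl su).
  have dT : 0 <= dyad T n k <= T%:num by rewrite (le_trans dlo)// andbT /dyad divr_ge0 ?exprn_ge0// mulr_ge0.
  have uT : 0 <= u <= T%:num by rewrite (le_trans s0 su) ge_min tT'.
  have stp := dyadS T n k; have ud : u <= dyad T n k.+1 by rewrite ge_min lexx orbT.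
  have -> : (x s + y u - y s - (x (dyad T n k) + y s - y s)) ^+ 2 -
     ((x s - x (dyad T n k)) ^+ 2 + (y u - y (dyad T n k)) ^+ 2 - (y s - y (dyad T n k)) ^+ 2)
     = 2 * ((y u - y s) * ((x s - x (dyad T n k)) - (y s - y (dyad T n k)))) by ring.
  rewrite normrM (ger0_norm (_ : 0 <= 2))// normrM.
  have -> : 4 * h ^+ 2 = 2 * (h * (h + h)) by ring.
  rewrite ler_wpM2l//; apply: ler_pM => //.
    apply: (holder_dist H0 yH) => //; rewrite ger0_norm ?subr_ge0// lerBlDl (le_trans ud)//.
    by rewrite stp lerD2r.
  apply: le_trans (ler_normB _ _) _; apply: lerD.
    by apply: (holder_dist H0 xH) => //; rewrite ger0_norm ?subr_ge0// lerBlDl -stp.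
  by apply: (holder_dist H0 yH) => //; rewrite ger0_norm ?subr_ge0// lerBlDl -stp.
change (`|\sum_(0 <= k < (2 ^ n).+1) D k| <= 4 * h ^+ 2).
have /= /andP[jlo jhi] := truncn_dyad T n s0.
set j := Num.truncn _ in jlo jhi.
have Dj k : k != j -> D k = 0.
  rewrite neq_ltn => /orP[kj|jk].
    by apply: Dlo; apply: le_trans jlo; exact: le_dyad.
  by apply: Dhi; apply: le_trans (ltW jhi) _; exact: le_dyad.
rewrite big_mkord; have [jn|nj] := ltnP j (2 ^ n).+1.
  rewrite (bigD1 (Ordinal jn))//= big1 ?addr0; first exact: Dmid jlo (ltW jhi).
  by move=> i ij; exact: Dj.
rewrite big1 ?normr0// => i _; apply: Dj; rewrite neq_ltn (leq_trans (ltn_ord i))//.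
Qed.

(** Young's inequality with exponents [eta^-1] and [(1 - eta)^-1]. *)
Lemma powR_le_affine (eta z : R) : 0 < eta < 1 -> 0 <= z ->
  z `^ eta <= eta * z + (1 - eta).
Proof.
move=> /andP[e0 e1] z0; have e10 : 0 < 1 - eta by rewrite subr_gt0.
have := @conjugate_powR R (z `^ eta) 1 eta^-1 (1 - eta)^-1 (powR_ge0 _ _) ler01.
have e11 : eta + (1 - eta) = 1 by ring.
rewrite !invr_gt0 !invrK => /(_ e0 e10 e11).
by rewrite mulr1 powR1 mul1r -powRrM divff ?gt_eqF// powRr1// mulrC.
Qed.

(** Concavity at the midpoint, which is where the factor [2 `^ (1 - eta)] of the
    concatenated path comes from: [a] and [b] are compared with their mean. *)
Lemma powR_subadditive (eta a b : R) : 0 < eta < 1 -> 0 < a -> 0 < b ->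
  a `^ eta + b `^ eta <= 2 `^ (1 - eta) * (a + b) `^ eta.
Proof.
move=> e01 a0 b0; have /andP[e0 e1] := e01; have c0 : 0 < a + b by rewrite addr_gt0.
have key u : 0 < u -> u `^ eta <= 2 `^ (- eta) * (a + b) `^ eta * (eta * (2 * u / (a + b)) + (1 - eta)).
  move=> u0; have -> : u `^ eta = 2 `^ (- eta) * (a + b) `^ eta * (2 * u / (a + b)) `^ eta.
    rewrite -mulrA -powRM ?divr_ge0 ?mulr_ge0 ?(ltW c0) ?(ltW u0)//.
    have -> : (a + b) * (2 * u / (a + b)) = 2 * u by field; rewrite gt_eqF.
    by rewrite powRM ?(ltW u0)// powRN mulKf// gt_eqF// powR_gt0.
  rewrite ler_wpM2l ?mulr_ge0 ?powR_ge0// powR_le_affine// divr_ge0 ?mulr_ge0 ?(ltW c0) ?(ltW u0)//.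
apply: le_trans (lerD (key a a0) (key b b0)) _.
rewrite -mulrDr (_ : eta * _ + _ + _ = 2); last by field; rewrite gt_eqF.
have -> : 2 `^ (1 - eta) = 2 * 2 `^ (- eta) by rewrite (@powRD _ 2 1 (- eta)) ?powRr1// pnatr_eq0 implybT.
by rewrite le_eqVlt; apply/orP; left; apply/eqP; ring.
Qed.

(** In the decay of the differences, [3 B] comes from the three quadratic sums
    and [8 A^2] from the errors of [Q_concat] at two consecutive levels. Those
    errors decay like [2^(- 2 eta n)], faster than [2^(- g n)]. *)
Lemma Kset_concat (L eta g A B : R) x y s : 0 < L -> 0 < eta < 2^-1 -> 0 < g -> g < 2 * eta ->
  1 <= A -> 1 <= B -> 0 <= s <= T%:num -> Kset T L eta g A B x -> Kset T L eta g A B y ->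
  Kset T L eta g (2 `^ (1 - eta) * A) (3 * B + 8 * A ^+ 2) (concat s x y).
Proof.
move=> L0 /andP[eta0 eta1] g0 g1 A1 B1 sT [[xH xZ] xL] [[yH yZ] yL].
have /andP[s0 sT'] := sT.
set H := A * Num.sqrt L * T%:num `^ (2^-1 - eta) in xH yH.
have H0 : 0 <= H by rewrite !mulr_ge0 ?powR_ge0 ?sqrtr_ge0// (le_trans ler01).
have /andP[r0 r1] := powR2_opp_itv g0; set r := 2 `^ (- g) in r0 r1.
have LT0 : 0 < L * T%:num by rewrite mulr_gt0.
pose z := concat s x y; pose S n t := Q n x (Num.min t s) + Q n y (Num.max t s) - Q n y s.
have mT t : 0 <= t <= T%:num -> 0 <= Num.min t s <= T%:num.
  by move=> /andP[t0 tT]; rewrite le_min t0 s0 ge_min tT.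
(* [S n] is the quadratic sum the concatenation would have if [s] were a
     dyadic point of level [n]. *)
have QS n t : 0 <= t <= T%:num -> `|Q n z t - S n t| <= 4 * A ^+ 2 * (L * T%:num) * r ^+ n.
  move=> tT; apply: le_trans (Q_concat n H0 (ltW eta0) xH yH sT tT) _.
  rewrite /H holder_scale ?(ltW L0)//.
  have -> : 4 * (A * Num.sqrt (L * T%:num) * 2 `^ (- eta) ^+ n) ^+ 2 =
      4 * A ^+ 2 * Num.sqrt (L * T%:num) ^+ 2 * (2 `^ (- eta) ^+ n) ^+ 2 by ring.
  have K0 : 0 <= 4 * A ^+ 2 * (L * T%:num).
    exact: mulr_ge0 (mulr_ge0 (ler0n _ 4) (sqr_ge0 _)) (ltW LT0).
  rewrite sqr_sqrtr ?(ltW LT0)//; apply: ler_wpM2l K0 _ _ _.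
  rewrite -exprM mulnC exprM; rewrite lerXn2r ?nnegrE ?sqr_ge0 ?(ltW r0)//.
  by rewrite -powR_mulrn ?powR_ge0// -powRrM /r ler_powR ?ler1n//; lra.
have zZ : (Zgamma g z <= ((3 * B + 8 * A ^+ 2) * L * T%:num)%:E)%E.
  apply/ZgammaP => n n1; apply: cpath_norm_leP => t tT; rewrite cpath_subE -/r.
  have hx := (ZgammaP _ _ _).1 xZ n n1; have hy := (ZgammaP _ _ _).1 yZ n n1.
  have := QS n t tT; have := QS n.+1 t tT => q1 q2.
  have d1 := le_trans (cpath_le_dist _ _ (Num.min t s)) hx.
  have d2 := le_trans (cpath_le_dist _ _ (Num.max t s)) hy.
  have d3 := le_trans (cpath_le_dist _ _ s) hy.
  rewrite -/r in d1 d2 d3; set c := B * L * T%:num in d1 d2 d3.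
  have -> : Q n.+1 z t - Q n z t = (Q n.+1 z t - S n.+1 t) - (Q n z t - S n t) +
     ((Q n.+1 x (Num.min t s) - Q n x (Num.min t s)) + (Q n.+1 y (Num.max t s) - Q n y (Num.max t s))
     - (Q n.+1 y s - Q n y s)) by rewrite /S; ring.
  apply: le_trans (ler_normD _ _) _.
  apply: le_trans (lerD (ler_normB _ _) (ler_normB _ _)) _.
  apply: le_trans (lerD (lerD q1 q2) (lerD (ler_normD _ _) (lexx _))) _.
  apply: le_trans (lerD (lexx _) (lerD (lerD d1 d2) d3)) _.
  have K0 : 0 <= 4 * A ^+ 2 * (L * T%:num) * r ^+ n.
    exact: mulr_ge0 (mulr_ge0 (mulr_ge0 (ler0n _ 4) (sqr_ge0 _)) (ltW LT0)) (exprn_ge0 _ (ltW r0)).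
  have -> : (3 * B + 8 * A ^+ 2) * L * T%:num * r ^+ n =
     4 * A ^+ 2 * (L * T%:num) * r ^+ n + 4 * A ^+ 2 * (L * T%:num) * r ^+ n + (c * r ^+ n + c * r ^+ n + c * r ^+ n).
    by rewrite /c; ring.
  by rewrite lerD2r lerD2r (exprS r n) mulrCA ler_piMl// ltW.
split; first split => //.
  have -> : 2 `^ (1 - eta) * A * Num.sqrt L * T%:num `^ (2^-1 - eta) = 2 `^ (1 - eta) * H by rewrite /H !mulrA.
  have p1 : 1 <= 2 `^ (1 - eta) by rewrite -[leLHS](powRr0 2) ler_powR ?ler1n//; lra.
  have HH : H <= 2 `^ (1 - eta) * H by rewrite ler_peMl.
  apply/holder_normP => u t u0 ut tT.
  have tu0 : 0 < t - u by rewrite subr_gt0.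
  rewrite /= ; case: (leP t s) => ts; case: (leP u s) => us.
  - by apply: le_trans ((holder_normP _ _ _).1 xH u t u0 ut tT) _; rewrite ler_wpM2r ?powR_ge0.
  - by move: (lt_le_trans us (le_trans (ltW ut) ts)); rewrite ltxx.
  - have [->|un] := eqVneq u s.
      have -> : x s + y t - y s - x s = y t - y s by ring.
      have st := ts; apply: le_trans ((holder_normP _ _ _).1 yH s t s0 ts tT) _.
      by rewrite ler_wpM2r ?powR_ge0.
    have us' : u < s by rewrite lt_neqAle un.
    have -> : x s + y t - y s - x u = (x s - x u) + (y t - y s) by ring.
    apply: le_trans (ler_normD _ _) _.
    apply: le_trans (lerD ((holder_normP _ _ _).1 xH u s u0 us' sT') ((holder_normP _ _ _).1 yH s t s0 ts tT)) _.
    rewrite -mulrDr (_ : 2 `^ _ * H * _ = H * (2 `^ (1 - eta) * (t - u) `^ eta)); last by rewrite (mulrC _ H) mulrA.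
    apply: (ler_wpM2l H0).
    have -> : t - u = (s - u) + (t - s) by ring.
    by apply: powR_subadditive; rewrite ?subr_gt0//; apply/andP; split => //; lra.
  - have -> : x s + y t - y s - (x s + y u - y s) = y t - y u by ring.
    by apply: le_trans ((holder_normP _ _ _).1 yH u t u0 ut tT) _; rewrite ler_wpM2r ?powR_ge0.
have QE t : 0 <= t <= T%:num -> Qhat z t = Qhat x (Num.min t s) + Qhat y (Num.max t s) - Qhat y s.
  move=> tT; apply/eqP; rewrite -subr_eq0 -normr_le0.
  have cS : S n t @[n --> \oo] --> Qhat x (Num.min t s) + Qhat y (Num.max t s) - Qhat y s.
    by apply: cvgB; [apply: cvgD|]; [exact: (cvg_Q g0 xZ)|exact: (cvg_Q g0 yZ)|exact: (cvg_Q g0 yZ)].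
  have cD : (Q n z t - S n t) @[n --> \oo] --> Qhat z t - (Qhat x (Num.min t s) + Qhat y (Num.max t s) - Qhat y s).
    by apply: cvgB => //; exact: (cvg_Q g0 zZ).
  have ce : (fun n => 4 * A ^+ 2 * (L * T%:num) * r ^+ n) @ \oo --> 4 * A ^+ 2 * (L * T%:num) * 0.
    by apply: cvgM; [exact: cvg_cst|apply: cvg_expr; rewrite ger0_norm// ltW].
  rewrite mulr0 in ce; apply: ler_cvg_to (cvg_norm cD) ce _.
  by near=> n; exact: QS.
apply: AlipP; first exact: Qhat0 g0 zZ.
move=> u t u0 ut tT; rewrite !QE ?u0 ?tT ?(le_trans u0 ut) ?(le_trans ut tT)//.
have h1 : 0 <= Num.min u s by rewrite le_min u0.
have /andP[h2 h4] := min_step_itv s ut; rewrite subr_ge0 in h2.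
have h3 : Num.min t s <= T%:num by rewrite ge_min tT.
have h5 : 0 <= Num.max u s by rewrite le_max u0.
have h7 : Num.max t s <= T%:num by rewrite ge_max tT.
have h6 : Num.max u s <= Num.max t s by case: (leP t s) => ?; case: (leP u s) => ?; lra.
have /andP[k1 k2] := Alip_increment xL h1 h2 h3.
have /andP[k3 k4] := Alip_increment yL h5 h6 h7.
have mm : (Num.min t s - Num.min u s) + (Num.max t s - Num.max u s) = t - u.
  by case: (leP t s) => ?; case: (leP u s) => ?; ring.
have -> : Qhat x (Num.min t s) + Qhat y (Num.max t s) - Qhat y s - (Qhat x (Num.min u s) + Qhat y (Num.max u s) - Qhat y s)
  = (Qhat x (Num.min t s) - Qhat x (Num.min u s)) + (Qhat y (Num.max t s) - Qhat y (Num.max u s)) by ring.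
by rewrite addr_ge0//= -mm mulrDr lerD.
Unshelve. all: by end_near.
Qed.

End stop_concat.

(** * Compactness *)

Lemma ultra_image_cvg (X : Type) (Y : topologicalType) (F : set_system X) (f : X -> Y) (K : set Y) :
  UltraFilter F -> compact K -> F (f @^-1` K) -> exists p : Y, f @ F --> p.
Proof.
move=> UF cK FK; have PF : ProperFilter F by exact: ultra_proper.
have [p [_ clp]] := cK (f @ F) _ FK.
exists p => U Up; have [//|FC] := in_ultra_setVsetC (f @^-1` U) UF.
by have [y [/= nUy Uy]] := clp _ _ (FC : (f @ F) (~` U)) Up.
Qed.

Section compactness.
Context (R : realType) (T : {posnum R}).
Implicit Types (x y : Omega T).

Lemma clip_dist s t : `|clip T t - clip T s| <= `|t - s|.
Proof.
wlog st : s t / s <= t.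
  by move=> H; case: (leP s t) => [|/ltW] /H//; rewrite distrC (distrC t).
have cc := le_clip T st; rewrite !ger0_norm ?subr_ge0//.
have /andP[h0 h] := min_step_itv T%:num st; apply: le_trans h; move: h0; rewrite /clip => h0.
by case: (leP 0 (Num.min t T%:num)) => ?; case: (leP 0 (Num.min s T%:num)) => ?; lra.
Qed.

Lemma holder_modulus (eta H e : R) : 0 < eta -> 0 <= H -> 0 < e ->
  exists2 d : R, 0 < d & H * d `^ eta < e.
Proof.
move=> eta0 H0 e0; have H1 : 0 < H + 1 by rewrite ltr_wpDl.
have q0 : 0 < e / (H + 1) by rewrite divr_gt0.
exists ((e / (H + 1)) `^ eta^-1); first by rewrite powR_gt0.
rewrite -powRrM mulVf ?gt_eqF// powRr1 ?(ltW q0)// mulrCA gtr_pMr//.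
by rewrite ltr_pdivrMr// mul1r ltrDl.
Qed.

Lemma holder_dist_clip (eta H : R) x : 0 < eta -> 0 <= H -> (holder_norm eta x <= H%:E)%E ->
  forall s t d, 0 < d -> `|t - s| <= d -> `|x t - x s| <= H * d `^ eta.
Proof.
move=> eta0 H0 xH s t d d0 tsd; rewrite -(cpath_clip x t) -(cpath_clip x s).
have := clip_itv T t; have := clip_itv T s; rewrite !in_itv => sI tI.
by apply: (holder_dist H0 xH d0 (ltW eta0) sI tI); exact: le_trans (clip_dist _ _) _.
Qed.

Lemma dyad_itv n k : (k <= 2 ^ n)%N -> 0 <= dyad T n k <= T%:num.
Proof.
move=> kn; rewrite /dyad divr_ge0 ?mulr_ge0 ?exprn_ge0//= ler_pdivrMr ?exprn_gt0// mulrC.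
by rewrite ler_pM2l// -natrX ler_nat.
Qed.

Lemma truncn_dyad_le n (t : R) : 0 <= t <= T%:num -> (Num.truncn (t * 2 ^+ n / T%:num) <= 2 ^ n)%N.
Proof.
move=> /andP[t0 tT]; rewrite -(ler_nat R) natrX.
have h0 : 0 <= t * 2 ^+ n / T%:num by rewrite divr_ge0 ?mulr_ge0 ?exprn_ge0.
have /andP[/le_trans-> //] := truncn_itv h0.
by rewrite ler_pdivrMr// mulrC ler_wpM2l ?exprn_ge0.
Qed.

Lemma dyad_mesh_small (d : R) : 0 < d -> exists n : nat, T%:num / 2 ^+ n <= d.
Proof.
move=> d0; have : (fun n => T%:num * (2^-1) ^+ n) @ \oo --> T%:num * (0 : R).
  apply: cvgM; first exact: cvg_cst.
  by apply: cvg_expr; rewrite ger0_norm ?invr_ge0// invf_lt1// ltr1n.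
rewrite mulr0 => /cvgrPdist_le/(_ d d0)[n _ /(_ n (leqnn n))].
rewrite sub0r normrN ger0_norm ?mulr_ge0 ?exprn_ge0 ?invr_ge0// exprVn => h.
by exists n.
Qed.

(** Pointwise closeness on a finite dyadic grid spreads to all times through the
    common Hölder modulus. *)
Lemma equicontinuous_cvg (eta H : R) (F : set_system (Omega T)) (v : Omega T) :
  ProperFilter F -> 0 < eta -> 0 <= H -> (\forall x \near F, (holder_norm eta x <= H%:E)%E) ->
  (holder_norm eta v <= H%:E)%E ->
  (forall t, 0 <= t <= T%:num -> (fun x : Omega T => x t) @ F --> v t) -> F --> v.
Proof.
move=> PF eta0 H0 FH vH Fv; apply/cvgrPdist_le => e e0.
have e30 : 0 < e / 3 by rewrite divr_gt0.
have [d d0 dH] := holder_modulus eta0 H0 e30.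
have [n nd] := dyad_mesh_small d0.
have grid_close : \forall x \near F, forall k : 'I_(2 ^ n).+1, `|v (dyad T n k) - (x : Omega T) (dyad T n k)| <= e / 3.
  apply: filter_forall => k; have /cvgrPdist_le := Fv _ (@dyad_itv n k (ltn_ord k)); exact.
near=> x; have xH : (holder_norm eta x <= H%:E)%E by near: x.
have xg : forall k : 'I_(2 ^ n).+1, `|v (dyad T n k) - x (dyad T n k)| <= e / 3 by near: x.
apply: (@cpath_norm_leP R T (Omega_path v - Omega_path x)) => t tT; rewrite cpath_subE.
have /andP[t0 _] := tT; have /= := truncn_dyad T n t0; have kn := truncn_dyad_le n tT.
set k := Num.truncn _ in kn *; rewrite dyadS => /andP[h1 h2].
have td : `|t - dyad T n k| <= d by apply: le_trans nd; rewrite ger0_norm; lra.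
have := xg (Ordinal (kn : (k < (2 ^ n).+1)%N)) => /= hk.
have hv := holder_dist_clip eta0 H0 vH d0 td; have hx := holder_dist_clip eta0 H0 xH d0 td.
have -> : v t - x t = (v t - v (dyad T n k)) - (x t - x (dyad T n k)) + (v (dyad T n k) - x (dyad T n k)) by ring.
apply: le_trans (ler_normD _ _) _; apply: le_trans (lerD (ler_normB _ _) hk) _.
by apply: le_trans (lerD (lerD hv hx) (lexx _)) _; lra.
Unshelve. all: by end_near.
Qed.

(** At each time the values stay in a compact interval, so an ultrafilter
    converges there; the limits inherit the Hölder modulus. *)
Lemma pointwise_limit_holder (eta H : R) (F : set_system (Omega T)) :
  UltraFilter F -> 0 < eta -> 0 <= H -> (\forall x \near F, (holder_norm eta x <= H%:E)%E) ->
  exists2 v : Omega T, (holder_norm eta v <= H%:E)%E & F --> v.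
Proof.
move=> UF eta0 H0 FH; have PF : ProperFilter F by exact: ultra_proper.
have T1 : 0 < T%:num + 1 by rewrite ltr_wpDl.
pose b := H * (T%:num + 1) `^ eta.
have cvl t : {l : R | (fun x : Omega T => x t) @ F --> l}.
  apply: cid; apply: (@ultra_image_cvg _ _ F (fun x : Omega T => x t) `[- b, b]) => //.
    exact: segment_compact.
  rewrite -/(\forall x \near F, _); near=> x => /=; rewrite in_itv/= -ler_norml -(cpath_clip x t).
  have := clip_itv T t; rewrite in_itv/= => /andP[c0 cT].
  rewrite -[X in `|X|]subr0 -(Omega0 x).
  have xH : (holder_norm eta x <= H%:E)%E by near: x.
  by apply: (holder_dist_clip eta0 H0 xH) => //; rewrite subr0 ger0_norm//; lra.
pose v t := sval (cvl t); have vP t : (fun x : Omega T => x t) @ F --> v t := svalP (cvl t).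
have vE (t s : R) : (forall x : Omega T, x t = x s) -> v t = v s.
  move=> ts; apply: (@cvg_unique _ (@norm_hausdorff _ _) _ _ _ _ (vP t)).
  rewrite (_ : (fun x : Omega T => x t) = (fun x : Omega T => x s)); first exact: vP.
  by apply/funext => x; exact: ts.
have vd s t d : 0 < d -> `|t - s| <= d -> `|v t - v s| <= H * d `^ eta.
  move=> d0 td; have c : (fun x : Omega T => `|x t - x s|) @ F --> `|v t - v s|.
    by apply: cvg_norm; apply: cvgB; exact: vP.
  apply: ler_cvg_to c (cvg_cst (H * d `^ eta)) _.
  by near=> x; apply: (holder_dist_clip eta0 H0 _ d0 td); near: x.
have vp : v \in cpath_pred T.
  apply/cpath_predP; split => [t|t]; last by apply: vE => x; rewrite cpath_clip.
  apply/cvgrPdist_lt => e e0; have [d d0 dH] := holder_modulus eta0 H0 e0.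
  have /cvgrPdist_le/(_ d d0) : id @ t --> t by [].
  by apply: filterS => s ts; apply: le_lt_trans (vd s t d d0 ts) dH.
have v0 : CPath vp \in Omega_pred T.
  apply/eqP; apply: (@cvg_unique _ (@norm_hausdorff _ _) _ _ _ _ (vP 0)).
  rewrite (_ : (fun x : Omega T => x 0) = cst 0); first exact: cvg_cst.
  by apply/funext => x; exact: Omega0.
have vH : (holder_norm eta (MkOmega v0) <= H%:E)%E.
  apply/holder_normP => s t s0 st tT.
  by apply: vd; rewrite ?subr_gt0// ger0_norm// subr_ge0 ltW.
by exists (MkOmega v0) => //; apply: equicontinuous_cvg eta0 H0 FH vH _ => // t _; exact: vP.
Unshelve. all: by end_near.
Qed.

End compactness.

Section compact_path_sets.
Context (R : realType) (T : {posnum R}).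
Implicit Types (x y v : Omega T).

Lemma holder_Q_dist (eta H : R) n : 0 < eta -> 0 <= H -> exists2 C : R, 0 <= C &
  forall x y, (holder_norm eta x <= H%:E)%E -> (holder_norm eta y <= H%:E)%E ->
  `|Q n x - Q n y| <= C * `|x - y|.
Proof.
move=> eta0 H0; exists (8 * (H * (T%:num / 2 ^+ n) `^ eta) * 2 ^+ n).
  by rewrite !mulr_ge0 ?powR_ge0 ?exprn_ge0.
move=> x y xH yH; apply: le_trans (Q_dist_le n (ltW eta0) H0 xH yH) _.
by rewrite le_eqVlt; apply/orP; left; apply/eqP; ring.
Qed.

Lemma geometric_small (c r e : R) : 0 <= r < 1 -> 0 < e -> exists2 n, (1 <= n)%N & c * r ^+ n < e.
Proof.
move=> /andP[r0 r1] e0; have : (fun n => c * r ^+ n) @ \oo --> c * 0.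
  by apply: cvgM; [exact: cvg_cst|apply: cvg_expr; rewrite ger0_norm].
rewrite mulr0 => /cvgrPdist_lt/(_ e e0)[n _ /(_ n.+1 (leqnSn n))].
rewrite sub0r normrN => h; exists n.+1 => //; apply: le_lt_trans h; exact: ler_norm.
Qed.

Section limits_in_D.
Variables (eta g H c : R) (F : set_system (Omega T)) (v : Omega T).
Hypotheses (PF : ProperFilter F) (eta0 : 0 < eta) (g0 : 0 < g) (H0 : 0 <= H).
Hypotheses (FH : \forall x \near F, (holder_norm eta x <= H%:E)%E).
Hypotheses (FZ : \forall x \near F, (Zgamma g x <= c%:E)%E).
Hypotheses (vH : (holder_norm eta v <= H%:E)%E) (Fv : F --> v).

Lemma Q_cvg n (e : R) : 0 < e -> \forall x \near F, `|Q n v - Q n (x : Omega T)| < e.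
Proof.
move=> e0; have [C C0 HC] := holder_Q_dist n eta0 H0.
have C1 : 0 < C + 1 by rewrite ltr_wpDl.
have ec : 0 < e / (C + 1) by rewrite divr_gt0.
have /cvgrPdist_lt/(_ _ ec) Fe := Fv.
near=> x; apply: le_lt_trans (HC v x vH _) _; first by near: x.
have vx : `|v - x| < e / (C + 1) by near: x; exact: Fe.
move: vx; rewrite ltr_pdivlMr// mulrC; apply: le_lt_trans.
by rewrite ler_wpM2r// lerDl.
Unshelve. all: by end_near.
Qed.

(** [Q n] and [Q n.+1] are continuous on the Hölder ball, so each inequality
    passes to the limit separately. *)
Lemma limit_Zgamma : (Zgamma g v <= c%:E)%E.
Proof.
apply/ZgammaP => n n1; apply/ler_addgt0Pr => e e0; have e20 : 0 < e / 2 by rewrite divr_gt0.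
have h1 := Q_cvg n.+1 e20; have h2 := Q_cvg n e20.
have [x [[k1 k2] k3]] := filter_ex (filterI (filterI h1 h2) FZ).
have k4 := (ZgammaP _ _ _).1 k3 n n1.
apply: le_trans (ler_distD (Q n.+1 x) _ _) _.
apply: le_trans (lerD (ltW k1) (ler_distD (Q n x) _ _)) _.
rewrite distrC in k2; apply: le_trans (lerD (lexx _) (lerD k4 (ltW k2))) _.
lra.
Qed.

(** An interchange of limits: the convergence of [Q n] to [Qhat] is uniform over
    the paths considered. *)
Lemma Qhat_cvg t : (fun x : Omega T => Qhat x t) @ F --> Qhat v t.
Proof.
apply/cvgrPdist_le => e e0; have /andP[r0 r1] := powR2_opp_itv g0.
have e30 : 0 < e / 3 by rewrite divr_gt0.
have r01 : 0 <= 2 `^ (- g) < 1 by rewrite (ltW r0).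
have [n n1 ne] := @geometric_small (c / (1 - 2 `^ (- g))) (2 `^ (- g)) (e / 3) r01 e30.
have {}ne : c * 2 `^ (- g) ^+ n / (1 - 2 `^ (- g)) < e / 3 by rewrite mulrAC.
have h1 := Q_cvg n e30; apply: filterS (filterI h1 FZ) => x [k1 k2].
have k3 := (Qhat_limit g0 k2).2 n n1; have k4 := (Qhat_limit g0 limit_Zgamma).2 n n1.
apply: le_trans (cpath_le_dist _ _ _) _; apply: le_trans (ler_distD (Q n v) _ _) _.
apply: le_trans (lerD _ (ler_distD (Q n x) _ _)) _; first by rewrite distrC; exact: le_trans k4 (ltW ne).
by apply: le_trans (lerD (lexx _) (lerD (ltW k1) (le_trans k3 (ltW ne)))) _; lra.
Qed.

End limits_in_D.

Lemma Kset_compact (L eta g A B : R) : 0 < L -> 0 < eta -> 0 < g -> 1 <= A ->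
  compact (Kset T L eta g A B).
Proof.
move=> L0 eta0 g0 A1; rewrite compact_ultra => F UF FK.
have PF : ProperFilter F by exact: ultra_proper.
set H := A * Num.sqrt L * T%:num `^ (2^-1 - eta).
have H0 : 0 <= H by rewrite !mulr_ge0 ?powR_ge0 ?sqrtr_ge0// (le_trans ler01).
have FH : \forall x \near F, (holder_norm eta x <= H%:E)%E.
  by apply: filterS FK => x [[]].
have FZ : \forall x \near F, (Zgamma g x <= (B * L * T%:num)%:E)%E.
  by apply: filterS FK => x [[]].
have [v vH Fv] := pointwise_limit_holder UF eta0 H0 FH.
have vZ := limit_Zgamma PF eta0 H0 FH FZ vH Fv.
have Fq t := Qhat_cvg PF eta0 g0 H0 FH FZ vH Fv t.
exists v; split => //; split => //.
apply: AlipP; first exact: Qhat0 g0 vZ.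
move=> s t s0 st tT.
have cq : (fun x : Omega T => Qhat x t - Qhat x s) @ F --> Qhat v t - Qhat v s.
  by apply: cvgB; exact: Fq.
have Fx : \forall x \near F, 0 <= Qhat x t - Qhat x s <= L * (t - s).
  by apply: filterS FK => x [_ xL]; exact: Alip_increment.
apply/andP; split.
  by apply: ler_cvg_to (cvg_cst 0) cq _; apply: filterS Fx => x /andP[].
by apply: ler_cvg_to cq (cvg_cst (L * (t - s))) _; apply: filterS Fx => x /andP[].
Qed.

Lemma Kset_Q_dist (L eta g A B : R) n : 0 < g -> (1 <= n)%N ->
  (ereal_sup [set `|Q n x - Qhat x|%:E | x in Kset T L eta g A B]
     <= ((1 - 2 `^ (- g))^-1 * B * L * T%:num * 2 `^ (- (g * n%:R)))%:E)%E.
Proof.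
move=> g0 n1; apply: ge_ereal_sup => _ [x [[_ xZ] _] <-]; rewrite lee_fin.
apply: le_trans ((Qhat_limit g0 xZ).2 n n1) _; rewrite powR2_opp_expr.
by rewrite le_eqVlt; apply/orP; left; apply/eqP; ring.
Qed.

End compact_path_sets.

(** * Dyadic chaining *)

Section chaining.
Context (R : realType) (T : {posnum R}).
Implicit Types (x : cpath T).

Definition dyad_floor n (t : R) : R := dyad T n (Num.truncn (t * 2 ^+ n / T%:num)).

Lemma dyad_double n k : dyad T n.+1 k.*2 = dyad T n k.
Proof.
rewrite /dyad exprS -muln2 natrM invfM mulrA; congr (_ / _).
by field.
Qed.

Lemma dyad_lt n i j : dyad T n i < dyad T n j -> (i < j)%N.
Proof. by move=> ij; rewrite ltnNge; apply: contraTN ij => /(le_dyad T n); rewrite leNgt. Qed.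

Lemma dyad_floor_itv n (t : R) : 0 <= t -> 0 <= t - dyad_floor n t <= T%:num / 2 ^+ n.
Proof.
move=> /(truncn_dyad T n)/=; rewrite -/(dyad_floor n t) dyadS -/(dyad_floor n t) => /andP[h1 h2].
by rewrite subr_ge0 h1 lerBlDl ltW.
Qed.

(** The two floors are equal or adjacent points of level [n.+1]. *)
Lemma dyad_floorS x n (t b : R) : 0 <= t <= T%:num ->
  (forall k, (k < 2 ^ n.+1)%N -> `|x (dyad T n.+1 k.+1) - x (dyad T n.+1 k)| <= b) ->
  `|x (dyad_floor n.+1 t) - x (dyad_floor n t)| <= b.
Proof.
move=> tT H; have /andP[t0 _] := tT; rewrite /dyad_floor.
have b0 : 0 <= b by apply: le_trans (H 0%N _); rewrite ?expn_gt0.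
have := truncn_dyad_le n.+1 tT; have /= /andP[] := truncn_dyad T n.+1 t0; have /= /andP[] := truncn_dyad T n t0.
set j := Num.truncn (t * 2 ^+ n / _); set i := Num.truncn (t * 2 ^+ n.+1 / _).
rewrite -!(dyad_double n) => h1 h2 h3 h4 i2.
have := dyad_lt (le_lt_trans h1 h4); have := dyad_lt (le_lt_trans h3 h2); rewrite doubleS !ltnS => k1 k2.
have [->|/eqP ij] := eqVneq i j.*2; first by rewrite subrr normr0.
have e : i = j.*2.+1 by move: (i) (j) k1 k2 ij; clear; lia.
by rewrite e; apply: H; rewrite -e.
Qed.

Lemma cvg_dyad_floor (t : R) : 0 <= t -> dyad_floor n t @[n --> \oo] --> t.
Proof.
move=> t0; apply/cvgrPdist_le => e e0; have [N TN] := @dyad_mesh_small R T e e0.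
exists N => // n /= Nn; have /andP[h1 h2] := dyad_floor_itv n t0.
rewrite ger0_norm//; apply: le_trans h2 (le_trans _ TN).
by rewrite ler_pM2l// lef_pV2 ?posrE ?exprn_gt0// ler_eXn2l// ltr1n.
Qed.

Lemma dyad_floor_dist x (a r t : R) n : 0 <= a -> 0 < r < 1 -> 0 <= t <= T%:num ->
  (forall m k, (k < 2 ^ m)%N -> `|x (dyad T m k.+1) - x (dyad T m k)| <= a * r ^+ m) ->
  `|x t - x (dyad_floor n t)| <= a * r ^+ n / (1 - r).
Proof.
move=> a0 /andP[r0 r1] tT H; have r10 : 0 < 1 - r by rewrite subr_gt0.
have /andP[t0 _] := tT.
have step m : (n <= m)%N -> `|x (dyad_floor m t) - x (dyad_floor n t)| <= a * (r ^+ n - r ^+ m) / (1 - r).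
  move=> nm; rewrite -(subnKC nm); elim: (m - n)%N => [|k IH].
    by rewrite addn0 !subrr normr0 mulr0 mul0r.
  rewrite addnS; apply: le_trans (ler_distD (x (dyad_floor (n + k)%N t)) _ _) _.
  have h : `|x (dyad_floor (n + k).+1 t) - x (dyad_floor (n + k) t)| <= a * r ^+ (n + k).
    apply: dyad_floorS => // l l2; apply: le_trans (H _ _ l2) _.
    by rewrite ler_wpM2l// ler_wiXn2l// ltW.
  apply: le_trans (lerD h IH) _.
  rewrite le_eqVlt; apply/orP; left; apply/eqP; rewrite exprS; field.
  by rewrite gt_eqF.
have cx : (fun m => x (dyad_floor m t)) @ \oo --> x t.
  exact: (cvg_comp (fun m => dyad_floor m t) x (cvg_dyad_floor t0) (@cpath_continuous _ _ x t)).
rewrite distrC; apply: cvg_dist_le cx _; exists n => // m /= nm.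
rewrite distrC; apply: le_trans (step m nm) _.
rewrite ler_wpM2r ?invr_ge0 ?(ltW r10)// ler_wpM2l//.
by rewrite gerBl exprn_ge0// ltW.
Qed.

Lemma dyadic_scale (d : R) : 0 < d <= T%:num ->
  exists n : nat, T%:num / 2 ^+ n.+1 <= d <= T%:num / 2 ^+ n.
Proof.
move=> /andP[d0 dT].
have ex : exists n, T%:num / 2 ^+ n.+1 <= d.
  have [n nd] := @dyad_mesh_small R T d d0; exists n; apply: le_trans nd.
  by rewrite ler_pM2l// lef_pV2 ?posrE ?exprn_gt0// ler_eXn2l// ltr1n.
have [n nd nm] := ex_minnP ex; exists n; rewrite nd/=.
case: n nd nm => [|n] _ nm; first by rewrite expr0 divr1.
by rewrite leNgt; apply/negP => /ltW/nm; rewrite ltnn.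
Qed.

(** For [t - s] of order [T 2^(- n)] the floors of [s] and [t] at level [n] are
    equal or adjacent; from them [s] and [t] are reached by chains of
    increments of levels finer than [n], which sum to a geometric series. *)
Lemma dyadic_chaining (x : Omega T) (eta a : R) : 0 < eta -> 0 <= a ->
  (forall m k, (k < 2 ^ m)%N -> `|x (dyad T m k.+1) - x (dyad T m k)| <= a * (2 `^ (- eta)) ^+ m) ->
  (holder_norm eta x <= (2 `^ eta * (1 + 2 / (1 - 2 `^ (- eta))) * a / T%:num `^ eta)%:E)%E.
Proof.
move=> eta0 a0 H; apply/holder_normP => s t s0 st tT.
have r01 := powR2_opp_itv eta0; have /andP[r0 r1] := r01; set r := 2 `^ (- eta) in H r0 r1 r01 *.
have r10 : 0 < 1 - r by rewrite subr_gt0.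
have [n /andP[n1 n2]] : exists n : nat, T%:num / 2 ^+ n.+1 <= t - s <= T%:num / 2 ^+ n.
  by apply: dyadic_scale; apply/andP; split; lra.
have sI : 0 <= s <= T%:num by rewrite s0 (le_trans (ltW st)).
have tI : 0 <= t <= T%:num by rewrite (le_trans s0 (ltW st)).
have ds := dyad_floor_dist n a0 r01 sI H; have dt := dyad_floor_dist n a0 r01 tI H.
have dst : `|x (dyad_floor n t) - x (dyad_floor n s)| <= a * r ^+ n.
  have /andP[t0 _] := tI.
  rewrite /dyad_floor; have := truncn_dyad_le n tI.
  have /= /andP[] := truncn_dyad T n t0; have /= /andP[] := truncn_dyad T n s0.
  set i := Num.truncn (s * _ / _); set j := Num.truncn (t * _ / _) => h1 h2 h3 h4 j2.
  have ij : (i < j.+1)%N by apply: dyad_lt; apply: le_lt_trans h1 (lt_trans st h4).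
  have ji : (j < i.+2)%N.
    apply: dyad_lt; apply: le_lt_trans h3 _; rewrite dyadS.
    have : t <= s + T%:num / 2 ^+ n by rewrite -lerBlDl.
    by move=> /le_lt_trans; apply; rewrite ltrD2r.
  have [->|/eqP ne] := eqVneq j i; first by rewrite subrr normr0 mulr_ge0 ?exprn_ge0 ?(ltW r0).
  have e : j = i.+1 by move: (j) (i) ij ji ne; clear; lia.
  by rewrite e; apply: H; rewrite -e.
have -> : x t - x s = (x t - x (dyad_floor n t)) - (x s - x (dyad_floor n s)) + (x (dyad_floor n t) - x (dyad_floor n s)) by ring.
apply: le_trans (ler_normD _ _) _; apply: le_trans (lerD (ler_normB _ _) (lexx _)) _.
apply: le_trans (lerD (lerD dt ds) dst) _.
have rn : r ^+ n <= 2 `^ eta * ((t - s) `^ eta / T%:num `^ eta).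
  have -> : r ^+ n = 2 `^ eta * (2 ^+ n.+1)^-1 `^ eta.
    have -> : (2 ^+ n.+1)^-1 = 2 `^ (- n.+1%:R) :> R by rewrite powRN powR_mulrn.
    rewrite /r -powR2_opp_expr -powRrM -powRD ?pnatr_eq0 ?implybT//.
    by congr (_ `^ _); rewrite -natr1; ring.
  rewrite ler_wpM2l ?powR_ge0//.
  have -> : (t - s) `^ eta / T%:num `^ eta = ((t - s) / T%:num) `^ eta.
    rewrite powRM ?subr_ge0 ?(ltW st) ?invr_ge0//; congr (_ * _).
    by rewrite -(powR_inv1 (ge0 T)) -powRrM mulN1r powRN.
  apply: ge0_ler_powR; rewrite ?nnegrE ?(ltW eta0) ?invr_ge0 ?exprn_ge0 ?divr_ge0 ?subr_ge0 ?(ltW st)//.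
  by rewrite ler_pdivlMr// mulrC.
have -> : a * r ^+ n / (1 - r) + a * r ^+ n / (1 - r) + a * r ^+ n = a * (1 + 2 / (1 - r)) * r ^+ n.
  by ring.
have -> : 2 `^ eta * (1 + 2 / (1 - r)) * a / T%:num `^ eta * (t - s) `^ eta
  = a * (1 + 2 / (1 - r)) * (2 `^ eta * ((t - s) `^ eta / T%:num `^ eta)) by ring.
by rewrite ler_wpM2l// mulr_ge0// addr_ge0// divr_ge0// ltW.
Qed.

End chaining.

(** * Consecutive dyadic levels *)

Section level_differences.
Context (R : realType) (T : {posnum R}).
Implicit Types (x : Omega T).

Lemma truncn_dyad_grid m p i :
  Num.truncn (dyad T (m + p) i * 2 ^+ m / T%:num) = (i %/ 2 ^ p)%N.
Proof.
have T0 : T%:num != 0 :> R by [].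
have -> : dyad T (m + p) i * 2 ^+ m / T%:num = i%:R / 2 ^+ p.
  rewrite /dyad exprD; field; rewrite ?expf_neq0 ?pnatr_eq0 ?gt_eqF//.
apply/eqP; rewrite truncn_eq ?divr_ge0 ?exprn_ge0//.
rewrite ler_pdivlMr ?exprn_gt0// ltr_pdivrMr ?exprn_gt0// -natrX -!natrM ler_nat ltr_nat.
by rewrite leq_trunc_div/= ltn_ceil ?expn_gt0.
Qed.

Lemma dyad_floor_grid m p i : dyad_floor T m (dyad T (m + p) i) = dyad T m (i %/ 2 ^ p).
Proof. by rewrite /dyad_floor truncn_dyad_grid. Qed.

Lemma dyad_scale m p i : dyad T (m + p) (i * 2 ^ p) = dyad T m i.
Proof.
rewrite /dyad natrM natrX exprD; field; rewrite ?expf_neq0 ?pnatr_eq0 ?gt_eqF//.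
Qed.

(** Both end points are allowed: at the right one the last square of the sum and
    the final square exchange their roles. *)
Lemma Q_block n k x t : 0 <= t <= T%:num -> dyad T n k <= t <= dyad T n k.+1 ->
  Q n x t = \sum_(i < k) (x (dyad T n i.+1) - x (dyad T n i)) ^+ 2 + (x t - x (dyad T n k)) ^+ 2.
Proof.
move=> tT /andP[h1 h2]; have /andP[t0 _] := tT.
rewrite /= clip_id ?in_itv//= /Qfun.
have /= /andP[] := truncn_dyad T n t0; set j := Num.truncn _ => h3 h4.
have k1 := dyad_lt (le_lt_trans h1 h4).
move: h2; rewrite le_eqVlt => /predU1P[tE|h2].
  have jk : (j <= k.+1)%N.
    by rewrite -ltnS; apply: (@dyad_lt R T n); apply: le_lt_trans h3 _; rewrite tE [ltRHS]dyadS ltrDl divr_gt0// exprn_gt0.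
  have [->//|/eqP ne] := eqVneq j k.
  have -> : j = k.+1 by move: (j) (k) k1 jk ne; clear; lia.
  by rewrite big_ord_recr/= tE subrr expr0n addr0.
have k2 := dyad_lt (le_lt_trans h3 h2).
by have -> : j = k by move: (j) (k) k1 k2; clear; lia.
Qed.

(** Half the integrand of the martingale transform that represents
    [Q n.+1 x - Q n x]. It vanishes when [t] is in the left half of its interval
    of level [n], and equals minus the increment over the left half otherwise. *)
Definition level_gap n x t : R := x (dyad_floor T n t) - x (dyad_floor T n.+1 t).

Lemma dyad_block m p i : dyad T m (i %/ 2 ^ p) <= dyad T (m + p) i /\
  dyad T (m + p) i.+1 <= dyad T m (i %/ 2 ^ p).+1.
Proof.
rewrite -!(@dyad_scale m p); split; apply: le_dyad; first exact: leq_trunc_div.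
by rewrite ltn_ceil ?expn_gt0.
Qed.

Lemma Q_increment m p i x : (i < 2 ^ (m + p))%N ->
  Q m x (dyad T (m + p) i.+1) - Q m x (dyad T (m + p) i) =
  (x (dyad T (m + p) i.+1) - x (dyad T (m + p) i)) *
  (x (dyad T (m + p) i.+1) + x (dyad T (m + p) i) - 2 * x (dyad_floor T m (dyad T (m + p) i))).
Proof.
move=> iN; have [h1 h2] := dyad_block m p i.
have h3 : dyad T (m + p) i <= dyad T (m + p) i.+1 by exact: le_dyad.
rewrite (@Q_block m (i %/ 2 ^ p)) ?dyad_itv//; last by rewrite h2 (le_trans h1).
rewrite (@Q_block m (i %/ 2 ^ p) x (dyad T (m + p) i)) ?dyad_itv ?(ltnW iN)//; last by rewrite h1 (le_trans h3).
by rewrite dyad_floor_grid; ring.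
Qed.

(** Over one step of the fine grid each [Q m] gains a product whose factor
    depends on [m] only through the floor of level [m] ([Q_increment]). *)
Lemma Q_difference_sum n p i x : (i <= 2 ^ (n.+1 + p))%N ->
  Q n.+1 x (dyad T (n.+1 + p) i) - Q n x (dyad T (n.+1 + p) i) =
  \sum_(j < i) 2 * level_gap n x (dyad T (n.+1 + p) j) *
    (x (dyad T (n.+1 + p) j.+1) - x (dyad T (n.+1 + p) j)).
Proof.
elim: i => [_|i IH iN]; first by rewrite big_ord0 /dyad !mul0r !Q0 subrr.
rewrite big_ord_recr/= -IH ?(ltnW iN)//.
have h1 := @Q_increment n.+1 p i x iN.
have h2 : (i < 2 ^ (n + p.+1))%N by rewrite -addSnnS.
have {h2} := @Q_increment n p.+1 i x h2; rewrite -addSnnS => h2.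
rewrite /level_gap -[LHS](subrK (Q n.+1 x (dyad T (n.+1 + p) i) - Q n x (dyad T (n.+1 + p) i))).
rewrite addrC; congr (_ + _).
have -> : Q n.+1 x (dyad T (n.+1 + p) i.+1) - Q n x (dyad T (n.+1 + p) i.+1)
    - (Q n.+1 x (dyad T (n.+1 + p) i) - Q n x (dyad T (n.+1 + p) i)) =
  (Q n.+1 x (dyad T (n.+1 + p) i.+1) - Q n.+1 x (dyad T (n.+1 + p) i)) -
  (Q n x (dyad T (n.+1 + p) i.+1) - Q n x (dyad T (n.+1 + p) i)) by ring.
by rewrite h1 h2; ring.
Qed.

Lemma sum_divn (f : nat -> R) q K : (0 < q)%N ->
  \sum_(0 <= j < K * q) f (j %/ q)%N = q%:R * \sum_(0 <= k < K) f k.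
Proof.
move=> q0; elim: K => [|K IH]; first by rewrite mul0n !big_nil mulr0.
rewrite mulSn addnC (@big_cat_nat _ _ _ (K * q)%N) ?leq_addr//= IH big_nat_recr//= mulrDr.
congr (_ + _); rewrite -{1}[(K * q)%N]add0n big_addn addnC addnK.
rewrite (eq_big_nat _ _ (F2 := fun=> f K)); last first.
  by move=> j /andP[_ jq]; rewrite addnC divnMDl// divn_small// addn0.
by rewrite big_const_nat subn0 iter_addr_0 mulr_natl.
Qed.

(** The gap is constant on intervals of level [n.+1], each of which contains
    [2 ^ p] grid points, and its square is 0 or the previous squared increment
    of level [n.+1], which is already part of [Q n.+1] at the time considered. *)
Lemma level_gap_sum n p i x : (i < 2 ^ (n.+1 + p))%N ->
  \sum_(j < i.+1) level_gap n x (dyad T (n.+1 + p) j) ^+ 2 <=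
  2 ^+ p * Q n.+1 x (dyad T (n.+1 + p) i).
Proof.
move=> iN.
(* Squared increment over the interval of level [n.+1] that precedes number [J]. *)
pose f J := if J is J'.+1 then (x (dyad T n.+1 J'.+1) - x (dyad T n.+1 J')) ^+ 2 else 0.
have f0 J : 0 <= f J by case: J => //= J; exact: sqr_ge0.
have gf j : level_gap n x (dyad T (n.+1 + p) j) ^+ 2 <= f (j %/ 2 ^ p)%N.
  rewrite /level_gap dyad_floor_grid addSnnS dyad_floor_grid expnSr divnMA.
  set J := (j %/ 2 ^ p)%N; rewrite -dyad_double divn2.
  have /orP[/eqP e|/eqP e] : (J == J./2.*2) || (J == J./2.*2.+1).
    by rewrite -{1 3}(odd_double_half J); case: (odd J); rewrite ?add0n ?add1n eqxx ?orbT.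
  - by rewrite -e subrr expr0n.
  - by rewrite {2 3}e /= -sqrrN opprB.
apply: (@le_trans _ _ (\sum_(0 <= j < (i %/ 2 ^ p).+1 * 2 ^ p) f (j %/ 2 ^ p)%N)).
  apply: (@le_trans _ _ (\sum_(0 <= j < i.+1) f (j %/ 2 ^ p)%N)).
    by rewrite big_mkord; apply: ler_sum => j _; exact: gf.
  rewrite [leRHS](@big_cat_nat _ _ _ i.+1) ?ltn_ceil ?expn_gt0//= lerDl.
  by apply: sumr_ge0 => j _.
rewrite sum_divn ?expn_gt0// -natrX ler_wpM2l//.
have [h1 h2] := dyad_block n.+1 p i.
have h3 : dyad T (n.+1 + p) i <= dyad T (n.+1 + p) i.+1 by exact: le_dyad.
rewrite (@Q_block n.+1 (i %/ 2 ^ p)) ?dyad_itv ?(ltnW iN)//; last by rewrite h1 (le_trans h3).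
by rewrite big_nat_recl//= add0r big_mkord lerDl sqr_ge0.
Qed.

End level_differences.

(** * Tails of dyadic increments and of level differences *)

Section superexponential.
Context (R : realType).

(** With [q ^ k >= 4], the quantity is at most the [k]-th power of
    [u exp (- c u / k)] for [u = q ^ m], and [y exp (- y) <= 1]. *)
Lemma superexp_bound (q c : R) : 1 < q -> 0 < c ->
  exists2 C : R, 0 < C & forall m, 4 ^+ m * expR (- (c * q ^+ m)) <= C.
Proof.
move=> q1 c0; have q0 : 0 < q by rewrite (lt_trans ltr01).
have [k k1 qk] : exists2 k, (1 <= k)%N & 4 <= q ^+ k.
  have [|k k1 hk] := @geometric_small R 1 q^-1 4^-1 _ ltac:(by []).
    by rewrite invr_ge0 (ltW q0)/= invf_lt1.
  exists k => //; move: hk; rewrite mul1r exprVn ltf_pV2 ?posrE ?exprn_gt0//; exact: ltW.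
have k0 : 0 < k%:R :> R by rewrite ltr0n.
have kc : 0 < k%:R / c by rewrite divr_gt0.
exists ((k%:R / c) ^+ k) => [|m]; first by rewrite exprn_gt0.
set u := q ^+ m; have u0 : 0 < u by rewrite exprn_gt0.
have h : u * expR (- (c / k%:R * u)) <= k%:R / c.
  rewrite expRN ler_pdivrMr ?expR_gt0// -ler_pdivrMl//.
  have -> : (k%:R / c)^-1 * u = c / k%:R * u by rewrite invf_div.
  by apply: le_trans (expR_ge1Dx _); rewrite lerDr.
apply: (@le_trans _ _ ((u * expR (- (c / k%:R * u))) ^+ k)).
  rewrite exprMn -expRM_natl; have -> : k%:R * - (c / k%:R * u) = - (c * u) by field; rewrite gt_eqF.
  rewrite ler_wpM2r ?expR_ge0// /u -exprM mulnC exprM.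
  by rewrite lerXn2r ?nnegrE ?exprn_ge0 ?(ltW q0).
apply: lerXn2r; rewrite ?nnegrE//; last exact: ltW.
exact: mulr_ge0 (ltW u0) (expR_ge0 _).
Qed.

(** Half of the exponent is spent on the factor [exp (- c z / 2)] and half on
    the summability in [m]. *)
Lemma superexp_tail (q c : R) : 1 < q -> 0 < c ->
  exists2 C : R, 0 < C & forall (z : R) m, 1 <= z ->
    expR (- (c * z * q ^+ m)) <= C * expR (- (c / 2 * z)) / 4 ^+ m.
Proof.
move=> q1 c0; have c20 : 0 < c / 2 by rewrite divr_gt0.
have [C C0 HC] := superexp_bound q1 c20; exists C => // z m z1.
have q0 : 1 <= q ^+ m by rewrite exprn_ege1// ltW.
have -> : C * expR (- (c / 2 * z)) / 4 ^+ m = C / 4 ^+ m * expR (- (c / 2 * z)) by ring.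
apply: (@le_trans _ _ (expR (- (c / 2 * q ^+ m)) * expR (- (c / 2 * z)))).
  rewrite -expRD ler_expR -opprD lerN2 -mulrDr (_ : c * z * q ^+ m = c / 2 * (2 * (z * q ^+ m))); last by field.
  rewrite ler_wpM2l ?(ltW c20)//.
  have h1 : q ^+ m <= z * q ^+ m by rewrite ler_peMl// (le_trans ler01).
  have h2 : z <= z * q ^+ m by rewrite ler_peMr// (le_trans ler01).
  lra.
rewrite ler_wpM2r ?expR_ge0// ler_pdivlMr ?exprn_gt0// mulrC; exact: HC.
Qed.

End superexponential.

Section measurable_events.
Context d (W : measurableType d) (R : realType).

Lemma measurable_absr (f : W -> R) : measurable_fun setT f -> measurable_fun setT (fun w => `|f w|).
Proof. by move=> mf; exact: measurableT_comp. Qed.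

Lemma measurable_le_cst (f : W -> R) a : measurable_fun setT f -> measurable [set w | f w <= a].
Proof.
move=> mf; have := mf measurableT [set` `]-oo, a]] (measurable_itv _).
by rewrite setTI; congr measurable; apply/seteqP; split => w /=; rewrite in_itv.
Qed.

Lemma measurable_ge_cst (f : W -> R) a : measurable_fun setT f -> measurable [set w | a <= f w].
Proof.
move=> mf; have := mf measurableT [set` `[a, +oo[] (measurable_itv _).
by rewrite setTI; congr measurable; apply/seteqP; split => w /=; rewrite in_itv/= andbT.
Qed.

Lemma measurable_gt_cst (f : W -> R) a : measurable_fun setT f -> measurable [set w | a < f w].
Proof.
move=> mf; have := mf measurableT [set` `]a, +oo[] (measurable_itv _).
by rewrite setTI; congr measurable; apply/seteqP; split => w /=; rewrite in_itv/= andbT.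
Qed.

Lemma measurable_exists (I : set nat) (A : nat -> set W) : (forall i, I i -> measurable (A i)) ->
  measurable [set w | exists2 i, I i & A i w].
Proof. by move=> mA; exact: bigcup_measurable. Qed.

Lemma measure_bigcup_geometric_le (P : probability W R) (E : nat -> set W) (e : R) : 0 <= e ->
  (forall m, measurable (E m)) -> (forall m, (P (E m) <= (e / (2 ^ m.+1)%:R)%:E)%E) ->
  (P (\bigcup_m E m) <= e%:E)%E.
Proof.
move=> e0 mE PE.
apply: le_trans (measure_sigma_subadditive _ mE _ (@subset_refl _ _)) _; first exact: bigcup_measurable.
apply: le_trans (epsilon_trick0 predT e0).
by apply: lee_nneseries => m _ //; exact: PE.
Qed.

End measurable_events.

(** Apart from adaptedness, [expX] is all that is assumed of the path [X]. *)
Section dyadic_maximal.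
Context d (W : measurableType d) (R : realType) (T : {posnum R}) (P : probability W R)
  (F : R -> set (set W)).
Hypothesis sF : forall t : R, 0 <= t <= T%:num -> sigma_algebra setT (F t).
Hypothesis Fm : forall t : R, 0 <= t <= T%:num -> F t `<=` measurable.
Hypothesis Fle : forall s t : R, 0 <= s -> s <= t -> t <= T%:num -> F s `<=` F t.
Variables (L : R) (X : W -> Omega T).
Hypothesis L0 : 0 < L.
Hypothesis aX : forall t, 0 <= t <= T%:num -> sub_measurable (F t) (fun w => X w t).
Hypothesis expX : forall (l s t : R) A, 0 <= s -> s <= t -> t <= T%:num -> F s A ->
  (\int[P]_(w in A) (expR (l * (X w t - X w s)))%:E
    <= (expR (l ^+ 2 * L * (t - s)))%:E * P A)%E.

Lemma coordinate_measurable t : measurable_fun setT (fun w => X w t).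
Proof.
have tI := clip_itv T t; rewrite in_itv in tI.
under eq_fun do rewrite -cpath_clip.
by apply: (sub_measurable_measurable (sF tI) (Fm tI)); exact: aX.
Qed.

Definition dyadic_integral N (h : R -> W -> R) i w :=
  \sum_(j < i) h (dyad T N j) w * (X w (dyad T N j.+1) - X w (dyad T N j)).

Definition dyadic_energy N (h : R -> W -> R) i w :=
  \sum_(j < i) h (dyad T N j) w ^+ 2 * (T%:num / 2 ^+ N).

Section integrand.
Variables (N : nat) (h : R -> W -> R).
Hypothesis mh : forall t, 0 <= t <= T%:num -> sub_measurable (F t) (h t).

(** [maximal_le] at the optimal parameter [l = a / (2 L v)]. *)
Lemma dyadic_maximal_le a v : 0 < a -> 0 < v ->
  (P [set w | exists2 i, (i < (2 ^ N).+1)%N & (a <= dyadic_integral N h i w /\ dyadic_energy N h i w <= v)%R]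
    <= (expR (- (a ^+ 2 / (4 * L * v))))%:E)%E.
Proof.
move=> a0 v0.
pose t i := dyad T N (minn i (2 ^ N)).
have tI i : 0 <= t i <= T%:num by apply: dyad_itv; exact: geq_minr.
have tS i : t i <= t i.+1 by apply: le_dyad; rewrite leq_min geq_minr andbT geq_min leqnSn.
have t0 i : 0 <= t i by have /andP[] := tI i.
have tT i : t i <= T%:num by have /andP[] := tI i.
have := @maximal_le _ W R P (fun i => F (t i)) (fun i => sF (tI i)) (fun i => @Fm _ (tI i))
  (fun i => @Fle _ _ (t0 i) (tS i) (tT i.+1)) L (fun i w => X w (t i.+1) - X w (t i))
  (fun i => t i.+1 - t i) (fun i => h (t i)) L0.
have mD i : sub_measurable (F (t i.+1)) (fun w => X w (t i.+1) - X w (t i)).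
  apply: sub_measurableB; first exact: aX.
  by apply: (sub_measurableS (sF (tI i)) (sF (tI i.+1)) (@Fle _ _ (t0 i) (tS i) (tT i.+1))); exact: aX.
have l0 : 0 <= a / (2 * L * v) by rewrite divr_ge0 ?(ltW a0)// ltW// !mulr_gt0.
move=> /(_ mD (fun i l A => @expX l _ _ A (t0 i) (tS i) (tT i.+1)) (fun i => mh (tI i)) _ a v (2 ^ N).+1 l0) H.
have -> : - (a ^+ 2 / (4 * L * v)) = - (a / (2 * L * v) * a) + (a / (2 * L * v)) ^+ 2 * L * v.
  by field; rewrite !gt_eqF.
apply: le_trans H; rewrite le_eqVlt; apply/orP; left; apply/eqP; congr (P _).
have E i w : (i < (2 ^ N).+1)%N ->
  \sum_(j < i) h (t j) w * (X w (t j.+1) - X w (t j)) = dyadic_integral N h i w /\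
  \sum_(j < i) h (t j) w ^+ 2 * (t j.+1 - t j) = dyadic_energy N h i w.
  move=> iN; split; apply: eq_bigr => j _.
    have j2 : (j < 2 ^ N)%N := leq_trans (ltn_ord j) iN.
    by rewrite /t (minn_idPl j2) (minn_idPl (ltnW j2)).
  have j2 : (j < 2 ^ N)%N := leq_trans (ltn_ord j) iN.
  by rewrite /t (minn_idPl j2) (minn_idPl (ltnW j2)) dyadS addrC addKr.
by apply/seteqP; split => w [i iN [h1 h2]]; exists i => //; have [e1 e2] := E i w iN; rewrite ?e1 ?e2// -?e1 -?e2.
Qed.

End integrand.

Lemma dyadic_maximal_abs_le N (h : R -> W -> R) a v :
  (forall t, 0 <= t <= T%:num -> sub_measurable (F t) (h t)) -> 0 < a -> 0 < v ->
  (P [set w | exists2 i, (i < (2 ^ N).+1)%N & (a <= `|dyadic_integral N h i w| /\ dyadic_energy N h i w <= v)%R]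
    <= (2 * expR (- (a ^+ 2 / (4 * L * v))))%:E)%E.
Proof.
move=> mh a0 v0.
pose E (h' : R -> W -> R) := [set w | exists2 i, (i < (2 ^ N).+1)%N & (a <= dyadic_integral N h' i w /\ dyadic_energy N h' i w <= v)%R].
pose h' t w := - h t w.
have mh' t : 0 <= t <= T%:num -> sub_measurable (F t) (h' t).
  by move=> tT; rewrite /h'; under eq_fun do rewrite -mulN1r; apply: sub_measurableM; [exact: sub_measurable_cst|exact: mh].
have mE g : (forall t, 0 <= t <= T%:num -> sub_measurable (F t) (g t)) -> measurable (E g).
  move=> mg; have mgj (j : nat) : (j <= 2 ^ N)%N -> measurable_fun setT (g (dyad T N j)).
    by move=> jN; apply: (sub_measurable_measurable (sF (dyad_itv T jN)) (Fm (dyad_itv T jN))); exact: (mg _ (dyad_itv T jN)).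
  apply: (@measurable_exists _ W [set i | (i < (2 ^ N).+1)%N]
    (fun i => [set w | a <= dyadic_integral N g i w] `&` [set w | dyadic_energy N g i w <= v])) => i /= iN.
  have jN (j : 'I_i) : (j <= 2 ^ N)%N by rewrite -ltnS (ltn_trans (ltn_ord j)).
  apply: measurableI; [apply: measurable_ge_cst|apply: measurable_le_cst]; apply: measurable_sum => j.
    by apply: measurable_funM; [exact: mgj|apply: measurable_funB; exact: coordinate_measurable].
  by apply: measurable_funM => //; apply: measurable_funX; exact: mgj.
have hN i w : dyadic_integral N h' i w = - dyadic_integral N h i w.
  by rewrite /dyadic_integral -sumrN; apply: eq_bigr => j _; rewrite mulNr.
have hE i w : dyadic_energy N h' i w = dyadic_energy N h i w.
  by apply: eq_bigr => j _; rewrite /h' sqrrN.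
apply: (@le_trans _ _ (P (E h `|` E h'))).
  rewrite (_ : mkset _ = E h `|` E h')//; apply/seteqP; split => w /=.
    move=> [i iN [h1 h2]]; case: (leP 0 (dyadic_integral N h i w)) h1 => s h1.
      by left; exists i => //; rewrite (ger0_norm s) in h1.
    by right; exists i => //; rewrite hN hE (ltr0_norm s) in h1 *.
  case=> [] [i iN [h1 h2]]; exists i => //; split.
  - by apply: le_trans h1 (ler_norm _).
  - by [].
  - by apply: le_trans h1 _; rewrite hN -normrN ler_norm.
  - by rewrite -hE.
apply: le_trans (measureU2 _ (mE _ mh) (mE _ mh')) _.
rewrite mulr_natl mulr2n EFinD; apply: leeD; exact: dyadic_maximal_le.
Qed.

End dyadic_maximal.

Section first_exceedance.
Context (R : realType) (T : {posnum R}).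
Implicit Types (x : Omega T).

Lemma Q_level0 x t : 0 <= t <= T%:num -> Q 0 x t = x t ^+ 2.
Proof.
move=> tT; rewrite (@Q_block _ T 0 0)//; first by rewrite big_ord0 add0r /dyad !mul0r Omega0 subr0.
by rewrite /dyad !mul0r mul1r expr0 divr1.
Qed.

Lemma Q_le_of_differences x t (b r : R) n : 0 <= b -> 0 < r < 1 -> 0 <= t <= T%:num ->
  x t ^+ 2 <= b -> (forall m, (m < n)%N -> `|Q m.+1 x t - Q m x t| <= b * r ^+ m) ->
  Q n x t <= b * (1 + (1 - r)^-1).
Proof.
move=> b0 /andP[r0 r1] tT xb H; have r10 : 0 < 1 - r by rewrite subr_gt0.
suff h m : (m <= n)%N -> Q m x t <= b * (1 + (1 - r ^+ m) / (1 - r)).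
  apply: le_trans (h n (leqnn n)) _; rewrite ler_wpM2l// lerD2l.
  by rewrite -[leRHS]mul1r ler_wpM2r ?invr_ge0 ?(ltW r10)// gerBl exprn_ge0// ltW.
elim: m => [_|m IH mn]; first by rewrite Q_level0// expr0 subrr mul0r addr0 mulr1.
have h1 := le_trans (ler_norm _) (H m mn); rewrite lerBlDr in h1.
apply: le_trans h1 (le_trans (lerD (lexx _) (IH (ltnW mn))) _).
by rewrite le_eqVlt; apply/orP; left; apply/eqP; rewrite exprS; field; rewrite gt_eqF.
Qed.

(** At the grid point just before the first exceedance the differences of all
    levels up to [n] are still bounded, hence so is [Q n.+1], and by
    [level_gap_sum] it bounds the energy of the integrand up to the exceedance.
    The one-step delay costs nothing, for the integrand of the last step is
    determined at that previous point. *)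
Lemma first_exceedance x n p (b r : R) : 0 <= b -> 0 < r < 1 ->
  (forall i, (i <= 2 ^ (n.+1 + p))%N -> x (dyad T (n.+1 + p) i) ^+ 2 <= b) ->
  (forall m i, (m < n)%N -> (i <= 2 ^ (n.+1 + p))%N ->
    `|Q m.+1 x (dyad T (n.+1 + p) i) - Q m x (dyad T (n.+1 + p) i)| <= b * r ^+ m) ->
  (exists2 i, (i <= 2 ^ (n.+1 + p))%N &
    b * r ^+ n < `|Q n.+1 x (dyad T (n.+1 + p) i) - Q n x (dyad T (n.+1 + p) i)|) ->
  exists2 i, (i <= 2 ^ (n.+1 + p))%N &
    b * r ^+ n <= `|Q n.+1 x (dyad T (n.+1 + p) i) - Q n x (dyad T (n.+1 + p) i)| /\
    \sum_(j < i) (2 * level_gap n x (dyad T (n.+1 + p) j)) ^+ 2 * (T%:num / 2 ^+ (n.+1 + p))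
      <= 2 * (T%:num / 2 ^+ n) * (b * (1 + (1 - r)^-1)).
Proof.
move=> b0 r01 xb H; set N := (n.+1 + p)%N => ex; have /andP[r0 r1] := r01.
pose D i := `|Q n.+1 x (dyad T N i) - Q n x (dyad T N i)|.
have ex' : exists i, (i <= 2 ^ N)%N && (b * r ^+ n < D i).
  by case: ex => i iN Di; exists i; rewrite iN.
have [i /andP[iN Di] imin] := ex_minnP ex'.
exists i => //; split; first exact: ltW.
case: i iN Di imin => [|i] iN Di imin.
  by rewrite big_ord0 !mulr_ge0 ?exprn_ge0 ?invr_ge0 ?exprn_ge0// ?addr_ge0 ?invr_ge0 ?subr_ge0 ?(ltW r1).
have Di' : D i <= b * r ^+ n.
  by rewrite leNgt; apply/negP => h; have := imin i; rewrite h (ltnW iN) ltnn => /(_ isT).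
have tI := dyad_itv T (ltnW iN).
have Qi : Q n.+1 x (dyad T N i) <= b * (1 + (1 - r)^-1).
  apply: Q_le_of_differences => //; first exact/xb/ltnW.
  move=> m; rewrite ltnS leq_eqVlt => /predU1P[->//|mn]; apply: H => //; exact: ltnW.
rewrite (eq_bigr (fun j : 'I_i.+1 => level_gap n x (dyad T N j) ^+ 2 * (4 * (T%:num / 2 ^+ N)))); last first.
  by move=> j _; ring.
rewrite -mulr_suml; have g0 : 0 <= 4 * (T%:num / 2 ^+ N) :> R by rewrite mulr_ge0// divr_ge0 ?exprn_ge0.
apply: le_trans (ler_wpM2r g0 (@level_gap_sum _ T n p i x iN)) _.
have -> : 2 ^+ p * Q n.+1 x (dyad T N i) * (4 * (T%:num / 2 ^+ N)) = 2 * (T%:num / 2 ^+ n) * Q n.+1 x (dyad T N i).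
  by rewrite /N exprD exprS; field; rewrite !expf_neq0 ?pnatr_eq0.
by apply: ler_wpM2l Qi; rewrite mulr_ge0// divr_ge0 ?exprn_ge0.
Qed.

End first_exceedance.

Section increments_tail.
Context d (W : measurableType d) (R : realType) (T : {posnum R}) (P : probability W R)
  (F : R -> set (set W)).
Hypothesis sF : forall t : R, 0 <= t <= T%:num -> sigma_algebra setT (F t).
Hypothesis Fm : forall t : R, 0 <= t <= T%:num -> F t `<=` measurable.
Hypothesis Fle : forall s t : R, 0 <= s -> s <= t -> t <= T%:num -> F s `<=` F t.
Variables (L : R) (X : W -> Omega T).
Hypothesis L0 : 0 < L.
Hypothesis aX : forall t, 0 <= t <= T%:num -> sub_measurable (F t) (fun w => X w t).
Hypothesis expX : forall (l s t : R) A, 0 <= s -> s <= t -> t <= T%:num -> F s A ->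
  (\int[P]_(w in A) (expR (l * (X w t - X w s)))%:E
    <= (expR (l ^+ 2 * L * (t - s)))%:E * P A)%E.

Let maximal_abs_le := @dyadic_maximal_abs_le _ W R T P F sF Fm Fle L X L0 aX expX.
Let mX := @coordinate_measurable _ W R T F sF Fm X aX.

(** The maximal inequality for the integrand that selects the single step of
    index [k]. *)
Lemma increment_tail m k (a : R) : (k < 2 ^ m)%N -> 0 < a ->
  (P [set w | a < `|X w (dyad T m k.+1) - X w (dyad T m k)|]%R
    <= (2 * expR (- (a ^+ 2 / (4 * L * (T%:num / 2 ^+ m)))))%:E)%E.
Proof.
move=> km a0; have v0 : 0 < T%:num / 2 ^+ m :> R by rewrite divr_gt0// exprn_gt0.
pose h (t : R) (w : W) : R := (t == dyad T m k)%:R.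
have mh t : 0 <= t <= T%:num -> sub_measurable (F t) (h t) by move=> _; exact: sub_measurable_cst.
have hk (j : 'I_k) w : h (dyad T m j) w = 0.
  rewrite /h lt_eqF// /dyad ltr_pM2r ?invr_gt0 ?exprn_gt0// ltr_pM2r// ltr_nat; exact: ltn_ord.
have kk w : h (dyad T m k) w = 1 by rewrite /h eqxx.
have E1 w : dyadic_integral X m h k.+1 w = X w (dyad T m k.+1) - X w (dyad T m k).
  by rewrite /dyadic_integral big_ord_recr/= big1 ?add0r ?kk ?mul1r// => j _; rewrite hk mul0r.
have E2 w : dyadic_energy T m h k.+1 w = T%:num / 2 ^+ m.
  by rewrite /dyadic_energy big_ord_recr/= big1 ?add0r ?kk ?expr1n ?mul1r// => j _; rewrite hk expr0n mul0r.
apply: le_trans (maximal_abs_le m mh a0 v0).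
apply: le_measure; rewrite ?inE.
- by apply: measurable_gt_cst; apply: measurable_absr; apply: measurable_funB; exact: mX.
- apply: (@measurable_exists _ W [set i | (i < (2 ^ m).+1)%N]
    (fun i => [set w | a <= `|dyadic_integral X m h i w|] `&` [set w | dyadic_energy T m h i w <= T%:num / 2 ^+ m])) => i /= iN.
  apply: measurableI; [apply: measurable_ge_cst; apply: measurable_absr|apply: measurable_le_cst]; apply: measurable_sum => j.
    by apply: measurable_funM; [exact: measurable_cst|apply: measurable_funB; exact: mX].
  by apply: measurable_funM => //; apply: measurable_funX; exact: measurable_cst.
- by move=> w /= aw; exists k.+1 => //; rewrite E1 E2; split => //; exact: ltW.
Qed.

(** At level [m] there are [2 ^ m] increments, each with tail
    [2 exp (- c z q ^ m)]; the factor [4 ^ m] in the hypothesis leaves a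
    geometric series in [m]. *)
Lemma increments_tail (q c C a z : R) :
  (forall m, expR (- (c * z * q ^+ m)) <= C * expR (- (c / 2 * z)) / 4 ^+ m) -> 0 < a -> 0 < C ->
  forall r : R, 0 < r -> c * z = a ^+ 2 / (4 * L * T%:num) -> q = 2 * r ^+ 2 ->
  (P (\bigcup_m [set w | exists2 k, (k < 2 ^ m)%N & a * r ^+ m < `|X w (dyad T m k.+1) - X w (dyad T m k)|]%R)
    <= (4 * C * expR (- (c / 2 * z)))%:E)%E.
Proof.
move=> H a0 C0 r r0 cz qr.
pose E m k := [set w | a * r ^+ m < `|X w (dyad T m k.+1) - X w (dyad T m k)|].
have mE m k : measurable (E m k).
  by apply: measurable_gt_cst; apply: measurable_absr; apply: measurable_funB; exact: mX.
apply: measure_bigcup_geometric_le => [|m|m]; first by rewrite !mulr_ge0 ?expR_ge0 ?(ltW C0).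
  exact: (@measurable_exists _ W [set k | (k < 2 ^ m)%N] (E m)).
apply: (@le_trans _ _ (\sum_(k < 2 ^ m) P (E m k))%E).
  apply: content_subadditive => //; first exact: (@measurable_exists _ W [set k | (k < 2 ^ m)%N] (E m)).
  by rewrite -bigcup_mkord => w [k km h]; exists k.
apply: (@le_trans _ _ (\sum_(k < 2 ^ m) (2 * C * expR (- (c / 2 * z)) / 4 ^+ m)%:E)%E).
  apply: lee_sum => k _; apply: le_trans (increment_tail (ltn_ord k) (mulr_gt0 a0 (exprn_gt0 m r0))) _.
  rewrite lee_fin -!mulrA ler_wpM2l// !mulrA; apply: le_trans (H m).
  rewrite ler_expR lerN2 cz qr le_eqVlt; apply/orP; left; apply/eqP.
  by rewrite exprMn -exprM mulnC exprM; field; rewrite ?expf_neq0 ?gt_eqF.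
rewrite sumEFin lee_fin sumr_const card_ord -[leLHS]mulr_natl natrX le_eqVlt; apply/orP; left; apply/eqP.
have -> : 4 ^+ m = 2 ^+ m * 2 ^+ m :> R by rewrite -exprMn -natrM.
by rewrite natrX exprS; field; rewrite expf_neq0.
Qed.

End increments_tail.

Section level_differences_tail.
Context d (W : measurableType d) (R : realType) (T : {posnum R}) (P : probability W R)
  (F : R -> set (set W)).
Hypothesis sF : forall t : R, 0 <= t <= T%:num -> sigma_algebra setT (F t).
Hypothesis Fm : forall t : R, 0 <= t <= T%:num -> F t `<=` measurable.
Hypothesis Fle : forall s t : R, 0 <= s -> s <= t -> t <= T%:num -> F s `<=` F t.
Variables (L : R) (X : W -> Omega T).
Hypothesis L0 : 0 < L.
Hypothesis aX : forall t, 0 <= t <= T%:num -> sub_measurable (F t) (fun w => X w t).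
Hypothesis expX : forall (l s t : R) A, 0 <= s -> s <= t -> t <= T%:num -> F s A ->
  (\int[P]_(w in A) (expR (l * (X w t - X w s)))%:E
    <= (expR (l ^+ 2 * L * (t - s)))%:E * P A)%E.

Let maximal_abs_le := @dyadic_maximal_abs_le _ W R T P F sF Fm Fle L X L0 aX expX.
Let mX := @coordinate_measurable _ W R T F sF Fm X aX.

Lemma coordinate_sub_measurable s t : 0 <= s -> s <= t -> t <= T%:num -> sub_measurable (F t) (fun w => X w s).
Proof.
move=> s0 st tT; have sT : 0 <= s <= T%:num by rewrite s0 (le_trans st).
have tT' : 0 <= t <= T%:num by rewrite (le_trans s0 st).
by apply: (sub_measurableS (sF sT) (sF tT') (@Fle _ _ s0 st tT)); exact: aX.
Qed.

Lemma Q_measurable n t : 0 <= t <= T%:num -> measurable_fun setT (fun w => Q n (X w) t).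
Proof.
move=> tT; under eq_fun do rewrite QE//.
by apply: measurable_sum => k; apply: measurable_funX; apply: measurable_funB; exact: mX.
Qed.

Lemma level_gap_measurable n t : 0 <= t <= T%:num ->
  sub_measurable (F t) (fun w => 2 * level_gap n (X w) t).
Proof.
move=> /andP[t0 tT]; have fl m : 0 <= dyad_floor T m t <= t.
  have /andP[h _] := dyad_floor_itv T m t0; rewrite subr_ge0 in h; rewrite h andbT.
  by rewrite /dyad_floor /dyad divr_ge0 ?mulr_ge0 ?exprn_ge0.
have m1 m : sub_measurable (F t) (fun w => X w (dyad_floor T m t)).
  by have /andP[h1 h2] := fl m; exact: coordinate_sub_measurable.
apply: sub_measurableM; first exact: sub_measurable_cst.
by apply: sub_measurableB; exact: m1.
Qed.

Variables (g B : R).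
Hypothesis g01 : 0 < g < 2^-1.
Hypothesis B1 : 1 <= B.
Let r := 2 `^ (- g).
Let q := 2 * r ^+ 2.
Let b := B * L * T%:num.
Let c := (8 * (1 + (1 - r)^-1))^-1.

Let r01 : 0 < r < 1.
Proof. by apply: powR2_opp_itv; have /andP[] := g01. Qed.
Let r0 : 0 < r. Proof. by have /andP[] := r01. Qed.
Let r1 : r < 1. Proof. by have /andP[] := r01. Qed.
Let b0 : 0 < b.
Proof. by rewrite !mulr_gt0// (lt_le_trans ltr01). Qed.
Let C20 : 0 < 1 + (1 - r)^-1.
Proof. by rewrite addr_gt0// invr_gt0 subr_gt0. Qed.

(* The sum of squares of level 0 is the square of the path, so [large] starts the
   induction on levels. *)
Let large N : set W := [set w | exists2 i, (i < (2 ^ N).+1)%N & b < X w (dyad T N i) ^+ 2].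
Let bad N n : set W := [set w | exists2 i, (i < (2 ^ N).+1)%N &
  b * r ^+ n < `|Q n.+1 (X w) (dyad T N i) - Q n (X w) (dyad T N i)|].
Let exceed N n : set W := large N `|` [set w | exists2 m, (m < n)%N & bad N m w].

Let mlarge N : measurable (large N).
Proof.
apply: (@measurable_exists _ W [set i | (i < (2 ^ N).+1)%N] (fun i => [set w | b < X w (dyad T N i) ^+ 2])) => i _.
by apply: measurable_gt_cst; apply: measurable_funX; exact: mX.
Qed.

Let mbad N n : measurable (bad N n).
Proof.
apply: (@measurable_exists _ W [set i | (i < (2 ^ N).+1)%N] (fun i => [set w |
  b * r ^+ n < `|Q n.+1 (X w) (dyad T N i) - Q n (X w) (dyad T N i)|])) => i /= iN.
by apply: measurable_gt_cst; apply: measurable_absr; apply: measurable_funB; apply: Q_measurable; exact: dyad_itv.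
Qed.

Let mexceed N n : measurable (exceed N n).
Proof.
apply: measurableU => //.
by apply: (@measurable_exists _ W [set m | (m < n)%N] (bad N)) => m _.
Qed.

(** The maximal inequality for the integrand 1, whose transform is the path. *)
Lemma large_tail N : (P (large N) <= (2 * expR (- (B / 4)))%:E)%E.
Proof.
pose h (t : R) (w : W) : R := 1.
have mh t : 0 <= t <= T%:num -> sub_measurable (F t) (h t) by move=> _; exact: sub_measurable_cst.
have sb0 : 0 < Num.sqrt b by rewrite sqrtr_gt0.
have T0 : 0 < T%:num :> R by [].
have -> : B / 4 = Num.sqrt b ^+ 2 / (4 * L * T%:num).
  by rewrite sqr_sqrtr ?(ltW b0)// /b; field; rewrite !gt_eqF.
apply: le_trans (maximal_abs_le N mh sb0 T0).
have E1 i w : dyadic_integral X N h i w = X w (dyad T N i).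
  rewrite /dyadic_integral; under eq_bigr do rewrite mul1r.
  by rewrite -(big_mkord xpredT (fun j => X w (dyad T N j.+1) - X w (dyad T N j))) telescope_sumr// {2}/dyad !mul0r Omega0 subr0.
have E2 i w : (i < (2 ^ N).+1)%N -> dyadic_energy T N h i w <= T%:num.
  move=> iN; rewrite /dyadic_energy; under eq_bigr do rewrite expr1n mul1r.
  rewrite sumr_const card_ord -[leLHS]mulr_natl.
  have /andP[_] := dyad_itv T (iN : (i <= 2 ^ N)%N).
  by rewrite /dyad mulrA.
apply: le_measure; rewrite ?inE//.
  apply: (@measurable_exists _ W [set i | (i < (2 ^ N).+1)%N]
    (fun i => [set w | Num.sqrt b <= `|dyadic_integral X N h i w|] `&` [set w | dyadic_energy T N h i w <= T%:num])) => i /= iN.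
  apply: measurableI; [apply: measurable_ge_cst; apply: measurable_absr|apply: measurable_le_cst]; apply: measurable_sum => j.
    by apply: measurable_funM; [exact: measurable_cst|apply: measurable_funB; exact: mX].
  by apply: measurable_funM => //; apply: measurable_funX; exact: measurable_cst.
move=> w [i iN bi]; exists i => //; split; last exact: E2.
by rewrite E1 -sqrtr_sqr ler_wsqrtr// ltW.
Qed.

(** Outside [exceed N n] the bound on the energy of [first_exceedance] is
    available, and [a^2 / (4 L v)] equals [c B q ^ n]. *)
Lemma bad_tail n p : (P (bad (n.+1 + p) n `\` exceed (n.+1 + p) n)
  <= (2 * expR (- (c * B * q ^+ n)))%:E)%E.
Proof.
set N := (n.+1 + p)%N; pose h (t : R) (w : W) : R := 2 * level_gap n (X w) t.
have mh t : 0 <= t <= T%:num -> sub_measurable (F t) (h t) by move=> tT; exact: level_gap_measurable.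
have a0 : 0 < b * r ^+ n by rewrite mulr_gt0// exprn_gt0.
have v0 : 0 < 2 * (T%:num / 2 ^+ n) * (b * (1 + (1 - r)^-1)).
  by rewrite mulr_gt0 ?(mulr_gt0 b0 C20)// mulr_gt0// divr_gt0// exprn_gt0.
have -> : c * B * q ^+ n = (b * r ^+ n) ^+ 2 / (4 * L * (2 * (T%:num / 2 ^+ n) * (b * (1 + (1 - r)^-1)))).
  have rr : q ^+ n = 2 ^+ n * (r ^+ n) ^+ 2 by rewrite /q exprMn -!exprM mulnC.
  have B0 : 0 < B by exact: lt_le_trans B1.
  rewrite /c rr /b; move: (C20); move: (1 + (1 - r)^-1) => C2 C20'.
  by field; rewrite ?expf_neq0 ?gt_eqF.
apply: le_trans (maximal_abs_le N mh a0 v0).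
apply: le_measure; rewrite ?inE.
- exact: measurableD.
- apply: (@measurable_exists _ W [set i | (i < (2 ^ N).+1)%N]
    (fun i => [set w | b * r ^+ n <= `|dyadic_integral X N h i w|] `&` [set w | dyadic_energy T N h i w <= 2 * (T%:num / 2 ^+ n) * (b * (1 + (1 - r)^-1))])) => i /= iN.
  have mhj (j : 'I_i) : measurable_fun setT (h (dyad T N j)).
    by apply: measurable_funM => //; apply: measurable_funB; exact: mX.
  apply: measurableI; [apply: measurable_ge_cst; apply: measurable_absr|apply: measurable_le_cst]; apply: measurable_sum => j.
    by apply: measurable_funM; [exact: mhj|apply: measurable_funB; exact: mX].
  by apply: measurable_funM => //; apply: measurable_funX; exact: mhj.
- move=> w [bw nw].
  have [|m i mn iN|//|i iN [h1 h2]] := @first_exceedance R T (X w) n p b r (ltW b0) r01.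
  + move=> i iN; rewrite leNgt; apply/negP => h1; apply: nw; left; by exists i.
  + rewrite leNgt; apply/negP => h1; apply: nw; right; exists m => //; by exists i.
  + by exists i => //; split => //; rewrite /dyadic_integral -Q_difference_sum.
Qed.

Hypothesis q1 : 1 < q.
Variable C : R.
Hypothesis C0 : 0 < C.
Hypothesis HC : forall z m, 1 <= z -> expR (- (c * z * q ^+ m)) <= C * expR (- (c / 2 * z)) / 4 ^+ m.

(** The probability of a first failure at level [n] is added at each step;
    [4 ^ n] is replaced by [2 ^ n] to obtain a telescoping bound. *)
Lemma exceed_tail N n : (n <= N)%N ->
  (P (exceed N n) <= (2 * expR (- (B / 4)) + 4 * C * expR (- (c / 2 * B)) * (1 - (2 ^+ n)^-1))%:E)%E.
Proof.
elim: n => [_|n IH nN].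
  rewrite expr0 invr1 subrr mulr0 addr0; apply: le_trans (large_tail N).
  apply: le_measure; rewrite ?inE//; last by move=> w [//|[]].
have -> : exceed N n.+1 = exceed N n `|` (bad N n `\` exceed N n).
  apply/seteqP; split => w.
    case=> [lw|[m]]; first by left; left.
    rewrite ltnS leq_eqVlt => /predU1P[-> bw|mn bw]; last by left; right; exists m.
    by have [ew|ew] := pselect (exceed N n w); [left|right].
  case=> [[lw|[m mn bw]]|[bw _]]; [by left|right; exists m => //; exact: ltnW|by right; exists n].
apply: le_trans (measureU2 _ (mexceed _ _) (measurableD (mbad _ _) (mexceed _ _))) _.
have tail : (P (bad N n `\` exceed N n) <= (2 * expR (- (c * B * q ^+ n)))%:E)%E.
  by have := bad_tail n (N - n.+1); rewrite subnKC.
apply: le_trans (leeD (IH (ltnW nN)) tail) _; rewrite -EFinD lee_fin -addrA lerD2l.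
apply: (@le_trans _ _ (4 * C * expR (- (c / 2 * B)) * (1 - (2 ^+ n)^-1) + 2 * (C * expR (- (c / 2 * B)) / 4 ^+ n))).
  by rewrite lerD2l ler_wpM2l// HC.
set e := expR _; have e0 : 0 < C * e by rewrite mulr_gt0// expR_gt0.
have -> : 4 ^+ n = 2 ^+ n * 2 ^+ n :> R by rewrite -exprMn -natrM.
have -> : 4 * C * e * (1 - (2 ^+ n.+1)^-1) = 4 * C * e * (1 - (2 ^+ n)^-1) + 2 * (C * e / 2 ^+ n).
  by rewrite exprS; field; rewrite expf_neq0.
rewrite lerD2l ler_wpM2l// ler_wpM2l ?(ltW e0)// invfM ler_piMr ?invr_ge0 ?exprn_ge0//.
by rewrite invf_le1 ?exprn_gt0// exprn_ege1// ler1n.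
Qed.

Let exceed_nd : nondecreasing_seq (fun N => exceed N N).
Proof.
apply/nondecreasing_seqP => N; rewrite subsetEset => w.
have i2 i : (i < (2 ^ N).+1)%N -> (i.*2 < (2 ^ N.+1).+1)%N.
  by rewrite !ltnS expnS -mul2n leq_mul2l.
case=> [[i iN h]|[m mN [i iN h]]].
  by left; exists i.*2; [exact: i2|rewrite dyad_double].
by right; exists m; [exact: ltnW|exists i.*2; [exact: i2|rewrite dyad_double]].
Qed.

(** The events increase with the level of the grid, so a bound that is uniform
    in the level passes to their union. *)
Lemma level_differences_tail :
  (P (\bigcup_N exceed N N) <= (2 * expR (- (B / 4)) + 4 * C * expR (- (c / 2 * B)))%:E)%E.
Proof.
have cv := nondecreasing_cvg_mu (mu := P) (fun N => mexceed N N) (bigcup_measurable (fun N _ => mexceed N N)) exceed_nd.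
rewrite -(cvg_lim _ cv)//; apply: lime_le; first by apply/cvg_ex; eexists; exact: cv.
near=> N; apply: le_trans (exceed_tail (leqnn N)) _; rewrite lee_fin lerD2l.
rewrite ler_piMr ?mulr_ge0 ?expR_ge0 ?(ltW C0)// gerBl invr_ge0 exprn_ge0//.
Unshelve. all: by end_near.
Qed.

(** Strict inequality at some time persists at nearby dyadic times of any high
    enough level. *)
Lemma Zgamma_large_exceed w : ~ (Zgamma g (X w) <= b%:E)%E -> (\bigcup_N exceed N N) w.
Proof.
move=> /ZgammaP/existsNP [n /not_implyP[n1 /negP]]; rewrite -ltNge -/r => hn.
have [t tT Dt] : exists2 t, 0 <= t <= T%:num & b * r ^+ n < `|Q n.+1 (X w) t - Q n (X w) t|.
  apply: contrapT => nt; move: hn; rewrite ltNge => /negP; apply; apply: cpath_norm_leP => t tT.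
  by rewrite leNgt; apply/negP => h; apply: nt; exists t.
have /andP[t0 _] := tT.
have cD : `|Q n.+1 (X w) (dyad_floor T m t) - Q n (X w) (dyad_floor T m t)| @[m --> \oo] -->
    `|Q n.+1 (X w) t - Q n (X w) t|.
  have cQ k : Q k (X w) (dyad_floor T m t) @[m --> \oo] --> Q k (X w) t.
    exact: (cvg_comp (fun m => dyad_floor T m t) (Q k (X w)) (cvg_dyad_floor T t0) (@cpath_continuous _ _ (Q k (X w)) t)).
  by apply: cvg_norm; apply: cvgB; exact: cQ.
have /cvgrPdist_lt/(_ (`|Q n.+1 (X w) t - Q n (X w) t| - b * r ^+ n)) := cD.
rewrite subr_gt0 => /(_ Dt) [m0 _ Hm].
have := Hm (maxn m0 n.+1) (leq_maxl _ _) => /= /(le_lt_trans (ler_norm _)).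
rewrite ltrD2l ltrN2 => hm; exists (maxn m0 n.+1) => //; right; exists n; first exact: leq_maxr.
by exists (Num.truncn (t * 2 ^+ (maxn m0 n.+1) / T%:num)) => //; exact: truncn_dyad_le.
Qed.

Lemma Zgamma_tail : exists E : set W, [/\ measurable E,
  (P E <= (2 * expR (- (B / 4)) + 4 * C * expR (- (c / 2 * B)))%:E)%E &
  forall w, ~ (Zgamma g (X w) <= (B * L * T%:num)%:E)%E -> E w].
Proof.
exists (\bigcup_N exceed N N); split; [exact: bigcup_measurable|exact: level_differences_tail|].
by move=> w; exact: Zgamma_large_exceed.
Qed.

End level_differences_tail.

(** * Lipschitz bound for the quadratic variation *)

Lemma gap_le (R : realDomainType) (u v p e : R) : u - v < u - p - e -> p + e <= v.
Proof. by move=> h; rewrite -(lerD2l (- u)) -lerN2 !opprD !opprK addrA ltW. Qed.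

Section quadratic_lipschitz.
Context d (W : measurableType d) (R : realType) (T : {posnum R}) (P : probability W R)
  (F : R -> set (set W)).
Hypothesis sF : forall t : R, 0 <= t <= T%:num -> sigma_algebra setT (F t).
Hypothesis Fm : forall t : R, 0 <= t <= T%:num -> F t `<=` measurable.
Hypothesis Fle : forall s t : R, 0 <= s -> s <= t -> t <= T%:num -> F s `<=` F t.
Variables (L : R) (X : W -> Omega T).
Hypothesis L0 : 0 < L.
Hypothesis aX : forall t, 0 <= t <= T%:num -> sub_measurable (F t) (fun w => X w t).
Hypothesis energyX : forall (s t : R) A, 0 <= s -> s <= t -> t <= T%:num -> F s A ->
  (\int[P]_(w in A) ((X w t - X w s) ^+ 2)%:E <= (L * (t - s))%:E * P A)%E.
Hypothesis expX : forall (l s t : R) A, 0 <= s -> s <= t -> t <= T%:num -> F s A ->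
  (\int[P]_(w in A) (expR (l * (X w t - X w s)))%:E
    <= (expR (l ^+ 2 * L * (t - s)))%:E * P A)%E.

Lemma grid_dyad m i k n l : (0 < k)%N ->
  grid (dyad T m i) (dyad T m (i + k)) (k * 2 ^ n) l = dyad T (m + n) (i * 2 ^ n + l) :> R.
Proof.
move=> k0; rewrite /grid /dyad exprD !natrD !natrM natrX; field.
by rewrite !expf_neq0 ?pnatr_eq0 -?lt0n.
Qed.

Lemma Q_dyad n (x : Omega T) K : (K <= 2 ^ n)%N ->
  Q n x (dyad T n K) = \sum_(k < K) (x (dyad T n k.+1) - x (dyad T n k)) ^+ 2.
Proof.
move=> Kn; rewrite (@Q_block _ T n K) ?dyad_itv//; first by rewrite subrr expr0n addr0.
by rewrite lexx le_dyad.
Qed.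

Lemma Q_dyad_increment m i k n (x : Omega T) : (i + k <= 2 ^ m)%N ->
  Q (m + n) x (dyad T m (i + k)) - Q (m + n) x (dyad T m i) =
  \sum_(l < k * 2 ^ n) (x (dyad T (m + n) (i * 2 ^ n + l.+1)) - x (dyad T (m + n) (i * 2 ^ n + l))) ^+ 2.
Proof.
move=> ik; rewrite -!(@dyad_scale R T m n) !Q_dyad ?expnD ?leq_mul2r ?ik ?orbT//; last first.
  by rewrite (leq_trans _ ik) ?orbT// leq_addr.
rewrite mulnDl -!(big_mkord xpredT (fun k => (x (dyad T (m + n) k.+1) - x (dyad T (m + n) k)) ^+ 2)).
rewrite (@big_cat_nat _ _ _ (i * 2 ^ n)%N) ?leq_addr//= [LHS]addrC addKr.
rewrite -{1}[(i * 2 ^ n)%N]add0n big_addn addnC addnK big_mkord.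
by apply: eq_bigr => l _; rewrite addnS (addnC l).
Qed.

(** Dyadic times are dense and [q] is continuous. *)
Lemma Alip_of_dyadic (q : cpath T) : q 0 = 0 ->
  (forall m i k, (i + k <= 2 ^ m)%N ->
    0 <= q (dyad T m (i + k)) - q (dyad T m i) <= L * (dyad T m (i + k) - dyad T m i)) ->
  Alip T L q.
Proof.
move=> q0 H; apply: AlipP => // s t s0 st tT.
have t0 : 0 <= t := le_trans s0 st.
have cq u : 0 <= u -> (fun m => q (dyad_floor T m u)) @ \oo --> q u.
  by move=> u0; exact: (cvg_comp (fun m => dyad_floor T m u) q (cvg_dyad_floor T u0) (@cpath_continuous _ _ q u)).
have cd : (fun m => q (dyad_floor T m t) - q (dyad_floor T m s)) @ \oo --> q t - q s.
  by apply: cvgB; exact: cq.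
have cl : (fun m => L * (dyad_floor T m t - dyad_floor T m s)) @ \oo --> L * (t - s).
  by apply: cvgM; [exact: cvg_cst|apply: cvgB; exact: cvg_dyad_floor].
have Hm m : 0 <= q (dyad_floor T m t) - q (dyad_floor T m s) <= L * (dyad_floor T m t - dyad_floor T m s).
  have tI : 0 <= t <= T%:num by rewrite t0.
  have := truncn_dyad_le m tI; rewrite /dyad_floor.
  have ij : (Num.truncn (s * 2 ^+ m / T%:num) <= Num.truncn (t * 2 ^+ m / T%:num))%N.
    by apply: le_truncn; rewrite ler_pM2r ?invr_gt0// ler_pM2r ?exprn_gt0.
  by rewrite -(subnKC ij); exact: H.
apply/andP; split.
  by apply: ler_cvg_to (cvg_cst 0) cd _; apply: nearW => m; have /andP[] := Hm m.
by apply: ler_cvg_to cd cl _; apply: nearW => m; have /andP[] := Hm m.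
Qed.

(** Monotonicity is automatic for a limit of sums of squares. If the upper bound
    fails between two dyadic times, it fails by a margin [1 / e.+1] that the
    approximating sums share from some level on, which is a countable union of
    the null events of [square_variation_negligible]. *)
Lemma Qhat_lipschitz_ae (g b : R) : 0 < g ->
  P.-negligible [set w | (Zgamma g (X w) <= b%:E)%E /\ ~ Alip T L (Qhat (X w))].
Proof.
move=> g0.
pose M (t : R) (w : W) : R := X w t.
have cM w : {within `[0, T%:num], continuous (M ^~ w)}.
  by apply: continuous_subspaceT => t; exact: cpath_continuous.
pose S m i k n w := \sum_(l < k * 2 ^ n) (X w (dyad T (m + n) (i * 2 ^ n + l.+1)) - X w (dyad T (m + n) (i * 2 ^ n + l))) ^+ 2.
pose E m i k e := [set w | [/\ (0 < k)%N, (i + k <= 2 ^ m)%N &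
  \forall n \near \oo, L * (dyad T m (i + k) - dyad T m i) + e.+1%:R^-1 <= S m i k n w]].
have nE m i k e : P.-negligible (E m i k e).
  have [/andP[k0 ik]|h] := boolP ((0 < k)%N && (i + k <= 2 ^ m)%N); last first.
    apply: negligibleS (negligible_set0 P) => w [k0 ik _].
    by move: h; rewrite k0 ik.
  have /andP[s0 _] : 0 <= dyad T m i <= T%:num by apply: dyad_itv; rewrite (leq_trans _ ik)// leq_addr.
  have st : dyad T m i < dyad T m (i + k).
    by rewrite /dyad ltr_pM2r ?invr_gt0 ?exprn_gt0// ltr_pM2r// ltr_nat -[ltnLHS]addn0 ltn_add2l.
  have /andP[_ tT] := dyad_itv T ik.
  have e0 : 0 < e.+1%:R^-1 :> R by rewrite invr_gt0.
  have nN n : (n < k * 2 ^ n)%N by rewrite (leq_trans (ltn_expl n (ltnSn 1)))// leq_pmull.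
  have := @square_variation_negligible _ W R P T%:num F sF Fm Fle L M L0 aX cM energyX expX _ _ _ _ s0 st tT e0 nN.
  apply: negligibleS => w [_ _]; apply: filterS => n /le_trans; apply.
  rewrite le_eqVlt; apply/orP; left; apply/eqP; apply: eq_bigr => l _.
  by rewrite /M !grid_dyad.
apply: (@negligibleS _ _ _ _ (\bigcup_m \bigcup_i \bigcup_k \bigcup_e E m i k e)); last first.
  by do 4 apply: negligible_bigcup => ?; exact: nE.
move=> w [wZ wA]; apply: contrapT => nw; apply: wA; apply: Alip_of_dyadic; first exact: Qhat0 g0 wZ.
move=> m i k ik.
have cS : (fun n => S m i k n w) @ \oo --> Qhat (X w) (dyad T m (i + k)) - Qhat (X w) (dyad T m i).
  have cQ t : (fun n => Q (m + n) (X w) t) @ \oo --> Qhat (X w) t.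
    have cQ : (fun n => Q n (X w) t) @ \oo --> Qhat (X w) t by exact: (@cvg_Q _ _ _ _ _ g0 wZ t).
    rewrite (_ : (fun n => Q (m + n) (X w) t) = (fun n => Q (n + m) (X w) t)).
      by rewrite (cvg_shiftn m (fun n => Q n (X w) t)).
    by apply/funext => n; rewrite addnC.
  rewrite (_ : (fun n => S m i k n w) =
      (fun n => Q (m + n) (X w) (dyad T m (i + k)) - Q (m + n) (X w) (dyad T m i))).
    by apply: cvgB; exact: cQ.
  by apply/funext => n; rewrite Q_dyad_increment.
apply/andP; split.
  apply: ler_cvg_to (cvg_cst 0) cS _; apply: nearW => n.
  by apply: sumr_ge0 => l _; exact: sqr_ge0.
rewrite leNgt; apply/negP => h; apply: nw.
case: k ik cS h => [|k] ik cS h.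
  by move: h; rewrite addn0 !subrr mulr0 ltxx.
set q := (X in X < _) in h; rewrite -subr_gt0 in h; set D := Qhat _ _ - Qhat _ _ in cS h.
have := near_infty_natSinv_lt (PosNum h) => -[e _ /(_ e (leqnn e)) /= he].
exists m => //; exists i => //; exists k.+1 => //; exists e => //; split => //.
have h2 : 0 < D - q - e.+1%:R^-1 by rewrite subr_gt0.
have /cvgrPdist_lt/(_ _ h2) := cS; apply: filterS => n /(le_lt_trans (ler_norm _)).
exact: gap_le.
Qed.

End quadratic_lipschitz.

(** * The completed measure and the augmented filtration *)

Section completion.
Context (R : realType) (T : {posnum R}) (P : probability (Borel T) R).

(** A name under which the completed measure carries its structure of
    probability. *)
Definition completion := @completed_measure_extension _ (Borel T) R P.

HB.instance Definition _ := Measure.on completion.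

Lemma completionE (A : set (Borel T)) : measurable A -> completion A = P A.
Proof. by move=> mA; rewrite /completion /completed_measure_extension measurable_mu_extE. Qed.

Let completion_setT : completion setT = 1%E.
Proof. by rewrite completionE// probability_setT. Qed.

HB.instance Definition _ := Measure_isProbability.Build _ _ R completion completion_setT.

Lemma Borel_completion (A : set (Borel T)) : measurable A ->
  (measurable : set (set (caratheodory_type (mu_ext P)))) A.
Proof. by move=> mA; exact: caratheodory_measurable_mu_ext. Qed.

Lemma negligible_completion (A : set (Borel T)) : P.-negligible A -> completion.-negligible A.
Proof.
by move=> [N [mN PN AN]]; exists N; split => //; [exact: Borel_completion|rewrite -PN; exact: completionE].
Qed.

Lemma completion_negligible_measurable (A : set (Borel T)) : P.-negligible A ->
  (measurable : set (set (caratheodory_type (mu_ext P)))) A.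
Proof. by move=> /negligible_completion; exact: measure_is_complete_caratheodory. Qed.

Lemma ae_completion (S : Borel T -> Prop) : {ae P, forall w, S w} -> {ae completion, forall w, S w}.
Proof. exact (@negligible_completion (~` [set w | S w])). Qed.

Lemma coord_measurable t : measurable_fun setT (@Defs.coord R T t : Borel T -> R).
Proof.
apply: (@measurability _ _ (Borel T) R setT (@Defs.coord R T t) _ (RGenOInfty.measurableE R)) => _ [_ [a ->] <-].
rewrite setTI; apply: sub_sigma_algebra.
have cc : continuous (fun x : Omega T => x t).
  move=> x; have FF : Filter (nbhs x) by exact: nbhs_filter.
  apply/cvgrPdist_lt => e e0; have /cvgrPdist_lt/(_ e e0) : id @ nbhs x --> x by [].
  apply: filterS => y; apply: le_lt_trans; exact: Omega_dist_le.
by move/continuousP : cc => /(_ `]a, +oo[%classic); apply; exact: interval_open.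
Qed.

Lemma natural_Borel u : natural T u `<=` (measurable : set (set (Borel T))).
Proof.
apply: smallest_sub; first exact: sigma_algebra_measurable.
by move=> _ [s _ [B mB <-]]; rewrite setTI -[_ @^-1` _]setTI; exact: coord_measurable.
Qed.

Lemma augmented_sigma_algebra t : sigma_algebra setT (augmented P t).
Proof. by apply: sigma_algebra_bigcap => u _; exact: smallest_sigma_algebra. Qed.

Lemma augmented_measurable t :
  augmented P t `<=` (measurable : set (set (caratheodory_type (mu_ext P)))).
Proof.
move=> A /(_ (t + 1)); rewrite /= in_itv/= ltrDl ltr01 => /(_ isT).
move: A; apply: smallest_sub; first exact: sigma_algebra_measurable.
move=> A [/natural_Borel|]; [exact: Borel_completion|exact: completion_negligible_measurable].
Qed.

Lemma augmented_le s t : s <= t -> augmented P s `<=` augmented P t.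
Proof.
move=> st A As u /=; rewrite in_itv/= andbT => tu; apply: As => /=.
by rewrite in_itv/= andbT (le_lt_trans st).
Qed.

End completion.

Arguments completion {R T} P _.

(** * Lipschitz brackets from bounded predictable densities *)

Section bounded_bracket_density.
Context (R : realType).

(** The sections of the generators are intervals or empty. *)
Lemma predictable_section (W : Type) (T : R) (F : R -> set (set W)) (C : set (W * R)) w :
  predictable_sets T F C -> measurable [set s | C (w, s)].
Proof.
move: C; apply: smallest_sub.
  split => [|A mA|A mA] /=.
  - by rewrite (_ : mkset _ = set0).
  - rewrite (_ : mkset _ = [set` `[0, T]] `\` [set s | A (w, s)]); first exact: measurableD.
    by apply/seteqP; split => s.
  - rewrite (_ : mkset _ = \bigcup_n [set s | A n (w, s)]); first exact: bigcup_measurable.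
    by apply/seteqP; split => s.
move=> C [[A _ <-]|[s [t [A [_ _ _ _ ->]]]]].
  have [Aw|Aw] := pselect (A w).
    rewrite (_ : mkset _ = [set 0]); first exact: measurable_set1.
    by apply/seteqP; split => u [].
  rewrite (_ : mkset _ = set0); first exact: measurable0.
  by apply/seteqP; split => u [].
have [Aw|Aw] := pselect (A w).
  rewrite (_ : mkset _ = [set` `]s, t]]); first exact: measurable_itv.
  by apply/seteqP; split => u; [case|split].
rewrite (_ : mkset _ = set0); first exact: measurable0.
by apply/seteqP; split => u [].
Qed.

Lemma predictable_section_fun (W : Type) (T : R) (F : R -> set (set W)) (a : W * R -> R) w :
  predictable T F a -> measurable_fun `[0, T] (fun s => a (w, s)).
Proof.
move=> pa _ B mB; have := @predictable_section W T F _ w (pa B mB).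
by congr measurable; apply/seteqP; split => s.
Qed.

(** Tonelli: the measure of a set is the integral of those of its sections. *)
Lemma ae_section d (W : measurableType d) (P : probability W R) (S : W * R -> Prop) :
  {ae (P \x (@lebesgue_measure R))%E, forall z, S z} ->
  {ae P, forall w, {ae (@lebesgue_measure R), forall s, S (w, s)}}.
Proof.
move=> [N [mN N0 SN]].
have m1 : measurable_fun setT ((@lebesgue_measure R) \o xsection N) by exact: measurable_fun_xsection.
have [N' [mN' N'0 SN']] : ae_eq P setT ((@lebesgue_measure R) \o xsection N) (cst 0%E).
  apply/ae_eq_integral_abs => //; rewrite -[RHS]N0; apply: eq_integral => w _.
  by rewrite gee0_abs.
exists N'; split => // w /= nw; apply: SN' => /= /(_ I) h; apply: nw.
exists (xsection N w); split; [exact: measurable_xsection|exact: h|].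
by move=> s /= ns; rewrite /xsection/= mem_set//; exact: SN.
Qed.

(** The density is first replaced by its truncation to [0, L], which changes it
    on a null set only and makes the integral additive in the interval. *)
Lemma integral_increment_le (T L : R) (a : R -> R) : 0 <= L -> measurable_fun `[0, T] a ->
  {ae (@lebesgue_measure R), forall s, s \in `[0, T] -> 0 <= a s <= L} ->
  forall s t, 0 <= s -> s <= t -> t <= T ->
  (\int[lebesgue_measure]_(u in `[0%R, t]) (a u)%:E <=
   \int[lebesgue_measure]_(u in `[0%R, s]) (a u)%:E + (L * (t - s))%:E)%E.
Proof.
move=> L0 ma aL s t s0 st tT.
pose a' u := Num.max 0 (Num.min (a u) L).
have sub u : u <= T -> [set` `[0, u]] `<=` [set` `[0, T]].
  by move=> uT v; rewrite /= !in_itv/= => /andP[-> /le_trans]; apply.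
have ma' : measurable_fun `[0, T] a'.
  by apply: measurable_maxr => //; exact: measurable_minr.
have a'0 u : 0 <= a' u by rewrite le_max lexx.
have a'L u : a' u <= L by rewrite ge_max L0 ge_min lexx orbT.
have E u : u <= T -> (\int[lebesgue_measure]_(v in `[0%R, u]) (a v)%:E = \int[lebesgue_measure]_(v in `[0%R, u]) (a' v)%:E)%E.
  move=> uT; apply: ae_eq_integral => //.
  - by apply/measurable_EFinP; apply: measurable_funS ma => //; exact: sub.
  - by apply/measurable_EFinP; apply: measurable_funS ma' => //; exact: sub.
  - apply: (negligibleS _ aL) => v /=; apply: contra_not => av /(sub u uT) vT; have /andP[h1 h2] := av vT.
    by rewrite /a' (min_idPl h2) (max_idPr h1).
rewrite !E ?(le_trans st)//.
have -> : `[0, t]%classic = `[0, s]%classic `|` `]s, t]%classic.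
  by rewrite -itv_bndbnd_setU// bnd_simp.
rewrite ge0_integral_setU//=; first last.
- apply/disj_setPS => v [] /=; rewrite !in_itv/= => /andP[_ vs] /andP[sv _].
  by move: (lt_le_trans sv vs); rewrite ltxx.
- by move=> v _; rewrite lee_fin.
- apply/measurable_EFinP; apply: measurable_funS ma' => // v [] /=; rewrite !in_itv/=.
    by move=> /andP[-> /le_trans]; apply; exact: le_trans st tT.
  by move=> /andP[sv vt]; rewrite (le_trans s0 (ltW sv)) (le_trans vt).
rewrite leeD2l//; apply: (@le_trans _ _ (\int[lebesgue_measure]_(v in `]s, t]) (cst L%:E v))%E).
  apply: ge0_le_integral => //.
  - by move=> v _; rewrite lee_fin.
  - apply/measurable_EFinP; apply: measurable_funS ma' => // v /=; rewrite !in_itv/=.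
    by move=> /andP[sv vt]; rewrite (le_trans s0 (ltW sv)) (le_trans vt).
  - by move=> v _; rewrite lee_fin.
rewrite integral_cst//= lebesgue_measure_itv/= lte_fin.
case: ltP => h; first by rewrite -EFinB -EFinM.
by rewrite mule0 lee_fin mulr_ge0// subr_ge0.
Qed.

Lemma bracket_lipschitz d (W : measurableType d) (P : probability W R) (T L : R)
    (F : R -> set (set W)) (V : R -> W -> R) (a : W * R -> R) : 0 <= L ->
  predictable T F a ->
  {ae (P \x (@lebesgue_measure R))%E, forall z, z.2 \in `[0, T] -> 0 <= a z <= L} ->
  {ae P, forall w, forall t, t \in `[0, T] ->
    ((V t w)%:E = \int[lebesgue_measure]_(s in `[0%R, t]) (a (w, s))%:E)%E} ->
  {ae P, forall w, forall s t, 0 <= s -> s <= t -> t <= T -> V t w - V s w <= L * (t - s)}.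
Proof.
move=> L0 pa aL VE; have aL' := ae_section aL.
apply: filterS2 aL' VE => w aw Vw s t s0 st tT.
rewrite lerBlDl -lee_fin EFinD !Vw ?in_itv/= ?s0 ?(le_trans s0 st) ?(le_trans st tT)//.
exact: (@integral_increment_le T L (fun s => a (w, s)) L0 (predictable_section_fun w pa) aw s t s0 st tT).
Qed.

End bounded_bracket_density.

(** * The capacity of the complement *)

Section martingale_measure_moments.
Context (R : realType) (T : {posnum R}) (L : R) (P : probability (Borel T) R).
Hypothesis L0 : 0 < L.
Hypothesis PM : Mclass T L P.

Let W : measurableType _ := caratheodory_type (mu_ext P).
Let X : W -> Omega T := fun w => w.
Let F : R -> set (set W) := augmented P.
Let sF t : 0 <= t <= T%:num -> sigma_algebra setT (F t) := fun _ => augmented_sigma_algebra P t.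
Let Fm t : 0 <= t <= T%:num -> F t `<=` (measurable : set (set W)) := fun _ => @augmented_measurable R T P t.
Let Fle s t : 0 <= s -> s <= t -> t <= T%:num -> F s `<=` F t := fun _ st _ => @augmented_le R T P s t st.

(** Everything the capacity bound needs from membership in [Mclass]. *)
Lemma martingale_measure_moments :
  [/\ forall t, 0 <= t <= T%:num -> sub_measurable (F t) (fun w => X w t),
      forall (s t : R) A, 0 <= s -> s <= t -> t <= T%:num -> F s A ->
        (\int[completion P]_(w in A) ((X w t - X w s) ^+ 2)%:E <= (L * (t - s))%:E * completion P A)%E &
      forall (l s t : R) A, 0 <= s -> s <= t -> t <= T%:num -> F s A ->
        (\int[completion P]_(w in A) (expR (l * (X w t - X w s)))%:E
          <= (expR (l ^+ 2 * L * (t - s)))%:E * completion P A)%E].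
Proof.
have [lM [V [a [[_ Vc lN] pa aL VE]]]] := PM.
have V0 w : V 0 w = 0 by have [] := Vc w.
have VL : {ae (completion P), forall w, forall s t, 0 <= s -> s <= t -> t <= T%:num -> V t w - V s w <= L * (t - s)}.
  have h := @bracket_lipschitz R _ (Borel T) P T%:num L (augmented P) V a (ltW L0) pa aL VE.
  exact: (@ae_completion R T P _ h).
split.
- move=> t tT; have [aM _ _] := lM; exact: (adapted_sub_measurable sF aM tT).
- move=> s t A; exact: (@local_energy_le _ W R (completion P) T%:num F sF Fm Fle L (@Defs.coord R T) V (ltW L0) lM lN V0 VL s t A).
- move=> l s t A; exact: (@local_exp_le _ W R (completion P) T%:num F sF Fm Fle L (@Defs.coord R T) V (ltW L0) lM lN V0 VL l s t A).
Qed.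

End martingale_measure_moments.

Section capacity_bound.
Context (R : realType).

Definition chaining_constant (eta : R) : R := 2 `^ eta * (1 + 2 / (1 - 2 `^ (- eta))).

(** With [a = A sqrt (L T) / chaining_constant eta], an increment of level [m]
    has tail [2 exp (- a^2 (2 r^2)^m / (4 L T))] for [r = 2 `^ (- eta)]; the
    rate is the coefficient of [A^2]. *)
Definition holder_rate (eta : R) : R := (4 * chaining_constant eta ^+ 2)^-1.

(** The coefficient of [B] in [bad_tail]. *)
Definition difference_rate (g : R) : R := (8 * (1 + (1 - 2 `^ (- g))^-1))^-1.

(** This is where both exponents have to be smaller than one half. *)
Lemma dyadic_ratio_gt1 (e : R) : 0 < e < 2^-1 -> 1 < 2 * (2 `^ (- e)) ^+ 2.
Proof.
move=> /andP[e0 e1]; have -> : 2 * (2 `^ (- e)) ^+ 2 = 2 `^ (1 - 2 * e).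
  rewrite -powR2_opp_expr powRD ?pnatr_eq0 ?implybT// powRr1//; congr (_ * 2 `^ (- _)); ring.
have h : 0 < 1 - 2 * e by lra.
by have /andP[_] := powR2_opp_itv h; rewrite powRN invf_lt1// powR_gt0.
Qed.

Lemma chaining_constant_gt0 (eta : R) : 0 < eta -> 0 < chaining_constant eta.
Proof.
move=> e0; have /andP[r0 r1] := powR2_opp_itv e0.
by rewrite mulr_gt0 ?powR_gt0// addr_gt0// divr_gt0// subr_gt0.
Qed.

Lemma holder_rate_gt0 (eta : R) : 0 < eta -> 0 < holder_rate eta.
Proof. by move=> e0; rewrite invr_gt0 mulr_gt0// exprn_gt0// chaining_constant_gt0. Qed.

Lemma difference_rate_itv (g : R) : 0 < g -> 0 < difference_rate g <= 8^-1.
Proof.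
move=> g0; have /andP[r0 r1] := powR2_opp_itv g0.
have i0 : 0 < (1 - 2 `^ (- g))^-1 by rewrite invr_gt0 subr_gt0.
rewrite invr_gt0 mulr_gt0 ?addr_gt0//= lef_pV2 ?posrE ?mulr_gt0 ?addr_gt0//.
by rewrite ler_peMr// lerDl ltW.
Qed.

Lemma half_difference_rate_le (g : R) : 0 < g -> difference_rate g / 2 <= 4^-1.
Proof. by move=> /difference_rate_itv/andP[_ h]; lra. Qed.

Definition tail_constant (c q C : R) := 0 < C /\ forall (z : R) m, 1 <= z ->
  expR (- (c * z * q ^+ m)) <= C * expR (- (c / 2 * z)) / 4 ^+ m.

(** The constants are wanted as functions of the exponent alone, hence a choice
    that precedes [T], [L], [A] and [B]. *)
Lemma tail_constant_exists (c : R -> R) : (forall e, 0 < e -> 0 < c e) ->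
  exists C : R -> R, forall e, 0 < e < 2^-1 -> tail_constant (c e) (2 * (2 `^ (- e)) ^+ 2) (C e).
Proof.
move=> c0.
have ex (e : R) : {C : R | 0 < e < 2^-1 -> tail_constant (c e) (2 * (2 `^ (- e)) ^+ 2) C}.
  apply: cid; have [e01|/negP ne] := boolP (0 < e < 2^-1); last by exists 0.
  have /andP[e0 _] := e01.
  have [C C0 HC] := superexp_tail (dyadic_ratio_gt1 e01) (c0 e e0).
  by exists C.
exists (fun e => sval (ex e)) => e; exact: svalP (ex e).
Qed.

Section martingale_measure.
Context (T : {posnum R}) (L : R) (P : probability (Borel T) R).
Hypothesis L0 : 0 < L.
Hypothesis PM : Mclass T L P.
Variables (eta g A B Ch Cg : R).
Hypothesis eta01 : 0 < eta < 2^-1.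
Hypothesis g01 : 0 < g < 2^-1.
Hypothesis A1 : 1 <= A.
Hypothesis B1 : 1 <= B.
Hypothesis hCh : tail_constant (holder_rate eta) (2 * (2 `^ (- eta)) ^+ 2) Ch.
Hypothesis hCg : tail_constant (difference_rate g) (2 * (2 `^ (- g)) ^+ 2) Cg.

Let W : measurableType _ := caratheodory_type (mu_ext P).
Let X : W -> Omega T := fun w => w.
Let F : R -> set (set W) := augmented P.
Let sF t : 0 <= t <= T%:num -> sigma_algebra setT (F t) := fun _ => augmented_sigma_algebra P t.
Let Fm t : 0 <= t <= T%:num -> F t `<=` (measurable : set (set W)) := fun _ => @augmented_measurable R T P t.
Let Fle s t : 0 <= s -> s <= t -> t <= T%:num -> F s `<=` F t := fun _ st _ => @augmented_le R T P s t st.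

(** By [dyadic_chaining], a path outside the Hölder ball has an increment of
    some level [m] above [a r ^ m]. *)
Lemma holder_tail : exists E : set W, [/\ measurable E,
  (completion P E <= (4 * Ch * expR (- (holder_rate eta / 2 * A ^+ 2)))%:E)%E &
  forall w : W, ~ (holder_norm eta (X w) <= (A * Num.sqrt L * T%:num `^ (2^-1 - eta))%:E)%E -> E w].
Proof.
have [aX _ expX] := martingale_measure_moments L0 PM.
have /andP[eta0 _] := eta01; have C10 := chaining_constant_gt0 eta0.
pose a := A * Num.sqrt (L * T%:num) / chaining_constant eta.
have A0 : 0 < A by exact: lt_le_trans A1.
have LT0 : 0 < L * T%:num by rewrite mulr_gt0.
have S0 : 0 < Num.sqrt (L * T%:num) by rewrite sqrtr_gt0.
have a0 : 0 < a by rewrite divr_gt0// mulr_gt0.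
have [Ch0 HCh] := hCh.
have /andP[r0 _] := powR2_opp_itv eta0; set r := 2 `^ (- eta) in r0 HCh.
have A2 : 1 <= A ^+ 2 by rewrite exprn_ege1.
have cz : holder_rate eta * A ^+ 2 = a ^+ 2 / (4 * L * T%:num).
  have -> : 4 * L * T%:num = 4 * Num.sqrt (L * T%:num) ^+ 2 by rewrite sqr_sqrtr ?(ltW LT0)// mulrA.
  rewrite /a /holder_rate; move: (chaining_constant eta) C10 (Num.sqrt _) S0 => C1 C10 S S0.
  by field; rewrite !gt_eqF.
exists (\bigcup_m [set w | exists2 k, (k < 2 ^ m)%N & a * r ^+ m < `|X w (dyad T m k.+1) - X w (dyad T m k)|]).
split.
- apply: bigcup_measurable => m _.
  apply: (@measurable_exists _ W [set k | (k < 2 ^ m)%N]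
    (fun k => [set w | a * r ^+ m < `|X w (dyad T m k.+1) - X w (dyad T m k)|])) => k _.
  apply: measurable_gt_cst; apply: measurable_absr; apply: measurable_funB; exact: (coordinate_measurable sF Fm aX).
- exact: (@increments_tail _ W R T (completion P) F sF Fm Fle L X L0 aX expX _ _ Ch a (A ^+ 2)
    (fun m => HCh _ m A2) a0 Ch0 r r0 cz erefl).
- move=> w; apply: contra_notP => nE.
  have incr m k : (k < 2 ^ m)%N -> `|X w (dyad T m k.+1) - X w (dyad T m k)| <= a * r ^+ m.
    by move=> km; rewrite leNgt; apply/negP => h; apply: nE; exists m => //; exists k.
  apply: le_trans (dyadic_chaining eta0 (ltW a0) incr) _.
  have -> : T%:num `^ (2^-1 - eta) = Num.sqrt T%:num / T%:num `^ eta.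
    rewrite powRD; first by rewrite powR12_sqrt// powRN.
    by rewrite (gt_eqF (gt0 T)) implybT.
  rewrite lee_fin -/(chaining_constant eta) /a sqrtrM ?(ltW L0)//.
  have Te : 0 < T%:num `^ eta by rewrite powR_gt0.
  rewrite le_eqVlt; apply/orP; left; apply/eqP.
  move: (chaining_constant eta) C10 => C1 C10; field.
  by rewrite !gt_eqF.
Qed.

(** The complement is open, as [Kset] is compact, hence Borel; on Borel sets the
    completed measure is [P]. *)
Lemma Kset_complement_tail : (P (~` Kset T L eta g A B) <=
  (4 * Ch * expR (- (holder_rate eta / 2 * A ^+ 2))
   + (2 + 4 * Cg) * expR (- (difference_rate g / 2 * B)))%:E)%E.
Proof.
have [aX energyX expX] := martingale_measure_moments L0 PM.
have /andP[g0 _] := g01; have /andP[eta0 _] := eta01.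
have [E1 [mE1 PE1 hE1]] := holder_tail.
have [Cg0 HCg] := hCg.
have [E2 [mE2 PE2 hE2]] := @Zgamma_tail _ W R T (completion P) F sF Fm Fle L X L0 aX expX g B g01 B1 Cg Cg0 HCg.
have nE3 := @Qhat_lipschitz_ae _ W R T (completion P) F sF Fm Fle L X L0 aX energyX expX g (B * L * T%:num) g0.
set E3 := [set w | _] in nE3.
have mE3 : measurable (E3 : set W) by exact: measure_is_complete_caratheodory.
have mK : measurable (~` Kset T L eta g A B : set (Borel T)).
  apply: measurableC; rewrite -[Kset _ _ _ _ _ _]setCK; apply: measurableC; apply: sub_sigma_algebra.
  apply: closed_openC; apply: compact_closed; first exact: norm_hausdorff.
  exact: Kset_compact.
have sub : ~` Kset T L eta g A B `<=` E1 `|` E2 `|` E3.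
  move=> w nK; apply: contrapT => nE; apply: nK.
  have h1 : (holder_norm eta w <= (A * Num.sqrt L * T%:num `^ (2^-1 - eta))%:E)%E.
    by apply: contrapT => /hE1 ?; apply: nE; left; left.
  have h2 : (Zgamma g w <= (B * L * T%:num)%:E)%E.
    by apply: contrapT => /hE2 ?; apply: nE; left; right.
  by split => //; apply: contrapT => h; apply: nE; right.
rewrite -(completionE P mK).
apply: (@le_trans _ _ (completion P (E1 `|` E2 `|` E3))).
  apply: le_measure => //; rewrite inE; first exact: Borel_completion.
  by apply: measurableU => //; exact: measurableU.
apply: le_trans (measureU2 _ (measurableU _ _ mE1 mE2) mE3) _.
rewrite (measure_negligible mE3 nE3) adde0.
apply: le_trans (measureU2 _ mE1 mE2) _; apply: le_trans (leeD PE1 PE2) _.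
rewrite -EFinD lee_fin lerD2l (mulrDl 2) lerD2r ler_wpM2l// ler_expR lerN2.
rewrite [leRHS]mulrC; apply: ler_wpM2r; first exact: le_trans B1.
exact: half_difference_rate_le.
Qed.

End martingale_measure.

End capacity_bound.

Theorem theorem5p5 (R : realType) :
  exists (Ceta ceta kappa Cgamma cgamma : R -> R) (Cetagamma : R -> R -> R),
  forall (eta gamma : R), 0 < eta < 2^-1 -> 0 < gamma < Num.min 2^-1 (2 * eta) ->
  [/\ [/\ 0 < Ceta eta, 0 < ceta eta, 0 < Cgamma gamma, 0 < cgamma gamma &
          0 < Cetagamma eta gamma] &
  forall (T : {posnum R}) (Lambda : R), 0 < Lambda ->
  let K := Kset T Lambda eta gamma in
  let alpha := gamma / (1 - eta + gamma) in
  [/\ forall A B : R, 1 <= A -> 1 <= B -> compact (K A B) /\ K A B `<=` Gdyad T,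
      forall A B A' B' : R, 1 <= A -> 1 <= B -> A <= A' -> B <= B' ->
        K A B `<=` K A' B',
      forall A B : R, 1 <= A -> 1 <= B ->
        (capacity Lambda (~` K A B)
          <= (Ceta eta * expR (- (ceta eta * A ^+ 2))
              + Cgamma gamma * expR (- (cgamma gamma * B)))%:E)%E,
      forall A B : R, 1 <= A -> 1 <= B ->
        [/\ forall e : R, 0 < e -> exists2 d : R, 0 < d &
              forall x y : Omega T, K A B x -> K A B y -> `|x - y| < d ->
                `|Qhat x - Qhat y| < e,
            forall n : nat, (1 <= n)%N ->
              (ereal_sup [set `|Q n x - Qhat x|%:E | x in K A B]
                <= (Cgamma gamma * B * Lambda * T%:num
                    * 2 `^ (- (gamma * n%:R)))%:E)%E &
            0 < alpha /\
            forall x y : Omega T, K A B x -> K A B y ->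
              `|Qhat x - Qhat y|
                <= Cetagamma eta gamma * A `^ alpha * B `^ (1 - alpha)
                   * (Lambda * T%:num) `^ (1 - alpha / 2)
                   * `|x - y| `^ alpha] &
      forall A B : R, 1 <= A -> 1 <= B ->
        (forall (x : Omega T) (s : R), K A B x -> s \in `[0, T%:num] ->
           K A B (stop s x)) /\
        (forall (x y : Omega T) (s : R), s \in `[0, T%:num] ->
           K A B x -> K A B y ->
           K (2 `^ (1 - eta) * A) (3 * B + kappa eta * A ^+ 2)
             (concat s x y))]].
Proof.
have [Ch hCh] := @tail_constant_exists R (@holder_rate R) (@holder_rate_gt0 R).
have dr0 (e : R) : 0 < e -> 0 < difference_rate e by move=> /difference_rate_itv/andP[].
have [Cg hCg] := @tail_constant_exists R (@difference_rate R) dr0.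
exists (fun eta => 4 * Ch eta), (fun eta => holder_rate eta / 2), (fun=> 8),
  (fun g => 2 + 4 * Cg g + (1 - 2 `^ (- g))^-1), (fun g => difference_rate g / 2),
  (fun eta g => (2 `^ g + 1) * ((2 / (1 - 2 `^ (- g))) `^ (1 - g / (1 - eta + g))
        * 8 `^ (g / (1 - eta + g)))).
move=> eta g eta01; rewrite lt_min => /and3P[g0 g1 g2].
have g01 : 0 < g < 2^-1 by rewrite g0.
have /andP[eta0 eta1] := eta01.
have [Ch0 _] := hCh eta eta01; have [Cg0 _] := hCg g g01.
have /andP[r0 r1] := powR2_opp_itv g0.
have i0 : 0 < (1 - 2 `^ (- g))^-1 by rewrite invr_gt0 subr_gt0.
split.
  split.
  - by rewrite mulr_gt0.
  - by rewrite divr_gt0// holder_rate_gt0.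
  - by rewrite !addr_gt0// mulr_gt0.
  - by rewrite divr_gt0// dr0.
  - rewrite mulr_gt0 ?addr_gt0 ?powR_gt0// mulr_gt0 ?powR_gt0// mulr_gt0//.
move=> T L L0 K alpha.
have al0 : 0 < alpha by rewrite divr_gt0// addr_gt0// subr_gt0 (lt_trans eta1)// invf_lt1// ltr1n.
split.
- move=> A B A1 B1; split; first exact: Kset_compact.
  exact: Kset_Gdyad.
- move=> A B A' B' _ _ AA BB; exact: KsetS (ltW L0) AA BB.
- move=> A B A1 B1; apply: ge_ereal_sup => _ [P PM <-].
  apply: le_trans (Kset_complement_tail L0 PM eta01 g01 A1 B1 (hCh eta eta01) (hCg g g01)) _.
  by rewrite lee_fin lerD2l ler_wpM2r ?expR_ge0// lerDl ltW.
- move=> A B A1 B1.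
  have hol x y : K A B x -> K A B y -> _ := @Kset_Qhat_dist R T L eta g A B x y L0 eta01 g0 A1 B1.
  split; last by split.
  + move=> e e0; set C : R := (2 `^ g + 1) * _ * A `^ alpha * B `^ (1 - alpha) * (L * T%:num) `^ (1 - alpha / 2) in hol.
    have C0 : 0 <= C by rewrite !mulr_ge0 ?powR_ge0// addr_ge0 ?powR_ge0.
    have [d d0 Hd] := holder_modulus al0 C0 e0; exists d => // x y Kx Ky xy.
    apply: le_lt_trans (hol x y Kx Ky) _; apply: le_lt_trans Hd.
    by apply: ler_wpM2l => //; apply: ge0_ler_powR; rewrite ?nnegrE// ltW.
  + move=> n n1; apply: le_trans (Kset_Q_dist _ _ _ _ _ g0 n1) _.
    rewrite lee_fin ler_wpM2r ?powR_ge0// ler_wpM2r// ler_wpM2r ?(ltW L0)// ler_wpM2r ?(le_trans _ B1)//.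
    by rewrite lerDr addr_ge0// mulr_ge0// ltW.
- move=> A B A1 B1; split=> [x s Kx|x y s]; rewrite in_itv/= => sT.
    exact: Kset_stop.
  move=> Kx Ky; exact: Kset_concat.
Qed.
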